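(* There exists a unique pair of families of shuffle homomorphisms $f^{(0)}(\bullet;z),\ f^{(1)}(\bullet;z): S\to\mathbf{C}$ ($z\in\mathbf{D}_0\cap\mathbf{D}_1$) which satisfy $$f^{(0)}(\xi_0;z)=\log z,\qquad f^{(1)}(\xi_0;z)=\log(1-z),$$ and the following three conditions: (i) For any word $w\in S$, $$\sum_{uv=w} f^{(1)}(\tau(u);z)\, f^{(0)}(v;z)=\zeta(\mathrm{reg}^{10}(w))\qquad (z\in\mathbf{D}_0\cap\mathbf{D}_1).$$ (ii) For any word $w\in S^{10}$, $f^{(0)}(w;z)$ and $f^{(1)}(w;z)$ are holomorphic on $\mathbf{D}_0$ and $\mathbf{D}_1$ respectively, and satisfy, for $i=0,1$, the asymptotic condition $$\frac{d}{dz}f^{(i)}(w;z)\to 0\qquad (z\to\infty,\ z\in\mathbf{D}_i).$$ (iii) For any non-empty word $w\in S^{10}$, $f^{(0)}(w;0)=0$. Moreover, the solutions are expressed in terms of extended multiple polylogarithms: for every word $w \in S$, $$f^{(0)}(w;z)=\mathrm{Li}(w;z),\qquad f^{(1)}(w;z)=\mathrm{Li}(w;1-z).$$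
   Context: Domains: $\mathbf{D}_0=\mathbf{C}\setminus\{x\in\mathbf{R}: x\ge 1\}$, $\mathbf{D}_1=\mathbf{C}\setminus\{x\in\mathbf{R}: x\le 0\}$. $\log z$ denotes the principal branch on $\mathbf{D}_1$, and $\log(1-z)$ the principal branch on $\mathbf{D}_0$. Shuffle algebra: $\xi_0=\frac{dz}{z}$, $\xi_1=\frac{dz}{1-z}$. $S=S(\xi_0,\xi_1)$ is the vector space $\mathbf{C}\langle\xi_0,\xi_1\rangle$ of non-commutative polynomials in the letters $\xi_0,\xi_1$ (with basis the words; the empty word is denoted $\mathbf{1}$), equipped with the shuffle product ⧢, the bilinear product defined recursively by $w$ ⧢ $\mathbf{1}=\mathbf{1}$ ⧢ $w=w$ and $(\xi_{i}w_1)$ ⧢ $(\xi_{j}w_2)=\xi_{i}\big(w_1$ ⧢ $(\xi_{j}w_2)\big)+\xi_{j}\big((\xi_{i}w_1)$ ⧢ $w_2\big)$. A shuffle homomorphism $S\to\mathbf{C}$ is a (unital) $\mathbf{C}$-algebra homomorphism from $(S,$ ⧢$)$ to $\mathbf{C}$. Juxtaposition and powers such as $\xi_0^j$ denote concatenation. A sum $\sum_{uv=w}$ runs over all factorizations of the word $w$ as a concatenation of two (possibly empty) words $u,v$. $\tau:S\to S$ is the linear map reversing words and exchanging letters, i.e. the anti-automorphism for concatenation with $\tau(\xi_0)=\xi_1$, $\tau(\xi_1)=\xi_0$. Subalgebras: $S^0=\mathbf{C}\mathbf{1}+S\xi_1$, $S^{10}=\mathbf{C}\mathbf{1}+\xi_0S\xi_1$.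 Every $w\in S$ can be written uniquely as $w=\sum_j w_j$ ⧢ $\xi_0^j$ with $w_j\in S^0$, and uniquely as $w=\sum_{i,j}\xi_1^i$ ⧢ $w_{ij}$ ⧢ $\xi_0^j$ with $w_{ij}\in S^{10}$ (finite sums). The regularizing map $\mathrm{reg}^{10}:S\to S^{10}$ is defined by $\mathrm{reg}^{10}(w)=w_{00}$. Multiple polylogarithms: for a word $w=\xi_{i_1}\cdots\xi_{i_r}\in S^0$ (so $i_r=1$ if $r\ge1$) and $z\in\mathbf{D}_0$, $\mathrm{Li}(w;z)=\int_0^z w$ is the iterated integral along a path in $\mathbf{D}_0$, defined recursively by $\int_0^z\mathbf{1}=1$ and $\int_0^z w=\int_0^z\xi_{i_1}(t)\big(\int_0^t\xi_{i_2}\cdots\xi_{i_r}\big)$, extended linearly to $S^0$; it is holomorphic on $\mathbf{D}_0$, and $\mathrm{Li}(\xi_0^{k_1-1}\xi_1\cdots\xi_0^{k_r-1}\xi_1;z)=\sum_{n_1>\cdots>n_r>0}\frac{z^{n_1}}{n_1^{k_1}\cdots n_r^{k_r}}$ for $|z|<1$. The extended multiple polylogarithm of $w=\sum_j w_j$ ⧢ $\xi_0^j\in S$ ($w_j\in S^0$) is $\mathrm{Li}(w;z)=\sum_j\mathrm{Li}(w_j;z)\frac{\log^j z}{j!}$, holomorphic on $\mathbf{D}_0\cap\mathbf{D}_1$. Multiple zeta values: $\zeta:S^{10}\to\mathbf{C}$ is the linear map $\zeta(w)=\lim_{z\to1,\,z\in\mathbf{D}_0\cap\mathbf{D}_1}\mathrm{Li}(w;z)$;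 so $\zeta(\mathbf{1})=1$ and $\zeta(\xi_0^{k_1-1}\xi_1\cdots\xi_0^{k_r-1}\xi_1)=\sum_{n_1>\cdots>n_r>0}\frac{1}{n_1^{k_1}\cdots n_r^{k_r}}$ for $k_1\ge2$, $k_2,\dots,k_r\ge1$. Convention: for a word $w\in S^{10}$, saying that $f^{(i)}(w;z)$ is holomorphic on $\mathbf{D}_i$ means that the function of $z\in\mathbf{D}_0\cap\mathbf{D}_1$ extends to a holomorphic function on $\mathbf{D}_i$; the conditions at $z\to\infty$ and at $z=0$ refer to this extension. *)

(* Defs.v *)
(* Algebra in MathComp and multinomials, complex analysis in Coquelicot. *)
From HB Require Import structures.
From Stdlib Require Import Reals Lra ClassicalEpsilon.
From mathcomp Require Import all_boot all_algebra.
From mathcomp Require Import finmap boolp.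
From mathcomp Require Import monalg.
From Coquelicot Require Import Coquelicot.

Set Implicit Arguments.
Unset Strict Implicit.
Unset Printing Implicit Defensive.

(* MathComp binds the key R to ring_scope. *)
Delimit Scope R_scope with coqR.

HB.instance Definition _ := gen_eqMixin C.
HB.instance Definition _ := gen_choiceMixin C.

Lemma Cadd0l : left_id (RtoC 0) Cplus.
Proof. exact: Cplus_0_l. Qed.
Lemma CaddNl : left_inverse (RtoC 0) Copp Cplus.
Proof. by move=> x; rewrite Cplus_comm; exact: Cplus_opp_r. Qed.

HB.instance Definition _ :=
  GRing.isZmodule.Build C Cplus_assoc Cplus_comm Cadd0l CaddNl.

Lemma C1_neq0 : RtoC 1 != RtoC 0.
Proof. by apply/eqP; exact: C1_nz. Qed.
Lemma Cmul1l : left_id (RtoC 1) Cmult.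
Proof. exact: Cmult_1_l. Qed.
Lemma CmulDl : left_distributive Cmult Cplus.
Proof. by move=> x y z; exact: Cmult_plus_distr_r. Qed.

HB.instance Definition _ :=
  GRing.Zmodule_isComNzRing.Build C Cmult_assoc Cmult_comm Cmul1l CmulDl
    C1_neq0.

Lemma CmulVl (x : C) : x != RtoC 0 -> Cmult (Cinv x) x = RtoC 1.
Proof. by move/eqP => x0; exact: Cinv_l. Qed.
Lemma Cinv0 : Cinv (RtoC 0) = RtoC 0.
Proof. by rewrite /Cinv /= /Rdiv Ropp_0 !Rmult_0_l. Qed.

HB.instance Definition _ := GRing.ComNzRing_isField.Build C CmulVl Cinv0.

Definition D0 (z : C) : Prop := ~ (Im z = 0%coqR /\ (1 <= Re z)%coqR).
Definition D1 (z : C) : Prop := ~ (Im z = 0%coqR /\ (Re z <= 0)%coqR).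

Definition D01 : Type := {z : C | D0 z /\ D1 z}.
Definition D01_val (z : D01) : C := proj1_sig z.
Coercion D01_val : D01 >-> C.

(* Principal logarithm on D1: half-angle formula for the argument, where
   Cmod z + Re z > 0.  Values outside D1 are irrelevant. *)
Definition Clog (z : C) : C :=
  (ln (Cmod z), (2 * atan (Im z / (Cmod z + Re z)))%coqR).

Lemma Clog_principal (z : C) : D1 z ->
  (- PI < Im (Clog z) < PI)%coqR /\
  Cmult (RtoC (exp (Re (Clog z)))) (cos (Im (Clog z)), sin (Im (Clog z))) = z.
Proof.
case: z => x y; rewrite /D1 /Clog /Re /Im /= => H.
set r := Cmod (x, y).
have r2 : (r * r = x * x + y * y)%coqR.
  rewrite /r /Cmod /= sqrt_sqrt; nra.
have r0 : (0 <= r)%coqR by exact: Cmod_ge_0.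
have rx : (0 < r + x)%coqR.
  case: (Rlt_le_dec 0 (r + x)) => // rx.
  have y2 : (0 <= (r - x) * - (r + x))%coqR by apply: Rmult_le_pos; lra.
  have y0 : y = 0%coqR by nra.
  by case: H; split=> //; lra.
have rp : (0 < r)%coqR.
  case: (Rle_lt_dec r 0) => // rle0.
  have re : r = 0%coqR by lra.
  by rewrite re in r2 rx; nra.
split; first by have := atan_bound (y / (r + x)); lra.
rewrite exp_ln // cos_2a sin_2a.
set t := (y / (r + x))%coqR.
rewrite cos_atan sin_atan.
have Ht : (0 < 1 + t²)%coqR by rewrite /Rsqr; nra.
have Hs := sqrt_sqrt (1 + t²) (Rlt_le _ _ Ht).
have sp := sqrt_lt_R0 _ Ht.
set s := sqrt (1 + t²).
rewrite -/s in Hs sp; rewrite /Rsqr in Hs.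
have E1 : (1 / s * (1 / s) - t / s * (t / s) = (1 - t * t) / (1 + t * t))%coqR.
  by rewrite -Hs; field; lra.
have E2 : (2 * (t / s) * (1 / s) = 2 * t / (1 + t * t))%coqR.
  by rewrite -Hs; field; lra.
rewrite E1 E2 /Cmult /=.
have E3 : (1 + t * t = 2 * r / (r + x))%coqR.
  rewrite /t. apply: (Rmult_eq_reg_r ((r + x) * (r + x))); last nra.
  have -> : (2 * r / (r + x) * ((r + x) * (r + x)) = 2 * r * (r + x))%coqR.
    field; lra.
  have -> : ((1 + y / (r + x) * (y / (r + x))) * ((r + x) * (r + x)) =
     (r + x) * (r + x) + y * y)%coqR by field; lra.
  nra.
rewrite E3; congr pair.
- have -> : (1 - t * t = 2 - 2 * r / (r + x))%coqR by lra.
  field; lra.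
- rewrite /t; field; lra.
Qed.

Local Open Scope ring_scope.

(* A letter is a boolean: false is xi_0 = dz/z, true is xi_1 = dz/(1-z).
   The ring product of Sxi is concatenation. *)
Definition word : choiceType := {fmonom bool}.
Definition Sxi := {malg C[{fmonom bool}]}.

Definition letter (i : bool) : Sxi := << FMonom [:: i] >>.
Notation xi0 := (letter false).
Notation xi1 := (letter true).

Definition lin_ext (V : lmodType C) (h : word -> V) (a : Sxi) : V :=
  \sum_(u <- msupp a) a@_u *: h u.

Fixpoint shuffle_word (u : seq bool) : seq bool -> Sxi :=
  match u with
  | [::] => fun v => << FMonom v >>
  | i :: u' =>
      fix shuffle_u (v : seq bool) : Sxi :=
        match v with
        | [::] => << FMonom u >>
        | j :: v' => letter i * shuffle_word u' v + letter j * shuffle_u v'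
        end
  end.

Definition shuffle (a b : Sxi) : Sxi :=
  lin_ext (fun u => lin_ext (fun v => shuffle_word u v) b) a.
Notation "a '\sh' b" := (shuffle a b) (at level 40, left associativity).

Definition shuffle_hom (f : Sxi -> C) : Prop :=
  [/\ scalar f, f 1 = 1 & forall a b : Sxi, f (a \sh b) = f a * f b].

Definition tau_word (w : word) : word := FMonom (rev (map negb w)).
Definition tau (a : Sxi) : Sxi := lin_ext (fun u => << tau_word u >>) a.

Definition S0 (a : Sxi) : Prop := exists (c : C) (b : Sxi), a = c *: 1 + b * xi1.
Definition S10 (a : Sxi) : Prop :=
  exists (c : C) (b : Sxi), a = c *: 1 + xi0 * b * xi1.

(* The element w_00 in the unique expansion of w. *)
Definition is_reg10 (w x : Sxi) : Prop :=
  exists (n : nat) (c : nat -> nat -> Sxi),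
    [/\ forall i j, S10 (c i j),
        w = \sum_(i < n.+1) \sum_(j < n.+1) xi1 ^+ i \sh c i j \sh xi0 ^+ j
      & x = c 0%N 0%N].
Definition reg10 (w : Sxi) : Sxi := epsilon (inhabits 0) (is_reg10 w).

Definition form (i : bool) (t : C) : C :=
  if i then Cinv (Cminus (RtoC 1) t) else Cinv t.

(* The iterated integral from 0 to z, along the segment t = s z, which lies
   in D0 as D0 is star-shaped about 0.  For words of S0 other than the empty
   one, the integrand is bounded near s = 0, so its value at s = 0 is
   irrelevant. *)
Fixpoint iter_int (w : seq bool) (z : C) : C :=
  match w with
  | [::] => RtoC 1
  | i :: w' =>
      RInt (V := C_R_CompleteNormedModule)
        (fun s : R => Cmult (Cmult (form i (Cmult (RtoC s) z)) z)
                            (iter_int w' (Cmult (RtoC s) z)))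
        0%coqR 1%coqR
  end.

Definition Li0 (w : Sxi) (z : C) : C :=
  lin_ext (V := C^o) (fun u => iter_int u z) w.

(* The extension of Li0 from S0 to Sxi, through the unique expansion of w. *)
Definition is_Li (w : Sxi) (z y : C) : Prop :=
  exists (n : nat) (c : nat -> Sxi),
    [/\ forall j, S0 (c j),
        w = \sum_(j < n.+1) c j \sh xi0 ^+ j
      & y = \sum_(j < n.+1) Li0 (c j) z * (Clog z ^+ j / j`!%:R)].
Definition Li (w : Sxi) (z : C) : C := epsilon (inhabits 0) (is_Li w z).

Definition zeta (w : Sxi) : C :=
  iota (T := C_CompleteNormedModule) (fun l =>
    filterlim (Li w) (within (fun z : C => D0 z /\ D1 z) (locally (RtoC 1)))
      (locally l)).

Definition holomorphic (D : C -> Prop) (F : C -> C) : Prop :=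
  forall z, D z -> ex_derive (K := C_AbsRing) (V := C_NormedModule) F z.

(* F extends f from D01 to D; for D = D0 or D1 such an F is unique on D, as
   D01 is dense in D. *)
Definition holo_ext (D : C -> Prop) (f : D01 -> C) (F : C -> C) : Prop :=
  holomorphic D F /\ forall z : D01, F z = f z.

(* The neighbourhood filter of the point at infinity of C. *)
Definition at_infinity (P : C -> Prop) : Prop :=
  exists M : R, forall z : C, (M < Cmod z)%coqR -> P z.

Definition deriv_vanishes (D : C -> Prop) (F : C -> C) : Prop :=
  filterlim (C_derive F) (within D at_infinity) (locally (RtoC 0)).

Record solution (f0 f1 : D01 -> Sxi -> C) : Prop := Solution {
  sol_hom0 : forall z, shuffle_hom (f0 z);
  sol_hom1 : forall z, shuffle_hom (f1 z);
  sol_log0 : forall z : D01, f0 z xi0 = Clog z;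
  sol_log1 : forall z : D01, f1 z xi0 = Clog (Cminus (RtoC 1) z);
  sol_connection : forall (w : word) (z : D01),
    \sum_(k < (size w).+1)
      f1 z (tau << FMonom (take k w) >>) * f0 z << FMonom (drop k w) >>
    = zeta (reg10 << w >>);
  sol_holo0 : forall w : word, S10 << w >> ->
    exists F, holo_ext D0 (fun z => f0 z << w >>) F /\ deriv_vanishes D0 F;
  sol_holo1 : forall w : word, S10 << w >> ->
    exists F, holo_ext D1 (fun z => f1 z << w >>) F /\ deriv_vanishes D1 F;
  sol_init : forall w : word, S10 << w >> -> size w != 0%N ->
    exists F, holo_ext D0 (fun z => f0 z << w >>) F /\ F (RtoC 0) = RtoC 0
}.

(* Main.v *)
(** Uniqueness: two solutions agree on words of length at most n by induction.
    For a word w of S10 of length n+1, condition (i) gives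
    (f0 - g0)(w) + (f1 - g1)(tau w) = 0 once shorter words agree, so f0(w) - g0(w)
    extends to an entire function whose derivative vanishes at infinity; comparing
    its mean values over large circles around two points shows that it is
    constant, hence zero by (iii).  All other words are obtained from those of S10
    by shuffling with xi0 on the right and xi1 on the left.

    Existence: the function L(w; z) = Li(w; z) satisfies L(xi_i w)' = xi_i L(w),
    and this differential equation with the behaviour at 0 makes it a shuffle
    homomorphism.  The left-hand side of (i) has derivative zero, hence is a
    constant phi(w), and phi is a shuffle homomorphism vanishing at xi0 and xi1.
    Condition (i) read backwards bounds L(w; z) near 1 by powers of log(1 - z), so
    phi(w) is the limit of L(w; z) at 1 when w lies in S10; thus phi and
    zeta o reg10 coincide. *)
From Stdlib Require Import Reals Lra Lia Classical ClassicalEpsilon.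
From mathcomp Require Import all_boot all_algebra.
From mathcomp Require Import finmap boolp.
From mathcomp Require Import monalg zify.
From Coquelicot Require Import Coquelicot.
Require Import Defs.

Set Implicit Arguments.
Unset Strict Implicit.
Unset Printing Implicit Defensive.

(** Holomorphy means pointwise complex differentiability, and condition (ii) controls only a
    derivative at infinity. Goursat's theorem on rectangles supplies both tools for this setting. In
    the coordinate [s] with [z = a + exp s], circles become vertical segments, which yields the mean
    value property of entire functions; and it yields primitives on [D0]. The form xi0 has a pole at
    0, so holomorphy of iterated integrals is proved together with a factorization [z * v z], [v]
    holomorphic, which cancels the pole in the next integration. Near 0 and 1, functions are
    measured against [|z|^p (1 + |log z|)^k]. The exponent [p = 1] forces the limit 0 in spite of
    the logarithms, and this fixes all constants of integration. That the connection constant is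
    multiplicative is pure algebra: deconcatenation is compatible with the shuffle product, so the
    convolution of two characters is a character. *)

Local Notation CderivE := (is_derive (K := C_AbsRing) (V := C_NormedModule)).
Local Notation RderivE := (is_derive (K := R_AbsRing) (V := C_R_NormedModule)).
Local Notation CInt := (RInt (V := C_R_CompleteNormedModule)).
Local Notation isCInt := (is_RInt (V := C_R_NormedModule)).
Local Notation exCInt := (ex_RInt (V := C_R_NormedModule)).
Local Notation ccont := (continuous (T:=R_UniformSpace) (U:=C_UniformSpace)).

(** * Holomorphic functions *)

Section ComplexAnalysis.
Local Open Scope R_scope.
Lemma Cmod_normR (x : C) : norm (V:=C_R_NormedModule) x = Cmod x.
Proof. by rewrite Cmod_norm. Qed.

Lemma is_deriveC_eps (f : C -> C) z l : CderivE f z l <->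
 forall eps, 0 < eps -> exists del, 0 < del /\ forall w, Cmod (w - z)%C < del ->
  Cmod (f w - f z - (w - z) * l)%C <= eps * Cmod (w - z)%C.
Proof.
split.
- move=> [_ H] eps e0.
  have [d Hd] := H z (fun P HP => HP) (mkposreal eps e0).
  exists d; split; first exact: cond_pos.
  by move=> w Hw; apply: (Hd w Hw).
- move=> H; split; first exact: is_linear_scal_l.
  move=> x Hx eps.
  have {Hx} <- := is_filter_lim_locally_unique _ _ Hx.
  have [d [d0 Hd]] := H eps (cond_pos eps).
  exists (mkposreal d d0) => w Hw.
  exact: (Hd w Hw).
Qed.

Lemma is_deriveR_eps (f : R -> C) (z : R) l : RderivE f z l <->
 forall eps, 0 < eps -> exists del, 0 < del /\ forall w, Rabs (w - z) < del ->
  Cmod (f w - f z - RtoC (w - z) * l)%C <= eps * Rabs (w - z).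
Proof.
have E w : Cmod (f w - f z - RtoC (w - z) * l)%C = norm (V:=C_R_NormedModule)
   (minus (minus (f w) (f z)) (scal (minus w z) l)).
  rewrite Cmod_normR; f_equal.
  rewrite /minus /plus /opp /scal /= /prod_plus /prod_scal /prod_opp /Cplus /Cmult /Copp /=.
  by rewrite /plus /opp /scal /= /mult /= /Cminus /Cplus /Copp /=; f_equal; ring.
split.
- move=> [_ H] eps e0.
  have [d Hd] := H z (fun P HP => HP) (mkposreal eps e0).
  exists d; split; first exact: cond_pos.
  by move=> w Hw; rewrite E; apply: (Hd w Hw).
- move=> H; split; first exact: is_linear_scal_l.
  move=> x Hx eps.
  have {Hx} <- := is_filter_lim_locally_unique _ _ Hx.
  have [d [d0 Hd]] := H eps (cond_pos eps).
  exists (mkposreal d d0) => w Hw.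
  by rewrite -E; exact: (Hd w Hw).
Qed.

Lemma ccont_eps (f : R -> C) (x : R) : ccont f x <->
  forall eps, 0 < eps -> exists del, 0 < del /\ forall w, Rabs (w - x) < del ->
    Cmod (f w - f x)%C < eps.
Proof.
split.
- move=> H eps e0.
  (* Balls of the uniform space [C] are boxes; a box of radius r only gives modulus below
     [sqrt 2 * r]. *)
  have e1 : 0 < eps / sqrt 2 by apply: Rdiv_lt_0_compat => //; apply: sqrt_lt_R0; lra.
  have /H [d Hd] := locally_ball (f x) (mkposreal _ e1).
  exists d; split; first exact: cond_pos.
  move=> w /Hd /C_NormedModule_mixin_compat2 /=.
  by rewrite Rmult_comm /Rdiv Rmult_assoc Rinv_l ?Rmult_1_r //; have := sqrt_lt_R0 2; lra.
- move=> H P [e He].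
  have [d [d0 Hd]] := H e (cond_pos e).
  exists (mkposreal d d0) => w Hw; apply: He.
  exact: C_NormedModule_mixin_compat1 (Hd w Hw).
Qed.

Lemma R_filterdiff_fst (f : R -> C) t l : RderivE f t l ->
  is_derive (fun x => fst (f x)) t (fst l).
Proof.
move=> H; apply: (filterdiff_comp' f (@fst R R) t _ (@fst R R)) H _.
exact/filterdiff_linear/(is_linear_fst (U:=R_NormedModule) (V:=R_NormedModule)).
Qed.
Lemma R_filterdiff_snd (f : R -> C) t l : RderivE f t l ->
  is_derive (fun x => snd (f x)) t (snd l).
Proof.
move=> H; apply: (filterdiff_comp' f (@snd R R) t _ (@snd R R)) H _.
exact/filterdiff_linear/(is_linear_snd (U:=R_NormedModule) (V:=R_NormedModule)).
Qed.

Lemma Cmod_le_sum (z : C) : Cmod z <= Rabs z.1 + Rabs z.2.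
Proof.
rewrite /Cmod; apply: Rsqr_incr_0_var; last by have := Rabs_pos z.1; have := Rabs_pos z.2; lra.
rewrite Rsqr_sqrt; last by have := pow2_ge_0 z.1; have := pow2_ge_0 z.2; lra.
rewrite -[z.1 ^ 2]pow2_abs -[z.2 ^ 2]pow2_abs /Rsqr.
have := Rabs_pos z.1; have := Rabs_pos z.2; nra.
Qed.
Lemma Rabs_fst_le (z : C) : Rabs z.1 <= Cmod z.
Proof. by apply: Rle_trans (Rmax_Cmod z); apply: Rmax_l. Qed.
Lemma Rabs_snd_le (z : C) : Rabs z.2 <= Cmod z.
Proof. by apply: Rle_trans (Rmax_Cmod z); apply: Rmax_r. Qed.

(** The factor 2 comes from applying the real mean value theorem to the real and imaginary parts
    separately. *)
Lemma mean_value_bound (f df : R -> C) (a b M : R) : a <= b ->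
  (forall t, a <= t <= b -> RderivE f t (df t) /\ Cmod (df t) <= M) ->
  Cmod (f b - f a)%C <= 2 * M * (b - a).
Proof.
move=> ab H.
have B (p : C -> R) : (forall z, Rabs (p z) <= Cmod z) ->
   (forall t, a <= t <= b -> is_derive (fun x => p (f x)) t (p (df t))) ->
   Rabs (p (f b) - p (f a)) <= M * (b - a).
  move=> pm pd.
  have [||c [Hc ->]] := MVT_gen (fun x => p (f x)) a b (fun x => p (df x)).
  - by move=> x; rewrite Rmin_left // Rmax_right // => Hx; apply: pd; lra.
  - move=> x; rewrite Rmin_left // Rmax_right // => Hx.
    apply: derivable_continuous_pt; exists (p (df x)).
    by apply/is_derive_Reals; apply: pd.
  - rewrite Rmin_left // Rmax_right // in Hc.
    rewrite Rabs_mult [Rabs (b - a)]Rabs_pos_eq; last lra.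
    apply: Rmult_le_compat_r; first lra.
    by have [_] := H c Hc; have := pm (df c); lra.
have H1 := B fst Rabs_fst_le (fun t Ht => R_filterdiff_fst (proj1 (H t Ht))).
have H2 := B snd Rabs_snd_le (fun t Ht => R_filterdiff_snd (proj1 (H t Ht))).
apply: Rle_trans (Cmod_le_sum _) _ => /=.
rewrite /Rminus in H1 H2; lra.
Qed.

(** The increment [dl] is abstract so that one estimate serves an inner function of a real variable
    as well as of a complex one. *)
Lemma chain_rule_eps (X : Type) (G dl : X -> C) (F : C -> C) y k l :
  (forall eps, 0 < eps -> exists del, 0 < del /\ forall w, Cmod (dl w) < del ->
    Cmod (G w - y - dl w * k)%C <= eps * Cmod (dl w)) ->
  CderivE F y l ->
  forall eps, 0 < eps -> exists del, 0 < del /\ forall w, Cmod (dl w) < del ->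
    Cmod (F (G w) - F y - dl w * (k * l))%C <= eps * Cmod (dl w).
Proof.
move=> Hg /is_deriveC_eps HF eps e0.
set A := Cmod k; set B := Cmod l.
have A0 : 0 <= A by exact: Cmod_ge_0.
have B0 : 0 <= B by exact: Cmod_ge_0.
have [e1 [e10 He1]] : exists e1, 0 < e1 /\ e1 * (A + 1) <= eps / 2.
  exists (eps / 2 / (A + 1)); split; first by apply: Rdiv_lt_0_compat; lra.
  by apply: Req_le; field; lra.
have [e2 [e20 [He2 e21]]] : exists e2, 0 < e2 /\ e2 * B <= eps / 2 /\ e2 <= 1.
  exists (Rmin 1 (eps / 2 / (B + 1))); split; last split.
  - by apply: Rmin_pos; [lra|apply: Rdiv_lt_0_compat; lra].
  - apply: (Rle_trans _ ((eps / 2 / (B + 1)) * B)).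
      by apply: Rmult_le_compat_r => //; exact: Rmin_r.
    have -> : eps / 2 / (B + 1) * B = eps / 2 * (B / (B + 1)) by field; lra.
    have : B / (B + 1) <= 1 by apply/Rle_div_l; lra.
    by have : 0 <= B / (B + 1) by [apply: Rdiv_le_0_compat; lra]; nra.
  - exact: Rmin_l.
have [d1 [d10 Hd1]] := HF e1 e10.
have [d2 [d20 Hd2]] := Hg e2 e20.
exists (Rmin d2 (d1 / (A + 1))); split.
  by apply: Rmin_pos => //; apply: Rdiv_lt_0_compat; lra.
move=> w Hw.
have Hw2 := Rlt_le_trans _ _ _ Hw (Rmin_l _ _).
have Hw1 := Rlt_le_trans _ _ _ Hw (Rmin_r _ _).
have {Hd2} Gw := Hd2 w Hw2.
have L : Cmod (G w - y)%C <= Cmod (dl w) * (A + 1).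
  have -> : (G w - y = (G w - y - dl w * k) + dl w * k)%C by ring.
  apply: Rle_trans (Cmod_triangle _ _) _; rewrite Cmod_mult -/A.
  by have := Cmod_ge_0 (dl w); nra.
have {Hd1} K : Cmod (F (G w) - F y - (G w - y) * l)%C <= e1 * Cmod (G w - y)%C.
  apply: Hd1; apply: Rle_lt_trans L _.
  by apply/Rlt_div_r => //; lra.
have -> : (F (G w) - F y - dl w * (k * l) =
   (F (G w) - F y - (G w - y) * l) + (G w - y - dl w * k) * l)%C by ring.
apply: Rle_trans (Cmod_triangle _ _) _; rewrite Cmod_mult -/B.
have := Cmod_ge_0 (dl w) => P.
apply: (Rle_trans _ (e1 * (Cmod (dl w) * (A + 1)) + e2 * Cmod (dl w) * B)); last nra.
by apply: Rplus_le_compat; nra.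
Qed.

Lemma RderivE_comp (F : C -> C) (g : R -> C) t g' l :
  RderivE g t g' -> CderivE F (g t) l -> RderivE (fun s => F (g s)) t (g' * l)%C.
Proof.
move=> /is_deriveR_eps Hg HF; apply/is_deriveR_eps => eps e0.
have Hg' : forall eps, 0 < eps -> exists del, 0 < del /\ forall w, Cmod (RtoC (w - t)) < del ->
    Cmod (g w - g t - RtoC (w - t) * g')%C <= eps * Cmod (RtoC (w - t)).
  move=> e /Hg [d [d0 Hd]]; exists d; split=> // w; rewrite Cmod_R; exact: Hd.
have [d [d0 Hd]] := chain_rule_eps Hg' HF e0.
by exists d; split=> // w; have := Hd w; rewrite Cmod_R.
Qed.

Lemma CderivE_comp (F G : C -> C) z k l : CderivE F (G z) l -> CderivE G z k ->
  CderivE (fun w => F (G w)) z (k * l)%C.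
Proof.
move=> HF /is_deriveC_eps Hg; apply/is_deriveC_eps.
exact: (@chain_rule_eps C G (fun w => w - z)%C F (G z) k l Hg HF).
Qed.

Lemma RderivE_ext (f : R -> C) t l l' : l = l' -> RderivE f t l -> RderivE f t l'.
Proof. by move=> ->. Qed.

Lemma RderivE_line (a b : C) t : RderivE (fun s => a + RtoC s * b)%C t b.
Proof.
apply/is_deriveR_eps => eps e0; exists 1; split; first lra.
move=> w _; have -> : (a + w * b - (a + t * b) - RtoC (w - t) * b = 0)%C.
  by rewrite RtoC_minus; ring.
by rewrite Cmod_0; have := Rabs_pos (w - t); nra.
Qed.

Lemma RderivE_ccont (f : R -> C) t l : RderivE f t l -> ccont f t.
Proof. by move=> H; apply: (ex_derive_continuous (V:=C_R_NormedModule)); exists l. Qed.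

Lemma CderivE_cont_eps (f : C -> C) z l : CderivE f z l ->
  forall eps, 0 < eps -> exists del, 0 < del /\ forall w, Cmod (w - z)%C < del ->
    Cmod (f w - f z)%C < eps.
Proof.
move=> /is_deriveC_eps H eps e0.
have [d [d0 Hd]] := H 1 Rlt_0_1.
have M0 := Cmod_ge_0 l.
exists (Rmin d (eps / (Cmod l + 1))); split.
  by apply: Rmin_pos => //; apply: Rdiv_lt_0_compat; lra.
move=> w Hw.
have Hw2 := Rlt_le_trans _ _ _ Hw (Rmin_l _ _).
have Hw1 := Rlt_le_trans _ _ _ Hw (Rmin_r _ _).
have -> : (f w - f z = (f w - f z - (w - z) * l) + (w - z) * l)%C by ring.
apply: Rle_lt_trans (Cmod_triangle _ _) _; rewrite Cmod_mult.
have := Hd w Hw2.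
have : Cmod (w - z) * (Cmod l + 1) < eps by apply/Rlt_div_r; lra.
lra.
Qed.

Lemma hline_deriv y t : RderivE (fun x => (x, y) : C) t (RtoC 1).
Proof.
apply: (is_derive_ext (V:=C_R_NormedModule) (fun x => (0, y) + RtoC x * RtoC 1)%C).
  by move=> x; rewrite /RtoC /Cmult /Cplus /=; f_equal; ring.
exact: RderivE_line.
Qed.
Lemma vline_deriv x t : RderivE (fun y => (x, y) : C) t Ci.
Proof.
apply: (is_derive_ext (V:=C_R_NormedModule) (fun y => (x, 0) + RtoC y * Ci)%C).
  by move=> y; rewrite /RtoC /Cmult /Cplus /Ci /=; f_equal; ring.
exact: RderivE_line.
Qed.

(** * Goursat's theorem on rectangles *)

Definition hseg_int (h : C -> C) a b y : C := CInt (fun x => h (x, y)) a b.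
Definition vseg_int (h : C -> C) c d x : C := CInt (fun y => h (x, y)) c d.
(** The contour integral of [h(z) dz] along the boundary, counterclockwise from the bottom side;
    [Ci] is dz/dy on vertical sides. *)
Definition rect_int (h : C -> C) a b c d : C :=
  (hseg_int h a b c + Ci * vseg_int h c d b - hseg_int h a b d - Ci * vseg_int h c d a)%C.

Definition inrect a b c d (z : C) := a <= z.1 <= b /\ c <= z.2 <= d.
Definition diff_rect (h : C -> C) a b c d :=
  forall z, inrect a b c d z -> exists l, CderivE h z l.

Lemma isCInt_FTC (f df : R -> C) a b : a <= b ->
  (forall x, a <= x <= b -> RderivE f x (df x)) ->
  (forall x, a <= x <= b -> ccont df x) ->
  isCInt df a b (f b - f a)%C.
Proof.
move=> ab H1 H2.
by apply: (is_RInt_derive (V:=C_R_CompleteNormedModule)); rewrite Rmin_left // Rmax_right.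
Qed.

Lemma CInt_unique (f : R -> C) a b l : isCInt f a b l -> CInt f a b = l.
Proof. exact: (is_RInt_unique (V:=C_R_CompleteNormedModule)). Qed.
Lemma CInt_correct (f : R -> C) a b : exCInt f a b -> isCInt f a b (CInt f a b).
Proof. exact: (RInt_correct (V:=C_R_CompleteNormedModule)). Qed.
Lemma exCInt_cont (f : R -> C) a b : a <= b -> (forall x, a <= x <= b -> ccont f x) -> exCInt f a b.
Proof.
by move=> ab H; apply: (ex_RInt_continuous (V:=C_R_CompleteNormedModule)); rewrite Rmin_left // Rmax_right.
Qed.
Lemma CInt_bound (f : R -> C) a b M : a <= b -> exCInt f a b ->
  (forall x, a <= x <= b -> Cmod (f x) <= M) -> Cmod (CInt f a b) <= (b - a) * M.
Proof.
move=> ab /CInt_correct H B.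
rewrite -Cmod_normR; apply: (norm_RInt_le_const (V:=C_R_NormedModule) f a b _ M ab _ H).
by move=> x /B; rewrite Cmod_normR.
Qed.
Lemma CInt_Chasles (f : R -> C) a b c : exCInt f a b -> exCInt f b c ->
  CInt f a c = (CInt f a b + CInt f b c)%C.
Proof. by move=> H1 H2; rewrite -(RInt_Chasles (V:=C_R_CompleteNormedModule) f a b c). Qed.
Lemma CInt_minus (f g : R -> C) a b : exCInt f a b -> exCInt g a b ->
  CInt (fun x => f x - g x)%C a b = (CInt f a b - CInt g a b)%C.
Proof. by move=> H1 H2; apply: (RInt_minus (V:=C_R_CompleteNormedModule)). Qed.

Lemma isCInt_scal (k : C) (f : R -> C) a b l : isCInt f a b l ->
  isCInt (fun x => k * f x)%C a b (k * l)%C.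
Proof.
move=> H.
have H1 := is_RInt_fct_extend_fst (U:=R_NormedModule) (V:=R_NormedModule) f a b l H.
have H2 := is_RInt_fct_extend_snd (U:=R_NormedModule) (V:=R_NormedModule) f a b l H.
apply: (is_RInt_fct_extend_pair (U:=R_NormedModule) (V:=R_NormedModule)) => /=.
- exact: (is_RInt_minus (V:=R_NormedModule) _ _ _ _ _ _ (is_RInt_scal _ _ _ k.1 _ H1) (is_RInt_scal _ _ _ k.2 _ H2)).
- exact: (is_RInt_plus (V:=R_NormedModule) _ _ _ _ _ _ (is_RInt_scal _ _ _ k.1 _ H2) (is_RInt_scal _ _ _ k.2 _ H1)).
Qed.

Section Rect.
Variables (h : C -> C) (a b c d : R).
Hypothesis hd : diff_rect h a b c d.

Lemma hseg_cont y x : a <= x <= b -> c <= y <= d -> ccont (fun x => h (x, y)) x.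
Proof.
move=> Hx Hy; have [|l Hl] := hd (z:=(x,y)); first by split.
exact: RderivE_ccont (RderivE_comp (hline_deriv y x) Hl).
Qed.
Lemma vseg_cont y x : a <= x <= b -> c <= y <= d -> ccont (fun y => h (x, y)) y.
Proof.
move=> Hx Hy; have [|l Hl] := hd (z:=(x,y)); first by split.
exact: RderivE_ccont (RderivE_comp (vline_deriv x y) Hl).
Qed.
Lemma hseg_ex a' b' y : a <= a' -> a' <= b' -> b' <= b -> c <= y <= d ->
  exCInt (fun x => h (x, y)) a' b'.
Proof. by move=> *; apply: exCInt_cont => // x Hx; apply: hseg_cont; lra. Qed.
Lemma vseg_ex c' d' x : c <= c' -> c' <= d' -> d' <= d -> a <= x <= b ->
  exCInt (fun y => h (x, y)) c' d'.
Proof. by move=> *; apply: exCInt_cont => // y Hy; apply: vseg_cont; lra. Qed.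

(** The inner sides are traversed twice, in opposite directions. *)
Lemma rect_int_quarter m n : a <= m <= b -> c <= n <= d ->
  rect_int h a b c d = (rect_int h a m c n + rect_int h m b c n + rect_int h a m n d + rect_int h m b n d)%C.
Proof.
move=> Hm Hn; rewrite /rect_int /hseg_int /vseg_int.
rewrite (CInt_Chasles (f:=fun x => h (x, c)) (b:=m)); try by apply: hseg_ex; lra.
rewrite (CInt_Chasles (f:=fun x => h (x, d)) (b:=m)); try by apply: hseg_ex; lra.
rewrite (CInt_Chasles (f:=fun y => h (a, y)) (b:=n)); try by apply: vseg_ex; lra.
rewrite (CInt_Chasles (f:=fun y => h (b, y)) (b:=n)); try by apply: vseg_ex; lra.
ring.
Qed.

Lemma rect_int_bound M : a <= b -> c <= d -> (forall z, inrect a b c d z -> Cmod (h z) <= M) ->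
  Cmod (rect_int h a b c d) <= 2 * M * ((b - a) + (d - c)).
Proof.
move=> ab cd HM; rewrite /rect_int.
have H1 y : c <= y <= d -> Cmod (hseg_int h a b y) <= (b - a) * M.
  by move=> Hy; apply: CInt_bound => //; [apply: hseg_ex; lra|move=> x Hx; apply: HM; split].
have V1 x : a <= x <= b -> Cmod (vseg_int h c d x) <= (d - c) * M.
  by move=> Hy; apply: CInt_bound => //; [apply: vseg_ex; lra|move=> y ?; apply: HM; split].
have CI z : Cmod (Ci * z)%C = Cmod z by rewrite Cmod_mult Cmod_Ci Rmult_1_l.
have := H1 c ltac:(lra); have := H1 d ltac:(lra).
have := V1 a ltac:(lra); have := V1 b ltac:(lra).
rewrite -(CI (vseg_int _ _ _ a)) -(CI (vseg_int _ _ _ b)).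
move: (hseg_int _ _ _ c) (hseg_int _ _ _ d) (Ci * vseg_int _ _ _ a)%C (Ci * vseg_int _ _ _ b)%C => x y z w.
move=> A1 A2 A3 A4; rewrite /Cminus.
apply: Rle_trans (Cmod_triangle _ _) _; rewrite Cmod_opp.
have := Cmod_triangle (x + w)%C (- y)%C; rewrite Cmod_opp.
have := Cmod_triangle x w; lra.
Qed.

Lemma hseg_int_primitive (P : C -> C) a' b' y : a <= a' -> a' <= b' -> b' <= b -> c <= y <= d ->
  (forall z, inrect a b c d z -> CderivE P z (h z)) ->
  hseg_int h a' b' y = (P (b', y) - P (a', y))%C.
Proof.
move=> *; apply/CInt_unique/(isCInt_FTC (f:=fun x => P (x, y))) => // x Hx; last by apply: hseg_cont; lra.
apply: (RderivE_ext (l := RtoC 1 * h (x, y))%C); first by rewrite Cmult_1_l.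
apply: RderivE_comp; first exact: hline_deriv.
by auto with real; match goal with H : forall z, _ |- _ => apply: H end; split => /=; lra.
Qed.
Lemma vseg_int_primitive (P : C -> C) c' d' x : c <= c' -> c' <= d' -> d' <= d -> a <= x <= b ->
  (forall z, inrect a b c d z -> CderivE P z (h z)) ->
  (Ci * vseg_int h c' d' x = P (x, d') - P (x, c'))%C.
Proof.
move=> H1 H2 H3 H4 H5.
have I := CInt_correct (vseg_ex H1 H2 H3 H4).
rewrite -(CInt_unique (isCInt_scal (k:=Ci) I)).
apply: CInt_unique; apply: (isCInt_FTC (f := fun y => P (x, y))) => // y Hy.
  apply: RderivE_comp; first exact: vline_deriv.
  by apply: H5; split => /=; lra.
have [|l Hl] := hd (z:=(x,y)); first by split => /=; lra.
have /RderivE_ccont H := RderivE_comp (vline_deriv x y) Hl.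
apply/ccont_eps => eps e0; have [e [e1 He]] := proj1 (ccont_eps _ _) H eps e0.
exists e; split=> // w /He.
have -> : (Ci * h (x, w) - Ci * h (x, y) = Ci * (h (x, w) - h (x, y)))%C by ring.
by rewrite Cmod_mult Cmod_Ci Rmult_1_l.
Qed.
End Rect.

Lemma rect_int_primitive h P a b c d : a <= b -> c <= d -> diff_rect h a b c d ->
  (forall z, inrect a b c d z -> CderivE P z (h z)) -> rect_int h a b c d = 0%C.
Proof.
move=> ab cd hd HP; rewrite /rect_int.
rewrite !(hseg_int_primitive hd (P:=P)) //; try lra.
rewrite !(vseg_int_primitive hd (P:=P)) //; try lra.
ring.
Qed.

Lemma CderivE_affine (al be z : C) : CderivE (fun w => al + be * w)%C z be.
Proof.
apply/is_deriveC_eps => eps e0; exists 1; split; first lra.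
move=> w _; have -> : (al + be * w - (al + be * z) - (w - z) * be = 0)%C by ring.
by rewrite Cmod_0; have := Cmod_ge_0 (w - z); nra.
Qed.
Lemma CderivE_quad (al be z : C) :
  CderivE (fun w => al * w + be / 2 * (w * w))%C z (al + be * z)%C.
Proof.
apply/is_deriveC_eps => eps e0.
have B0 := Cmod_ge_0 (be/2).
exists (eps / (Cmod (be/2) + 1)); split; first by apply: Rdiv_lt_0_compat; lra.
move=> w /Rlt_div_r H; have {}H := H ltac:(lra).
have -> : (al * w + be / 2 * (w * w) - (al * z + be / 2 * (z * z)) - (w - z) * (al + be * z)
  = be / 2 * ((w - z) * (w - z)))%C by field.
rewrite Cmod_mult (Cmod_mult (w - z)) -Rmult_assoc; apply: Rmult_le_compat_r; first exact: Cmod_ge_0.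
by have := Cmod_ge_0 (w - z)%C; lra.
Qed.

Lemma rect_int_minus f g a b c d : a <= b -> c <= d -> diff_rect f a b c d -> diff_rect g a b c d ->
  rect_int (fun z => f z - g z)%C a b c d = (rect_int f a b c d - rect_int g a b c d)%C.
Proof.
move=> ab cd hf hg; rewrite /rect_int /hseg_int /vseg_int.
rewrite !CInt_minus; try (by apply: (hseg_ex hf); lra); try (by apply: (hseg_ex hg); lra);
  try (by apply: (vseg_ex hf); lra); try (by apply: (vseg_ex hg); lra).
ring.
Qed.

Lemma diff_rect_sub h a b c d a' b' c' d' : a <= a' -> b' <= b -> c <= c' -> d' <= d ->
  diff_rect h a b c d -> diff_rect h a' b' c' d'.
Proof. by move=> ???? H z [[??] [??]]; apply: H; split; lra. Qed.

Lemma CderivE_minus (f g : C -> C) z k l : CderivE f z k -> CderivE g z l ->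
  CderivE (fun w => f w - g w)%C z (k - l)%C.
Proof. by move=> H1 H2; apply: (is_derive_minus (V:=C_NormedModule)). Qed.

(* The error of the affine approximation at an interior point is quadratic in the side. *)
Lemma rect_int_small h a b c d (w l : C) s eps : a <= b -> c <= d -> diff_rect h a b c d ->
  b - a <= s -> d - c <= s -> inrect a b c d w -> 
  (forall z, inrect a b c d z -> Cmod (h z - h w - (z - w) * l)%C <= eps * Cmod (z - w)%C) ->
  0 <= eps -> Cmod (rect_int h a b c d) <= 8 * eps * s * s.
Proof.
move=> ab cd hd bs ds Hw H e0.
have e2 : forall z, (h w - w * l + l * z = h w + (z - w) * l)%C by move=> z; ring.
have ha : diff_rect (fun z => h w - w * l + l * z)%C a b c d.
  by move=> z _; exists l; exact: CderivE_affine.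
have -> : rect_int h a b c d = rect_int (fun z => h z - (h w - w * l + l * z))%C a b c d.
  rewrite rect_int_minus // (rect_int_primitive ab cd ha (P:=fun z => (h w - w * l) * z + l / 2 * (z * z))%C).
    by rewrite /Cminus Copp_0 Cplus_0_r.
  by move=> z _; exact: CderivE_quad.
have hd' : diff_rect (fun z => h z - (h w - w * l + l * z))%C a b c d.
  move=> z Hz; have [k Hk] := hd z Hz; exists (k - l)%C.
  by apply: CderivE_minus => //; exact: CderivE_affine.
apply: Rle_trans (rect_int_bound hd' (M:=eps * (2 * s)) ab cd _) _; last first.
  have : 0 <= eps * s by apply: Rmult_le_pos; lra.
  nra.
move=> z Hz; have -> : (h z - (h w - w * l + l * z) = h z - h w - (z - w) * l)%C by ring.
apply: Rle_trans (H z Hz) _; apply: Rmult_le_compat_l => //.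
apply: Rle_trans (Cmod_le_sum _) _ => /=.
case: Hz => [[??] [??]]; case: Hw => [[??] [??]].
suff : Rabs (z.1 + - w.1) <= s /\ Rabs (z.2 + - w.2) <= s by lra.
by split; apply: Rabs_le; lra.
Qed.

Lemma Cmod_sum4 (w x y z : C) :
  Cmod (w + x + y + z)%C <= Cmod w + Cmod x + Cmod y + Cmod z.
Proof.
have := Cmod_triangle (w + x + y)%C z; have := Cmod_triangle (w + x)%C y.
have := Cmod_triangle w x; lra.
Qed.

(** Nesting puts every left endpoint below every right endpoint, so the supremum of the left
    endpoints works. *)
Lemma nested_point (p l : nat -> R) (L : R) : 0 <= L -> (forall n, l n = L / 2 ^ n) ->
  (forall n, p n <= p (S n) /\ p (S n) + l (S n) <= p n + l n) ->
  exists x, forall n, p n <= x <= p n + l n.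
Proof.
move=> L0 lE H.
have l0 n : 0 <= l n.
  by rewrite lE; apply: Rdiv_le_0_compat => //; apply: pow_lt; lra.
have mono n k : p n <= p (n + k)%coq_nat /\ p (n + k)%coq_nat + l (n + k)%coq_nat <= p n + l n.
  elim: k => [|k IH]; first by rewrite Nat.add_0_r; lra.
  by rewrite Nat.add_succ_r; have := H (n + k)%coq_nat; lra.
have [||x Hx] := completeness (fun y => exists n, y = p n).
- by exists (p 0%N + l 0%N) => y [n ->]; have := mono 0%N n; have := l0 n; rewrite /=; lra.
- by exists (p 0%N), 0%N.
exists x => n; case: Hx => ub lub; split; first by apply: ub; exists n.
apply: lub => y [m ->]; case: (Compare_dec.le_lt_dec n m) => nm.
- by have [_] := mono n (m - n)%coq_nat; rewrite Nat.add_comm Nat.sub_add //; have := l0 m; lra.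
- have [+ _] := mono m (n - m)%coq_nat; rewrite Nat.add_comm Nat.sub_add; last lia.
  by have := l0 n; lra.
Qed.

(** Bisection: if the integral has modulus [E > 0], some quarter keeps at least a fourth of it, and
    so on. Around the common point of the nested rectangles the affine approximation bounds the n-th
    integral by [8 * eps * s * s / 4 ^ n], which is below [E / 4 ^ n] for small [eps]. *)
Lemma goursat_rect h a b c d : a <= b -> c <= d -> diff_rect h a b c d ->
  rect_int h a b c d = 0%C.
Proof.
move=> ab cd hd; apply: NNPP => N0.
have E0 : 0 < Cmod (rect_int h a b c d) by apply/Cmod_gt_0.
set E := Cmod (rect_int h a b c d) in E0.
set L := b - a; set M := d - c.
(* [p] is the lower left corner of a rectangle with sides [L / 2 ^ n] and [M / 2 ^ n]. *)
pose sub n (p : R * R) := [/\ a <= p.1, p.1 + L / 2 ^ n <= b, c <= p.2 & p.2 + M / 2 ^ n <= d].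
pose bad n (p : R * R) := E / 4 ^ n <=
   Cmod (rect_int h p.1 (p.1 + L / 2 ^ n) p.2 (p.2 + M / 2 ^ n)).
pose ok n p := sub n p /\ bad n p.
pose nxt n (p q : R * R) := [/\ p.1 <= q.1, q.1 + L / 2 ^ (S n) <= p.1 + L / 2 ^ n,
   p.2 <= q.2 & q.2 + M / 2 ^ (S n) <= p.2 + M / 2 ^ n].
have L0 : 0 <= L by rewrite /L; lra.
have M0 : 0 <= M by rewrite /M; lra.
have p2 n : 0 < 2 ^ n by apply: pow_lt; lra.
have Ln n : 0 <= L / 2 ^ n by apply: Rdiv_le_0_compat.
have Mn n : 0 <= M / 2 ^ n by apply: Rdiv_le_0_compat.
have half x n : x / 2 ^ n = x / 2 ^ (S n) + x / 2 ^ (S n) by rewrite /=; field; have := p2 n; lra.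
have step n p : ok n p -> exists q, ok (S n) q /\ nxt n p q.
  move=> [[s1 s2 s3 s4] B].
  have hL := half L n; have hM := half M n; have LS := Ln (S n); have MS := Mn (S n).
  have hd' : diff_rect h p.1 (p.1 + L / 2 ^ n) p.2 (p.2 + M / 2 ^ n).
    by apply: diff_rect_sub hd; lra.
  have Q := @rect_int_quarter _ _ _ _ _ hd' (p.1 + L / 2 ^ (S n)) (p.2 + M / 2 ^ (S n))
     ltac:(lra) ltac:(lra).
  rewrite hL hM -!Rplus_assoc in Q.
  rewrite /bad hL hM -!Rplus_assoc Q in B.
  have h4 : E / 4 ^ n = 4 * (E / 4 ^ (S n)) by rewrite /=; field; apply: pow_nonzero; lra.
  rewrite h4 in B.
  have {Q}T := Cmod_sum4 (rect_int h p.1 (p.1 + L / 2 ^ S n) p.2 (p.2 + M / 2 ^ S n))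
   (rect_int h (p.1 + L / 2 ^ S n) (p.1 + L / 2 ^ S n + L / 2 ^ S n) p.2 (p.2 + M / 2 ^ S n))
   (rect_int h p.1 (p.1 + L / 2 ^ S n) (p.2 + M / 2 ^ S n) (p.2 + M / 2 ^ S n + M / 2 ^ S n))
   (rect_int h (p.1 + L / 2 ^ S n) (p.1 + L / 2 ^ S n + L / 2 ^ S n) (p.2 + M / 2 ^ S n) (p.2 + M / 2 ^ S n + M / 2 ^ S n)).
  (* If no quarter were bad, the four strict bounds would add up to less than [E / 4 ^ n], against
     [B] and [T]. *)
  apply: NNPP => NQ.
  have nb q : sub (S n) q -> nxt n p q -> 
     Cmod (rect_int h q.1 (q.1 + L / 2 ^ S n) q.2 (q.2 + M / 2 ^ S n)) < E / 4 ^ S n.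
    move=> Hs Hn; apply: Rnot_le_lt => Hb; apply: NQ; exists q; split=> //.
  have := nb (p.1, p.2); have := nb (p.1 + L / 2 ^ S n, p.2).
  have := nb (p.1, p.2 + M / 2 ^ S n); have := nb (p.1 + L / 2 ^ S n, p.2 + M / 2 ^ S n).
  rewrite /=.
  have sb x y : (x = p.1 \/ x = p.1 + L / 2 ^ S n) -> (y = p.2 \/ y = p.2 + M / 2 ^ S n) ->
    sub (S n) (x, y) /\ nxt n p (x, y).
    by move=> Hx Hy; split; split; rewrite /= -/(2 ^ (S n)); lra.
  have [??] := sb _ _ (or_introl erefl) (or_introl erefl).
  have [??] := sb _ _ (or_intror erefl) (or_introl erefl).
  have [??] := sb _ _ (or_introl erefl) (or_intror erefl).
  have [??] := sb _ _ (or_intror erefl) (or_intror erefl).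
  move=> /(_ ltac:(done) ltac:(done)) ? /(_ ltac:(done) ltac:(done)) ?.
  move=> /(_ ltac:(done) ltac:(done)) ? /(_ ltac:(done) ltac:(done)) ?.
  rewrite /= in T B *; lra.
have [f [f0 Hf]] : exists f : nat -> R * R, f 0%N = (a, c) /\ forall n, ok n (f n) /\ nxt n (f n) (f (S n)).
  have stepS n (p : {p | ok n p}) : {q : {q | ok (S n) q} | nxt n (proj1_sig p) (proj1_sig q)}.
    have [q [Hq Hn]] := cid (step n _ (proj2_sig p)).
    by exists (exist _ q Hq).
  have ok0 : ok 0%N (a, c).
    split; last first.
      rewrite /bad /= (_ : a + L / 1 = b); last by rewrite /L; field.
      rewrite (_ : c + M / 1 = d); last by rewrite /M; field.
      by rewrite -/E; lra.
    by split=> /=; rewrite /L /M; lra.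
  pose F := fix F n : {p | ok n p} := match n with 0%N => exist _ (a, c) ok0
     | S n => proj1_sig (stepS n (F n)) end.
  exists (fun n => proj1_sig (F n)); split=> // n; split; first exact: proj2_sig (F n).
  exact: proj2_sig (stepS n (F n)).
have [x Hx] := @nested_point (fun n => (f n).1) (fun n => L / 2 ^ n) L L0 (fun=> erefl)
  (fun n => match (Hf n).2 with And4 a b _ _ => conj a b end).
have [y Hy] := @nested_point (fun n => (f n).2) (fun n => M / 2 ^ n) M M0 (fun=> erefl)
  (fun n => match (Hf n).2 with And4 _ _ a b => conj a b end).
have Hxy : inrect a b c d (x, y).
  by have := Hx 0%N; have := Hy 0%N; rewrite f0 /L /M /=; split=> /=; lra.
have [l /is_deriveC_eps Hl] := hd _ Hxy.
(* A common bound for both sides; the 1 keeps it positive for a degenerate rectangle. *)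
set s := L + M + 1.
have s1 : 0 < s by rewrite /s; lra.
have [eps [e0 He]] : exists eps, 0 < eps /\ 8 * eps * s * s < E.
  exists (E / (16 * s * s)); split; first by apply: Rdiv_lt_0_compat => //; nra.
  have -> : 8 * (E / (16 * s * s)) * s * s = E / 2 by field; lra.
  lra.
have [del [d0 Hdel]] := Hl eps e0.
have [n Hn] : exists n, s / 2 ^ n < del / 2.
  have [N HN] := pow_lt_1_zero (/2) ltac:(rewrite Rabs_pos_eq; lra) (del / 2 / s) ltac:(apply: Rdiv_lt_0_compat; lra).
  exists N; have := HN N (le_n _); rewrite Rabs_pos_eq; last by apply: pow_le; lra.
  move/Rlt_div_r => /(_ s1); rewrite pow_inv /Rdiv; lra.
have [[[q1 q2 q3 q4] Hb] _] := Hf n.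
have sn x' : x' <= s -> x' / 2 ^ n <= s / 2 ^ n.
  by move=> H; apply: Rmult_le_compat_r => //; apply/Rlt_le/Rinv_0_lt_compat.
have := sn L ltac:(rewrite /s; lra); have := sn M ltac:(rewrite /s; lra) => sM sL.
have Ln' := Ln n; have Mn' := Mn n; have Hxn := Hx n; have Hyn := Hy n.
have HB : forall z, inrect (f n).1 ((f n).1 + L / 2 ^ n) (f n).2 ((f n).2 + M / 2 ^ n) z ->
    Cmod (h z - h (x, y) - (z - (x, y)) * l)%C <= eps * Cmod (z - (x, y))%C.
  move=> z [Hz1 Hz2]; apply: Hdel.
  apply: Rle_lt_trans (Cmod_le_sum _) _ => /=; rewrite /= in Hz1 Hz2.
  suff : Rabs (z.1 + - x) <= s / 2 ^ n /\ Rabs (z.2 + - y) <= s / 2 ^ n by lra.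
  by split; apply: Rabs_le; lra.
have H := @rect_int_small h (f n).1 ((f n).1 + L / 2 ^ n) (f n).2 ((f n).2 + M / 2 ^ n) (x, y) l (s / 2 ^ n) eps
  ltac:(lra) ltac:(lra) (diff_rect_sub q1 q2 q3 q4 hd) ltac:(lra) ltac:(lra) (conj Hxn Hyn) HB ltac:(lra).
have := Rle_trans _ _ _ Hb H; apply/Rlt_not_le.
rewrite (_ : 4 ^ n = 2 ^ n * 2 ^ n); last by rewrite -Rpow_mult_distr; f_equal; lra.
have -> : 8 * eps * (s / 2 ^ n) * (s / 2 ^ n) = (8 * eps * s * s) / (2 ^ n * 2 ^ n) by field; have := p2 n; lra.
apply: Rmult_lt_compat_r => //; apply/Rinv_0_lt_compat; have := p2 n; nra.
Qed.

(** ** Exponential, mean values and Liouville's theorem *)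

Definition cexp (z : C) : C := (exp z.1 * cos z.2, exp z.1 * sin z.2).

Lemma cexpD z w : cexp (z + w)%C = (cexp z * cexp w)%C.
Proof.
rewrite /cexp /Cplus /Cmult /= exp_plus cos_plus sin_plus; f_equal; ring.
Qed.

Lemma Cmod_cexp z : Cmod (cexp z) = exp z.1.
Proof.
rewrite /Cmod /= (_ : _ + _ = exp z.1 * exp z.1).
  by apply: sqrt_square; apply/Rlt_le/exp_pos.
have := sin2_cos2 z.2; rewrite /Rsqr => E.
transitivity (exp z.1 * exp z.1 * (sin z.2 * sin z.2 + cos z.2 * cos z.2)); first ring.
by rewrite E; ring.
Qed.

Lemma derivable_pt_lim_eps0 f l : derivable_pt_lim f 0 l -> forall eps, 0 < eps ->
  exists del, 0 < del /\ forall h, Rabs h < del -> Rabs (f h - f 0 - h * l) <= eps * Rabs h.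
Proof.
move=> H eps e0; have [d Hd] := H eps e0; exists d; split; first exact: cond_pos.
move=> h Hh; case: (Req_dec h 0) => [->|h0].
  by rewrite /Rminus Rplus_opp_r Rmult_0_l Ropp_0 Rplus_0_r Rabs_R0 Rmult_0_r; lra.
have := Hd h h0 Hh; rewrite Rplus_0_l => /Rlt_le K.
have -> : f h - f 0 - h * l = ((f h - f 0) / h - l) * h by field.
by rewrite Rabs_mult; apply: Rmult_le_compat_r => //; exact: Rabs_pos.
Qed.

(** The expansion at 0 is enough: the functional equation [cexpD] transports it to every point. *)
Lemma cexp_near0 eps : 0 < eps -> exists del, 0 < del /\ forall w, Cmod w < del ->
  Cmod (cexp w - 1 - w)%C <= eps * Cmod w.
Proof.
move=> e0; set e := Rmin 1 (eps / 8).
have e10 : 0 < e by apply: Rmin_pos; lra.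
have e11 : e <= 1 := Rmin_l _ _.
have e12 : e <= eps / 8 := Rmin_r _ _.
have [d1 [d10 H1]] := derivable_pt_lim_eps0 (derivable_pt_lim_exp 0) e10.
have [d2 [d20 H2]] := derivable_pt_lim_eps0 (derivable_pt_lim_cos 0) e10.
have [d3 [d30 H3]] := derivable_pt_lim_eps0 (derivable_pt_lim_sin 0) e10.
exists (Rmin (Rmin d1 d2) (Rmin d3 (e / 4))); split.
  by apply: Rmin_pos; apply: Rmin_pos; lra.
move=> [x y] H.
have D1 := Rlt_le_trans _ _ _ (Rlt_le_trans _ _ _ H (Rmin_l _ _)) (Rmin_l _ _).
have D2 := Rlt_le_trans _ _ _ (Rlt_le_trans _ _ _ H (Rmin_l _ _)) (Rmin_r _ _).
have D3 := Rlt_le_trans _ _ _ (Rlt_le_trans _ _ _ H (Rmin_r _ _)) (Rmin_l _ _).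
have D4 := Rlt_le_trans _ _ _ (Rlt_le_trans _ _ _ H (Rmin_r _ _)) (Rmin_r _ _).
have Ex := Rabs_fst_le (x, y); have Ey := Rabs_snd_le (x, y); rewrite /= in Ex Ey.
have {}H1 := H1 x ltac:(lra). have {}H2 := H2 y ltac:(lra). have {}H3 := H3 y ltac:(lra).
rewrite exp_0 Rmult_1_r in H1. rewrite cos_0 sin_0 Ropp_0 Rmult_0_r Rminus_0_r in H2.
rewrite sin_0 cos_0 Rminus_0_r Rmult_1_r in H3.
apply: Rle_trans (Cmod_le_sum _) _; rewrite /cexp /=.
set m := Cmod (x, y) in H D1 D2 D3 D4 Ex Ey *.
have m0 : 0 <= m by exact: Cmod_ge_0.
have ex : Rabs (exp x - 1) <= 2 * m.
  have -> : exp x - 1 = (exp x - 1 - x) + x by ring.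
  by apply: Rle_trans (Rabs_triang _ _) _; nra.
have ex2 : Rabs (exp x) <= 2.
  have -> : exp x = (exp x - 1) + 1 by ring.
  by apply: Rle_trans (Rabs_triang _ _) _; rewrite Rabs_R1; nra.
have -> : exp x * cos y + - (1) + - x = exp x * (cos y - 1) + (exp x - 1 - x) by ring.
have -> : exp x * sin y + - 0 + - y = exp x * (sin y - y) + (exp x - 1) * y by ring.
have T1 := Rabs_triang (exp x * (cos y - 1)) (exp x - 1 - x).
have T2 := Rabs_triang (exp x * (sin y - y)) ((exp x - 1) * y).
rewrite !Rabs_mult in T1 T2.
have P1 : Rabs (exp x) * Rabs (cos y - 1) <= 2 * (e * m).
  by apply: Rmult_le_compat => //; try exact: Rabs_pos; nra.
have P2 : Rabs (exp x) * Rabs (sin y - y) <= 2 * (e * m).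
  by apply: Rmult_le_compat => //; try exact: Rabs_pos; nra.
have P3 : Rabs (exp x - 1) * Rabs y <= 2 * m * (e / 4).
  by apply: Rmult_le_compat => //; try exact: Rabs_pos; lra.
nra.
Qed.

Lemma cexp_deriv z : CderivE cexp z (cexp z).
Proof.
apply/is_deriveC_eps => eps e0.
have K0 : 0 < exp z.1 := exp_pos _.
have [d [d0 Hd]] := @cexp_near0 (eps / exp z.1) ltac:(by apply: Rdiv_lt_0_compat).
exists d; split=> // w /Hd H.
have -> : cexp w = (cexp z * cexp (w - z))%C by rewrite -cexpD; f_equal; ring.
have -> : (cexp z * cexp (w - z) - cexp z - (w - z) * cexp z =
  cexp z * (cexp (w - z) - 1 - (w - z)))%C by ring.
rewrite Cmod_mult Cmod_cexp.
apply: Rle_trans (Rmult_le_compat_l _ _ _ (Rlt_le _ _ K0) H) _.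
by apply: Req_le; field; lra.
Qed.

Definition entire (g : C -> C) := forall z, exists l, CderivE g z l.

Lemma entire_cexp_shift g a : entire g -> entire (fun s => g (a + cexp s)%C).
Proof.
move=> H z; have [l Hl] := H (a + cexp z)%C.
exists (cexp z * l)%C; apply: (CderivE_comp (F := g) (G := fun s => a + cexp s)%C) => //.
apply/is_deriveC_eps => eps e0; have [d [d0 Hd]] := proj1 (is_deriveC_eps _ _ _) (cexp_deriv z) eps e0.
exists d; split=> // w /Hd.
by rewrite (_ : (a + cexp w - (a + cexp z) = cexp w - cexp z)%C); last ring.
Qed.

(** The radius is [exp s]: with its logarithm as coordinate, the annulus between two circles is the
    image of a rectangle in [(s, t)]. *)
Definition circle a s (t : R) : C := (a + cexp (s, t))%C.

Lemma circle_cont g a s t : entire g -> ccont (fun t => g (circle a s t)) t.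
Proof.
move=> H; have [l Hl] := entire_cexp_shift a H (s, t).
exact: RderivE_ccont (RderivE_comp (vline_deriv s t) Hl).
Qed.
Lemma circle_ex g a s : entire g -> exCInt (fun t => g (circle a s t)) (- PI) PI.
Proof. by move=> H; apply: exCInt_cont; [have := PI_RGT_0; lra|move=> x _; exact: circle_cont]. Qed.

Lemma Ci_cancel (x y z : C) : (x + Ci * z - x - Ci * y = 0)%C -> y = z.
Proof.
move=> E; have {E}: (Ci * (y - z) = 0)%C.
  transitivity (- (x + Ci * z - x - Ci * y))%C; first ring.
  by rewrite E; ring.
move/(f_equal (fun w => - Ci * w)%C); rewrite Cmult_0_r Cmult_assoc.
rewrite (_ : (- Ci * Ci = 1)%C); last by rewrite /Ci /Cmult /Copp /RtoC /=; f_equal; ring.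
rewrite Cmult_1_l => E; transitivity (z + (y - z))%C; first ring.
by rewrite E Cplus_0_r.
Qed.

(** Goursat for [g (a + cexp s)] on the rectangle with heights [- PI] and [PI]: by periodicity of
    [cexp] the horizontal sides cancel, so the vertical ones agree. *)
Lemma circle_mean_const g a s0 s1 : entire g -> s0 <= s1 ->
  CInt (fun t => g (circle a s0 t)) (- PI) PI = CInt (fun t => g (circle a s1 t)) (- PI) PI.
Proof.
move=> H s01; have P := PI_RGT_0.
have := @goursat_rect (fun s => g (a + cexp s)%C) s0 s1 (- PI) PI s01 ltac:(lra)
  (fun z _ => entire_cexp_shift a H z).
rewrite /rect_int /hseg_int /vseg_int /circle.
have -> : CInt (fun x => g (a + cexp (x, (- PI)%coqR))%C) s0 s1 = CInt (fun x => g (a + cexp (x, PI))%C) s0 s1.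
  by apply: RInt_ext => x _; rewrite /cexp /= cos_neg sin_neg sin_PI Ropp_0.
exact: Ci_cancel.
Qed.

Lemma Csub_eq0 (x y : C) : (x - y = 0)%C -> x = y.
Proof. by move=> E; transitivity (y + (x - y))%C; [ring|rewrite E Cplus_0_r]. Qed.

Lemma Cmod_eps_eq0 (x : C) : (forall eps, 0 < eps -> Cmod x <= eps) -> x = 0%C.
Proof.
move=> H; apply: Cmod_eq_0; have := Cmod_ge_0 x; case: (Rle_lt_dec (Cmod x) 0); first lra.
by move=> x0; have := H (Cmod x / 2) ltac:(lra); lra.
Qed.

Lemma isCInt_const (c : C) a b : isCInt (fun _ => c) a b (RtoC (b - a) * c)%C.
Proof.
have -> : (RtoC (b - a) * c)%C = scal (V:=C_R_NormedModule) (b - a) c.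
  by rewrite /scal /= /prod_scal /Cmult /scal /= /mult /=; f_equal; ring.
exact: (is_RInt_const (V:=C_R_NormedModule)).
Qed.

(** The mean is independent of the radius, so the circle may be shrunk until continuity at the
    centre gives the value within [eps]. *)
Lemma circle_mean g a s : entire g ->
  CInt (fun t => g (circle a s t)) (- PI) PI = (RtoC (2 * PI) * g a)%C.
Proof.
move=> H; have P := PI_RGT_0.
apply: Csub_eq0.
apply: Cmod_eps_eq0 => eps e0.
have [l Hl] := H a.
have [d [d0 Hd]] := CderivE_cont_eps Hl (eps := eps / (2 * PI)) ltac:(apply: Rdiv_lt_0_compat; lra).
have [s' [ss' s'd]] : exists s', s' <= s /\ exp s' < d.
  exists (Rmin s (ln d - 1)); split; first exact: Rmin_l.
  rewrite -{2}(exp_ln d) //; apply: exp_increasing; have := Rmin_r s (ln d - 1); lra.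
rewrite -(@circle_mean_const g a s' s H ss').
have K := @isCInt_const (g a) (- PI) PI.
have -> : (RtoC (2 * PI) * g a)%C = CInt (fun _ => g a) (- PI) PI.
  by rewrite (CInt_unique K); f_equal; f_equal; ring.
rewrite -CInt_minus; [|exact: circle_ex|by eexists; exact: K].
apply: Rle_trans (CInt_bound (M := eps / (2 * PI)) _ _ _) _; first lra.
- apply: exCInt_cont; first lra; move=> x _.
  exact: (continuous_minus (V:=C_R_NormedModule) _ _ _ (@circle_cont g a s' x H) (continuous_const _ _)).
- move=> t _; apply/Rlt_le/Hd; rewrite /circle (_ : (a + cexp (s', t) - a = cexp (s', t))%C); last ring.
  by rewrite Cmod_cexp.
- by apply: Req_le; field; lra.
Qed.

Lemma segment_bound (g dg : C -> C) a b M :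
  (forall t, 0 <= t <= 1 -> CderivE g (a + RtoC t * (b - a))%C (dg (a + RtoC t * (b - a))%C) /\
     Cmod (dg (a + RtoC t * (b - a))%C) <= M) ->
  Cmod (g b - g a)%C <= 2 * M * Cmod (b - a)%C.
Proof.
move=> H.
have := @mean_value_bound (fun t => g (a + RtoC t * (b - a))%C)
  (fun t => (b - a) * dg (a + RtoC t * (b - a)))%C 0 1 (M * Cmod (b - a)%C) ltac:(lra).
rewrite Cmult_0_l Cplus_0_r Cmult_1_l (_ : (a + (b - a) = b)%C); last ring.
move=> H'; apply: Rle_trans (H' _) _; last by apply: Req_le; ring.
move=> t Ht; have [H1 H2] := H t Ht; split.
  by apply: RderivE_comp => //; exact: RderivE_line.
by rewrite Cmod_mult Rmult_comm; apply: Rmult_le_compat_r => //; exact: Cmod_ge_0.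
Qed.

(* Mean values over large circles centred at two points differ by little
   when the derivative is small at infinity. *)
Lemma liouville_deriv (g dg : C -> C) : (forall z, CderivE g z (dg z)) ->
  (forall eps, 0 < eps -> exists M, forall z, M < Cmod z -> Cmod (dg z) <= eps) ->
  forall a b, g a = g b.
Proof.
move=> H Hv a b; have P := PI_RGT_0.
have E : entire g by move=> z; exists (dg z).
suff : (RtoC (2 * PI) * g b - RtoC (2 * PI) * g a = 0)%C.
  move=> K; apply: NNPP => N.
  have : (RtoC (2 * PI) * (g b - g a) = 0)%C by rewrite -K; ring.
  move/(f_equal Cmod); rewrite Cmod_mult Cmod_0 Cmod_R => /Rmult_integral [].
    by rewrite Rabs_pos_eq; lra.
  by move/Cmod_eq_0 => K2; apply: N; symmetry; apply: Csub_eq0.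
apply: Cmod_eps_eq0 => eps e0.
set D := Cmod (b - a)%C; have D0 : 0 <= D by exact: Cmod_ge_0.
have [e1 [e10 He1]] : exists e, 0 < e /\ 2 * PI * (2 * e * D) <= eps.
  exists (eps / (4 * PI * (D + 1))); split; first by apply: Rdiv_lt_0_compat; nra.
  have -> : 2 * PI * (2 * (eps / (4 * PI * (D + 1))) * D) = eps * (D / (D + 1)) by field; lra.
  have : D / (D + 1) <= 1 by apply/Rle_div_l; lra.
  by have : 0 <= D / (D + 1) by [apply: Rdiv_le_0_compat; lra]; nra.
have [M HM] := Hv e1 e10.
(* A point on a segment joining corresponding points of the two circles has modulus at least
   [r - Cmod a - D], hence greater than [M]; [Rabs] covers a negative [M]. *)
set r := Rabs M + Cmod a + D + 1.
have r0 : 0 < r.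
  by rewrite /r; have := Rabs_pos M; have := Cmod_ge_0 a; lra.
rewrite -(@circle_mean g b (ln r) E) -(@circle_mean g a (ln r) E) -CInt_minus; try exact: circle_ex.
apply: Rle_trans (CInt_bound (M := 2 * e1 * D) _ _ _) _; first lra.
- apply: exCInt_cont; first lra; move=> x _.
  exact: (continuous_minus (V:=C_R_NormedModule) _ _ _ (@circle_cont g b _ x E) (@circle_cont g a _ x E)).
- move=> t _; rewrite /D (_ : (b - a = circle b (ln r) t - circle a (ln r) t)%C); last by rewrite /circle; ring.
  apply: segment_bound => // u Hu; split; first exact: H.
  apply: HM; rewrite /circle.
  rewrite (_ : (_ + _ = cexp (ln r, t) - (- (a + u * (b - a))))%C); last ring.
  have T : Cmod (cexp (ln r, t)) <= Cmod (cexp (ln r, t) - - (a + u * (b - a)))%C + Cmod (- (a + u * (b - a)))%C.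
    apply: Rle_trans (Cmod_triangle _ _); apply: Req_le; f_equal; ring.
  rewrite Cmod_cexp /= exp_ln // Cmod_opp in T.
  have T2 := Cmod_triangle a (u * (b - a))%C; rewrite Cmod_mult Cmod_R Rabs_pos_eq in T2; last lra.
  have := Rmult_le_compat_r D u 1 D0 ltac:(lra); rewrite -/D in T2 *.
  have := Rle_abs M; have rE : r = Rabs M + Cmod a + D + 1 by []. 
  lra.
- lra.
Qed.

(** * Rules of differentiation *)

Lemma CderivE_eq (f : C -> C) (z k l : C) : k = l -> CderivE f z k -> CderivE f z l.
Proof. by move=> ->. Qed.

Lemma CderivE_ext (f g : C -> C) (z l : C) : (forall t, f t = g t) -> CderivE f z l -> CderivE g z l.
Proof. by move=> H; apply: is_derive_ext. Qed.

Lemma CderivE_const (c z : C) : CderivE (fun _ => c) z (RtoC 0).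
Proof. exact: (is_derive_const (V:=C_NormedModule)). Qed.

Lemma CderivE_plus (f g : C -> C) z k l : CderivE f z k -> CderivE g z l ->
  CderivE (fun w => f w + g w)%C z (k + l)%C.
Proof. by move=> H1 H2; apply: (is_derive_plus (V:=C_NormedModule)). Qed.

Lemma CderivE_scal (f : C -> C) (c z k : C) : CderivE f z k ->
  CderivE (fun w => c * f w)%C z (c * k)%C.
Proof.
move=> H; apply: (CderivE_eq (k := (k * c)%C)); first ring.
apply: (@CderivE_comp (fun w => c * w)%C f z k c _ H).
apply: (@CderivE_ext (fun w => 0 + c * w)%C).
  by move=> t; rewrite Cplus_0_l.
exact: CderivE_affine.
Qed.

Lemma CderivE_square (f : C -> C) z k : CderivE f z k ->
  CderivE (fun w => f w * f w)%C z (2 * f z * k)%C.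
Proof.
move=> H; apply: (CderivE_eq (k := (k * (0 + 2 * f z))%C)); first ring.
apply: (@CderivE_comp (fun w => w * w)%C f z k _ _ H).
apply: (@CderivE_ext (fun w => 0 * w + 2 / 2 * (w * w))%C).
  by move=> t; field; move/RtoC_inj; lra.
exact: CderivE_quad.
Qed.

(* Polarization reduces products to squares. *)
Lemma CderivE_mult (f g : C -> C) z k l : CderivE f z k -> CderivE g z l ->
  CderivE (fun w => f w * g w)%C z (k * g z + f z * l)%C.
Proof.
move=> Hf Hg.
have n2 : RtoC 2 <> 0%C by move/RtoC_inj; lra.
apply: (CderivE_eq (k := (/ 2 * (2 * (f z + g z) * (k + l) - 2 * f z * k - 2 * g z * l))%C)).
  by field.
apply: (@CderivE_ext
  (fun w => / 2 * ((f w + g w) * (f w + g w) - f w * f w - g w * g w))%C).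
  by move=> t; field.
apply: CderivE_scal; apply: CderivE_minus; last exact: CderivE_square.
apply: CderivE_minus; last exact: CderivE_square.
by apply: CderivE_square; exact: CderivE_plus.
Qed.

Lemma CderivE_inv (z : C) : z <> 0%C -> CderivE Cinv z (- / (z * z))%C.
Proof.
move=> z0; apply/is_deriveC_eps => eps e0.
have zp : 0 < Cmod z by apply/Cmod_gt_0.
set m := Cmod z in zp.
have m3 : 0 < m * m * m by do 2 apply: Rmult_lt_0_compat => //.
exists (Rmin (m / 2) (eps * (m * m * m) / 2)); split.
  by apply: Rmin_pos; first lra; apply: Rdiv_lt_0_compat; [|lra]; apply: Rmult_lt_0_compat.
move=> w Hw.
have Hw1 := Rlt_le_trans _ _ _ Hw (Rmin_l _ _).
have Hw2 := Rlt_le_trans _ _ _ Hw (Rmin_r _ _).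
have wm : m / 2 <= Cmod w.
  have : m <= Cmod w + Cmod (w - z)%C; last lra.
  have -> : m = Cmod (w + - (w - z))%C by rewrite /m; f_equal; ring.
  by apply: Rle_trans (Cmod_triangle _ _) _; rewrite Cmod_opp; lra.
have w0 : w <> 0%C by apply/Cmod_gt_0; lra.
have -> : (/ w - / z - (w - z) * - / (z * z) = (w - z) * ((w - z) / (w * (z * z))))%C.
  by field.
rewrite Cmod_mult Rmult_comm; apply: Rmult_le_compat_r; first exact: Cmod_ge_0.
rewrite Cmod_div; last by apply: Cmult_neq_0 => //; exact: Cmult_neq_0.
rewrite !Cmod_mult -/m; apply/Rle_div_l; first by apply: Rmult_lt_0_compat; nra.
have : eps * (m / 2 * (m * m)) <= eps * (Cmod w * (m * m)).
  by apply: Rmult_le_compat_l; first lra; apply: Rmult_le_compat_r => //; nra.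
lra.
Qed.

Lemma Csub0r (x : C) : (x - 0 = x)%C.
Proof. ring. Qed.
Lemma Csub0l (x : C) : (0 - x = - x)%C.
Proof. ring. Qed.

(** ** The principal logarithm *)

Lemma continuous_C_eps (f : C -> R) (z : C) : continuous (T:=C_UniformSpace) (U:=R_UniformSpace) f z ->
  forall eps, 0 < eps -> exists del, 0 < del /\ forall w, Cmod (w - z)%C < del -> Rabs (f w - f z) < eps.
Proof.
move=> H eps e0; have /H [d Hd] := locally_ball (f z) (mkposreal eps e0).
exists d; split; first exact: cond_pos.
by move=> w Hw; apply: Hd; exact: C_NormedModule_mixin_compat1.
Qed.

Lemma Cmod_continuous (z : C) : continuous (T:=C_UniformSpace) (U:=R_UniformSpace) Cmod z.
Proof.
apply: (continuous_comp (fun z : C => z.1 ^ 2 + z.2 ^ 2) sqrt); last exact: continuous_sqrt.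
apply: (continuous_plus (V:=R_NormedModule)).
- apply: (continuous_mult (K:=R_AbsRing)); first exact: continuous_fst.
  by apply: (continuous_mult (K:=R_AbsRing)); [exact: continuous_fst|exact: continuous_const].
- apply: (continuous_mult (K:=R_AbsRing)); first exact: continuous_snd.
  by apply: (continuous_mult (K:=R_AbsRing)); [exact: continuous_snd|exact: continuous_const].
Qed.

(** The second quantity is the denominator in the half-angle formula of [Clog]; its positivity gives
    continuity of the argument. *)
Lemma D1_pos z : D1 z -> 0 < Cmod z /\ 0 < Cmod z + z.1.
Proof.
move=> H; have [_ E] := Clog_principal H.
have M := Cmod_ge_0 z; have F := Rabs_fst_le z.
have E2 := Cmod2_alt z; rewrite /Re /Im in E2.
have FA := Rle_abs (- z.1); rewrite Rabs_Ropp in FA.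
have N : ~ Cmod z + z.1 <= 0.
  move=> K; apply: H; rewrite /Im /Re; have Ez : Cmod z = - z.1 by lra.
  by rewrite Ez in E2 M; split; [nra|lra].
split; last lra.
case: (Req_dec (Cmod z) 0) => Z; last lra.
by rewrite Z in F N; have := Rabs_pos z.1; have := Rle_abs z.1; lra.
Qed.

Lemma D1_neq0 z : D1 z -> z <> 0%C.
Proof. by move/D1_pos => [/Cmod_gt_0]. Qed.

Lemma cexp_Clog z : D1 z -> cexp (Clog z) = z.
Proof.
move=> /Clog_principal [_ E]; rewrite -{2}E /cexp /Re /Im /Cmult /RtoC.
by apply: injective_projections => /=; ring.
Qed.

Lemma Clog_continuous z : D1 z -> forall eps, 0 < eps -> exists del, 0 < del /\
  forall w, Cmod (w - z)%C < del -> Cmod (Clog w - Clog z)%C < eps.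
Proof.
move=> H eps e0; have [P1 P2] := D1_pos H.
have c1 : continuous (T:=C_UniformSpace) (U:=R_UniformSpace) (fun w : C => (Clog w).1) z.
  by apply: (continuous_comp Cmod ln); [exact: Cmod_continuous|exact: continuous_ln].
have c2 : continuous (T:=C_UniformSpace) (U:=R_UniformSpace) (fun w : C => (Clog w).2) z.
  apply: (continuous_mult (K:=R_AbsRing)); first exact: continuous_const.
  apply: (continuous_comp (fun w : C => Im w / (Cmod w + Re w)) atan); last exact: continuous_atan.
  apply: (continuous_mult (K:=R_AbsRing)); first exact: continuous_snd.
  apply: (continuous_comp (fun w : C => Cmod w + Re w) Rinv).
    by apply: (continuous_plus (V:=R_NormedModule)); [exact: Cmod_continuous|exact: continuous_fst].
  by apply: continuous_Rinv; rewrite /Re; lra.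
have [d1 [d10 H1]] := continuous_C_eps c1 (eps := eps / 2) ltac:(lra).
have [d2 [d20 H2]] := continuous_C_eps c2 (eps := eps / 2) ltac:(lra).
exists (Rmin d1 d2); split; first exact: Rmin_pos.
move=> w Hw; apply: Rle_lt_trans (Cmod_le_sum _) _.
have := H1 w (Rlt_le_trans _ _ _ Hw (Rmin_l _ _)).
have := H2 w (Rlt_le_trans _ _ _ Hw (Rmin_r _ _)).
rewrite /Rminus /= => ? ?; lra.
Qed.

(** [Cmod w + w.1] is continuous, positive at [z], and zero on the slit. *)
Lemma D1_open z : D1 z -> exists del, 0 < del /\ forall w, Cmod (w - z)%C < del -> D1 w.
Proof.
move=> H; have [P1 P2] := D1_pos H.
have c : continuous (T:=C_UniformSpace) (U:=R_UniformSpace) (fun w : C => Cmod w + w.1) z.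
  by apply: (continuous_plus (V:=R_NormedModule)); [exact: Cmod_continuous|exact: continuous_fst].
have [d [d0 Hd]] := continuous_C_eps c P2.
exists d; split=> // w /Hd K [K1 K2].
have : Cmod w + w.1 <= 0.
  have -> : w = RtoC w.1 by rewrite [LHS]surjective_pairing; rewrite /Im in K1; rewrite K1.
  by rewrite Cmod_R Rabs_left1 //=; lra.
have := Rabs_def2 _ _ K; lra.
Qed.

Lemma D0_D1 z : D0 z <-> D1 (1 - z)%C.
Proof.
rewrite /D0 /D1 /Re /Im /=; split=> H [H1 H2]; apply: H; split; lra.
Qed.
Lemma D1_D0 z : D1 z <-> D0 (1 - z)%C.
Proof.
rewrite /D0 /D1 /Re /Im /=; split=> H [H1 H2]; apply: H; split; lra.
Qed.

Lemma D0_open z : D0 z -> exists del, 0 < del /\ forall w, Cmod (w - z)%C < del -> D0 w.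
Proof.
move/D0_D1/D1_open => [d [d0 Hd]]; exists d; split=> // w Hw; apply/D0_D1/Hd.
by rewrite (_ : (1 - w - (1 - z) = - (w - z))%C) ?Cmod_opp //; ring.
Qed.

(** Inversion of [cexp]: for [d = Clog w - Clog z] one has [cexp d - 1 = (w - z) / z], while
    [cexp d - 1 - d] is small compared with [d]. Taking [e <= 1/2] absorbs this error and gives
    [Cmod d <= 2 * Cmod ((w - z) / z)]. *)
Lemma Clog_deriv z : D1 z -> CderivE Clog z (/ z)%C.
Proof.
move=> H; apply/is_deriveC_eps => eps e0.
have z0 := D1_neq0 H; have [P1 _] := D1_pos H.
set e := Rmin (1/2) (eps * Cmod z / 2).
have e10 : 0 < e by apply: Rmin_pos; nra.
have e11 : e <= 1/2 := Rmin_l _ _.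
have e12 : e <= eps * Cmod z / 2 := Rmin_r _ _.
have [d1 [d10 H1]] := cexp_near0 e10.
have [d2 [d20 H2]] := Clog_continuous H d10.
have [d3 [d30 H3]] := D1_open H.
exists (Rmin d2 d3); split; first exact: Rmin_pos.
move=> w Hw.
have Hw2 := Rlt_le_trans _ _ _ Hw (Rmin_l _ _).
have Hw3 := H3 _ (Rlt_le_trans _ _ _ Hw (Rmin_r _ _)).
have {}H1 := H1 _ (H2 _ Hw2).
set d := (Clog w - Clog z)%C in H1 *.
have E : (w = z * cexp d)%C.
  rewrite -{1}(cexp_Clog Hw3) -{1}(cexp_Clog H) -cexpD; f_equal; rewrite /d; ring.
have E2 : (cexp d - 1 = (w - z) / z)%C by rewrite {1}E; field.
rewrite E2 in H1.
have -> : (d - (w - z) * / z = - ((w - z) / z - d))%C by rewrite /Cdiv; ring.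
rewrite Cmod_opp.
have T : Cmod d <= Cmod ((w - z) / z - d)%C + Cmod ((w - z) / z)%C.
  have -> : Cmod d = Cmod (- ((w - z) / z - d) + (w - z) / z)%C by f_equal; ring.
  by apply: Rle_trans (Cmod_triangle _ _) _; rewrite Cmod_opp; lra.
have D0 := Cmod_ge_0 d.
have T2 : Cmod d <= 2 * Cmod ((w - z) / z)%C by nra.
apply: Rle_trans H1 _; apply: Rle_trans (Rmult_le_compat_l _ _ _ (Rlt_le _ _ e10) T2) _.
rewrite Cmod_div //.
set m := Cmod (w - z)%C.
have m0 : 0 <= m by exact: Cmod_ge_0.
apply: (Rle_trans _ ((eps * Cmod z / 2) * (2 * (m / Cmod z)))).
  apply: Rmult_le_compat_r => //.
  by have : 0 <= m / Cmod z by [apply: Rdiv_le_0_compat]; lra.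
by apply: Req_le; field; lra.
Qed.

(** ** Primitives on D0 *)

Definition betw (a b x : R) := Rmin a b <= x <= Rmax a b.

Lemma betwC a b x : betw a b x -> betw b a x.
Proof. by rewrite /betw Rmin_comm Rmax_comm. Qed.

Lemma CInt_swap (f : R -> C) a b : exCInt f a b -> CInt f b a = (- CInt f a b)%C.
Proof. by move=> H; rewrite -(opp_RInt_swap (V:=C_R_CompleteNormedModule)). Qed.

Lemma exCInt_betw (f : R -> C) a b : (forall x, betw a b x -> ccont f x) -> exCInt f a b.
Proof. exact: (ex_RInt_continuous (V:=C_R_CompleteNormedModule)). Qed.

Lemma CInt_bound_abs (f : R -> C) a b M : exCInt f a b ->
  (forall x, betw a b x -> Cmod (f x) <= M) -> Cmod (CInt f a b) <= Rabs (b - a) * M.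
Proof.
move=> /CInt_correct H B; rewrite -Cmod_normR.
apply: (norm_RInt_le_const_abs (V:=C_R_NormedModule) f a b _ M _ H).
by move=> x /B; rewrite Cmod_normR.
Qed.

Lemma rect_int_swap1 (x y z w : C) : (- x + Ci * z - - y - Ci * w = 0)%C ->
  (x + Ci * w - y - Ci * z = 0)%C.
Proof.
move=> E; transitivity (- (- x + Ci * z - - y - Ci * w))%C; first ring.
by rewrite E; ring.
Qed.
Lemma rect_int_swap2 (x y z w : C) : (x + Ci * - z - y - Ci * - w = 0)%C ->
  (y + Ci * z - x - Ci * w = 0)%C.
Proof.
move=> E; transitivity (- (x + Ci * - z - y - Ci * - w))%C; first ring.
by rewrite E; ring.
Qed.

(** The sides of the paths used by [prim0] may run in either direction; reversing one pair of
    endpoints only changes the sign of the contour integral. *)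
Lemma goursat_any h a b c d :
  (forall x y, betw a b x -> betw c d y -> exists l, CderivE h (x, y) l) ->
  rect_int h a b c d = 0%C.
Proof.
wlog ab : a b / a <= b.
  move=> W H; case: (Rle_dec a b) => ab; first exact: W.
  have ba : b <= a by lra.
  have := W b a ba (fun x y Hx Hy => H x y (betwC Hx) Hy).
  have hx y : betw c d y -> exCInt (fun x => h (x, y)) a b.
    move=> Hy; apply: exCInt_betw => x Hx; have [l Hl] := H x y Hx Hy.
    exact: RderivE_ccont (RderivE_comp (hline_deriv y x) Hl).
  rewrite /rect_int /hseg_int (CInt_swap (hx c _)) ?(CInt_swap (hx d _)) /betw.
  - exact: rect_int_swap1.
  - by split; [exact: Rmin_r|exact: Rmax_r].
  - by split; [exact: Rmin_l|exact: Rmax_l].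
wlog cd : c d / c <= d.
  move=> W H; case: (Rle_dec c d) => cd; first exact: W.
  have dc : d <= c by lra.
  have := W d c dc (fun x y Hx Hy => H x y Hx (betwC Hy)).
  have hy x : betw a b x -> exCInt (fun y => h (x, y)) c d.
    move=> Hx; apply: exCInt_betw => y Hy; have [l Hl] := H x y Hx Hy.
    exact: RderivE_ccont (RderivE_comp (vline_deriv x y) Hl).
  rewrite /rect_int /vseg_int (CInt_swap (hy a _)) ?(CInt_swap (hy b _)) /betw.
  - exact: rect_int_swap2.
  - by split; [exact: Rmin_r|exact: Rmax_r].
  - by split; [exact: Rmin_l|exact: Rmax_l].
move=> H; apply: goursat_rect => // [[x y]] [Hx Hy].
by apply: H; rewrite /betw Rmin_left // Rmax_right.
Qed.

Definition holoD0 (G : C -> C) := forall z, D0 z -> exists l, CderivE G z l.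

Lemma betw_cases a b x : betw a b x -> a <= x <= b \/ b <= x <= a.
Proof. by rewrite /betw /Rmin /Rmax; case: Rle_dec; lra. Qed.

(* The path from [0] to [z] that is first vertical, then horizontal, stays in [D0]. *)
Definition prim0 (G : C -> C) (z : C) : C := (Ci * vseg_int G 0 z.2 0 + hseg_int G 0 z.1 z.2)%C.

(** By Goursat on the rectangle with horizontal side from 0 to [x] and vertical side from [y] to
    [y'], the increment of [prim0 G] is the integral along the two short sides joining [(x, y)] to
    [(x', y')], where [G] is within [eps / 2] of its value at [z]. *)
Lemma prim0_deriv G z : holoD0 G -> D0 z -> CderivE (prim0 G) z (G z).
Proof.
move=> HG Hz; apply/is_deriveC_eps => eps e0.
have [l Hl] := HG z Hz.
have [d1 [d10 H1]] := CderivE_cont_eps Hl (eps := eps / 2) ltac:(lra).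
have [d2 [d20 H2]] := D0_open Hz.
(* Keeps the rectangle inside [D0]: if [z.2] is nonzero it does not reach the real axis; if [z.2] is
   0, then [z.1 < 1] and it meets the axis left of the slit. *)
pose d3 := if Req_EM_T z.2 0 then 1 else Rabs z.2.
have d30 : 0 < d3 by rewrite /d3; case: (Req_EM_T z.2 0) => [?|?]; [exact: Rlt_0_1|exact: Rabs_pos_lt].
exists (Rmin (Rmin d1 d2) d3 / 2); split.
  by apply: Rdiv_lt_0_compat; last lra; do 2 apply: Rmin_pos => //.
move=> w Hw; set d := Rmin (Rmin d1 d2) d3 in Hw.
have dd1 : d <= d1 by apply: Rle_trans (Rmin_l _ _) (Rmin_l _ _).
have dd2 : d <= d2 by apply: Rle_trans (Rmin_l _ _) (Rmin_r _ _).
have dd3 : d <= d3 by exact: Rmin_r.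
case: z Hz Hl H1 H2 @d3 d30 @d Hw dd1 dd2 dd3 => x y Hz Hl H1 H2 d3 d30 d Hw dd1 dd2 dd3.
case: w Hw => x' y' Hw.
have Ex := Rabs_fst_le ((x', y') - (x, y))%C; rewrite /= in Ex.
have Ey := Rabs_snd_le ((x', y') - (x, y))%C; rewrite /= in Ey.
set m := Cmod _ in Hw Ex Ey *.
have near u v : betw x x' u -> betw y y' v -> Cmod ((u, v) - (x, y))%C < d.
  move=> Hu Hv; apply: Rle_lt_trans (Cmod_le_sum _) _ => /=.
  have : Rabs (u + - x) <= Rabs (x' + - x).
    by case: (betw_cases Hu) => ?; [rewrite !Rabs_pos_eq|rewrite !Rabs_left1]; lra.
  have : Rabs (v + - y) <= Rabs (y' + - y).
    by case: (betw_cases Hv) => ?; [rewrite !Rabs_pos_eq|rewrite !Rabs_left1]; lra.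
  lra.
have xx : betw x x' x by split; [exact: Rmin_l|exact: Rmax_l].
have xx' : betw x x' x' by split; [exact: Rmin_r|exact: Rmax_r].
have yy : betw y y' y by split; [exact: Rmin_l|exact: Rmax_l].
have yy' : betw y y' y' by split; [exact: Rmin_r|exact: Rmax_r].
have inD u v : betw 0 x u -> betw y y' v -> D0 (u, v).
  move=> Hu Hv [V0 U1]; rewrite /Im /Re /= in V0 U1.
  case: (Req_dec y 0) => y0.
    by apply: Hz; rewrite /Im /Re /=; case: (betw_cases Hu); lra.
  have : d3 = Rabs y by rewrite /d3 /=; case: Req_EM_T.
  have := near x v xx Hv; rewrite V0 => /(Rle_lt_trans _ _ _ (Rabs_snd_le _)) /=.
  by rewrite Rplus_0_l Rabs_Ropp; lra.
have inD2 u v : betw x x' u -> betw y y' v -> D0 (u, v).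
  by move=> Hu Hv; apply: H2; have := near u v Hu Hv; lra.
have D0v t : D0 (0, t) by rewrite /D0 /Re /=; lra.
have cv u v : D0 (u, v) -> ccont (fun t => G (u, t)) v.
  by move=> /HG [k Hk]; exact: RderivE_ccont (RderivE_comp (vline_deriv u v) Hk).
have ch u v : D0 (u, v) -> ccont (fun t => G (t, v)) u.
  by move=> /HG [k Hk]; exact: RderivE_ccont (RderivE_comp (hline_deriv v u) Hk).
have Q := @goursat_any G 0 x y y' (fun u v Hu Hv => HG _ (inD u v Hu Hv)).
have E : (prim0 G (x', y') - prim0 G (x, y) =
   Ci * CInt (fun t => G (x, t)) y y' + CInt (fun t => G (t, y')) x x')%C.
  rewrite /prim0 /= /vseg_int /hseg_int.
  rewrite (@CInt_Chasles (fun t => G (0, t)) 0 y y'); try by apply: exCInt_betw => t _; exact: cv.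
  rewrite (@CInt_Chasles (fun t => G (t, y')) 0 x x'); try by apply: exCInt_betw => t Ht; apply: ch; auto.
  rewrite /rect_int /hseg_int /vseg_int in Q.
  move: Q; move: (CInt _ _ _) (CInt _ _ _) (CInt _ _ _) (CInt _ _ _) (CInt _ _ _) (CInt _ _ _) => A B C D E F Q.
  apply: Csub_eq0; rewrite -[RHS]Copp_0 -Q; ring.
have Kv := @isCInt_const (G (x, y)) y y'.
have Kh := @isCInt_const (G (x, y)) x x'.
have -> : (prim0 G (x', y') - prim0 G (x, y) - ((x', y') - (x, y)) * G (x, y) =
   Ci * CInt (fun t => G (x, t) - G (x, y)) y y' + CInt (fun t => G (t, y') - G (x, y)) x x')%C.
  rewrite E !CInt_minus ?(CInt_unique Kv) ?(CInt_unique Kh); try by eexists; eassumption.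
  - have -> : ((x', y') - (x, y) = RtoC (x' - x) + Ci * RtoC (y' - y))%C.
      by rewrite /Cminus /Cplus /Copp /Ci /Cmult /RtoC /=; f_equal; ring.
    by move: (CInt _ _ _) (CInt _ _ _) => ? ?; ring.
  - by apply: exCInt_betw => t Ht; apply: ch; auto.
  - by apply: exCInt_betw => t Ht; apply: cv; auto.
apply: Rle_trans (Cmod_triangle _ _) _; rewrite Cmod_mult Cmod_Ci Rmult_1_l.
have B1 : Cmod (CInt (fun t => G (x, t) - G (x, y))%C y y') <= Rabs (y' - y) * (eps / 2).
  apply: CInt_bound_abs.
    apply: exCInt_betw => t Ht.
    exact: (continuous_minus (V:=C_R_NormedModule) _ _ _ (cv _ _ (inD2 _ _ xx Ht)) (continuous_const _ _)).
  by move=> t Ht; apply/Rlt_le/H1; have := near _ _ xx Ht; lra.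
have B2 : Cmod (CInt (fun t => G (t, y') - G (x, y))%C x x') <= Rabs (x' - x) * (eps / 2).
  apply: CInt_bound_abs.
    apply: exCInt_betw => t Ht.
    exact: (continuous_minus (V:=C_R_NormedModule) _ _ _ (ch _ _ (inD2 _ _ Ht yy')) (continuous_const _ _)).
  by move=> t Ht; apply/Rlt_le/H1; have := near _ _ Ht yy'; lra.
apply: Rle_trans (Rplus_le_compat _ _ _ _ B1 B2) _.
have := Rmult_le_compat_l (eps / 2) _ _ ltac:(lra) Ex.
have := Rmult_le_compat_l (eps / 2) _ _ ltac:(lra) Ey.
rewrite /Rminus => ? ?; lra.
Qed.

Lemma prim0_0 G : prim0 G 0 = 0%C.
Proof.
rewrite /prim0 /vseg_int /hseg_int /= !(RInt_point (V:=C_R_CompleteNormedModule)).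
by rewrite Cmult_0_r Cplus_0_l.
Qed.

Lemma D0_star z s : D0 z -> 0 <= s <= 1 -> D0 (RtoC s * z)%C.
Proof.
move=> H Hs [H1 H2]; apply: H; move: H1 H2; rewrite /Re /Im /= => H1 H2.
have H3 : s * z.2 = 0 by lra. have H4 : 1 <= s * z.1 by lra.
case: (Rmult_integral _ _ H3) => E; first by rewrite E in H4; lra.
split=> //; apply: Rnot_lt_le => K.
have s0 : 0 < s by apply: Rnot_le_lt => s0; have s1 : s = 0 by [lra]; rewrite s1 in H4; lra.
by have := Rmult_lt_compat_l s _ _ s0 K; lra.
Qed.

Lemma D0_0 : D0 0%C.
Proof. by rewrite /D0 /Re /=; lra. Qed.

(* Division by [z] preserves holomorphy at [0] because the second order
   Taylor expansion of a primitive of a function differentiable at [0] exists. *)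
Lemma div_by_z (F G : C -> C) : holoD0 G -> (forall z, D0 z -> CderivE F z (G z)) -> F 0%C = 0%C ->
  exists v, holoD0 v /\ forall z, D0 z -> F z = (z * v z)%C.
Proof.
move=> HG HF F0.
exists (fun z : C => if excluded_middle_informative (z = 0%C) then G 0%C else (F z / z)%C).
split; last first.
  move=> z Hz; case: excluded_middle_informative => [E|zn] /=; first by rewrite E F0 Cmult_0_l.
  by field.
move=> z Hz; case: (excluded_middle_informative (z = 0%C)) => z0; last first.
  exists (G z / z - F z / (z * z))%C; apply/is_deriveC_eps.
  have zp : 0 < Cmod z by apply/Cmod_gt_0.
  have K : CderivE (fun w => F w * / w)%C z (G z / z - F z / (z * z))%C.
    have := CderivE_mult (HF z Hz) (CderivE_inv z0).
    by apply: CderivE_eq; field.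
  move=> eps e0; have [d [d0 Hd]] := proj1 (is_deriveC_eps _ _ _) K eps e0.
  (* The bound [Cmod z] keeps [w] away from 0, where the other branch of the definition applies. *)
  exists (Rmin d (Cmod z)); split; first exact: Rmin_pos.
  move=> w Hw; have {}Hd := Hd _ (Rlt_le_trans _ _ _ Hw (Rmin_l _ _)).
  case: (excluded_middle_informative (z = 0%C)) => [?|?] //=.
  case: (excluded_middle_informative (w = 0%C)) => wn /=; last exact: Hd.
  have := Rlt_le_trans _ _ _ Hw (Rmin_r _ _).
  by rewrite wn Csub0l Cmod_opp; lra.
subst z; have [g2 Hg2] := HG 0%C D0_0.
exists (g2 / 2)%C; apply/is_deriveC_eps => eps e0.
have [d [d0 Hd]] := proj1 (is_deriveC_eps _ _ _) Hg2 (eps / 2) ltac:(lra).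
have [d2 [d20 H2]] := D0_open D0_0.
exists (Rmin d d2); split; first exact: Rmin_pos.
move=> w Hw.
have Hwd := Rlt_le_trans _ _ _ Hw (Rmin_l _ _).
have Hw0 := H2 _ (Rlt_le_trans _ _ _ Hw (Rmin_r _ _)).
case: (excluded_middle_informative (RtoC 0 = RtoC 0)) => [?|?] //=.
case: excluded_middle_informative => [E|wn] /=.
  rewrite E (_ : (G 0 - G 0 - (0 - 0) * (g2 / 2) = 0)%C); last ring.
  by rewrite Cmod_0; have := Cmod_ge_0 (0 - 0)%C; nra.
have wp : 0 < Cmod w by apply/Cmod_gt_0.
rewrite Csub0r in Hwd *.
(* [F] minus its Taylor polynomial of order two has derivative at most [eps / 2 * Cmod w] along the
   segment from 0 to [w]; integrating gives a remainder quadratic in [w], which survives the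
   division by [w]. *)
have B := @segment_bound (fun z => F z - (G 0%C * z + g2 / 2 * (z * z)))%C
   (fun z => G z - (G 0%C + g2 * z))%C 0%C w (eps / 2 * Cmod w).
have {}B : Cmod (F w - (G 0 * w + g2 / 2 * (w * w)))%C <= eps * Cmod w * Cmod w.
  have := B _; rewrite F0 Csub0r => {}B.
  apply: Rle_trans (Req_le _ _ _) (Rle_trans _ _ _ (B _) (Req_le _ _ _)); last by field.
    by f_equal; ring.
  move=> t Ht; have -> : (0 + t * w = t * w)%C by ring.
  split.
    apply: CderivE_minus; last exact: CderivE_quad.
    by apply: HF; exact: D0_star.
  have dual_word : Cmod (t * w)%C <= Cmod w.
    by rewrite Cmod_mult Cmod_R Rabs_pos_eq; nra.
  have := Hd (t * w)%C; rewrite Csub0r => /(_ ltac:(lra)).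
  rewrite (_ : (G (t * w) - G 0 - t * w * g2 = G (t * w) - (G 0 + g2 * (t * w)))%C); last ring.
  by move=> K; apply: Rle_trans K _; apply: Rmult_le_compat_l; lra.
have -> : (F w / w - G 0 - w * (g2 / 2) = (F w - (G 0 * w + g2 / 2 * (w * w))) / w)%C.
  by field.
by rewrite Cmod_div //; apply/Rle_div_l.
Qed.

Lemma Csub_fst (x y : C) : (x - y)%C.1 = x.1 - y.1. Proof. by []. Qed.
Lemma Csub_snd (x y : C) : (x - y)%C.2 = x.2 - y.2. Proof. by []. Qed.

Lemma exp_le_mono x y : x <= y -> exp x <= exp y.
Proof. by move=> [/exp_increasing|->]; lra. Qed.

Lemma exp_powE x n : exp x ^ n = exp (INR n * x).
Proof.
elim: n => [|n IH]; first by rewrite Rmult_0_l exp_0.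
by rewrite -tech_pow_Rmult IH S_INR -exp_plus; f_equal; ring.
Qed.

Lemma CInt_ext (f g : R -> C) a b : (forall x, Rmin a b < x < Rmax a b -> f x = g x) ->
  (CInt f a b : C) = CInt g a b.
Proof. exact: (RInt_ext (V:=C_R_CompleteNormedModule)). Qed.

(** ** Iterated integrals *)

Lemma D0_neq1 z : D0 z -> (1 - z)%C <> 0%C.
Proof. by move/D0_D1/D1_neq0. Qed.

Lemma form1_deriv z : D0 z -> CderivE (form true) z (/ ((1 - z) * (1 - z)))%C.
Proof.
move=> /D0_neq1 H; rewrite /form.
apply: (CderivE_eq (k := (- (1) * (- / ((1 - z) * (1 - z))))%C)); first by field.
apply: (@CderivE_comp Cinv (fun w => 1 - w)%C z (- (1))%C _ (CderivE_inv H)).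
apply: (@CderivE_ext (fun w => 1 + - (1) * w)%C); first by move=> t; ring.
exact: CderivE_affine.
Qed.

Lemma CderivE_id z : CderivE (fun w => w) z (RtoC 1).
Proof.
apply: (@CderivE_ext (fun w => 0 + 1 * w)%C); first by move=> t; ring.
exact: CderivE_affine.
Qed.

(** [G] continues the integrand over 0, where [form false] has its pole. The fundamental theorem
    along the ray from 0 to [z], with primitive [prim0 G], turns the integral on the segment into
    [prim0 G z]. *)
Lemma iter_int_prim i w G : holoD0 G ->
  (forall t, D0 t -> t <> 0%C -> (form i t * iter_int w t)%C = G t) ->
  forall z, D0 z -> iter_int (i :: w) z = prim0 G z.
Proof.
move=> HG E z Hz; rewrite /= -/(iter_int w).
case: (excluded_middle_informative (z = RtoC 0)) => z0.
  rewrite z0 prim0_0; transitivity (CInt (fun _ => RtoC 0) 0 1).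
    by apply: CInt_ext => s _; rewrite Cmult_0_r Cmult_0_r Cmult_0_l.
  by rewrite (CInt_unique (@isCInt_const _ _ _)) Cmult_0_r.
transitivity (CInt (fun s => z * G (s * z)%C)%C 0 1).
  apply: CInt_ext => s; rewrite Rmin_left ?Rmax_right; try lra; move=> Hs.
  rewrite -E; first by move: (form _ _) (iter_int _ _) => ? ?; ring.
    by apply: D0_star => //; lra.
  by apply: Cmult_neq_0 => //; move/RtoC_inj; lra.
apply: CInt_unique.
have L : forall s, RderivE (fun s => RtoC s * z)%C s z.
  move=> s; apply: (is_derive_ext (V:=C_R_NormedModule) (fun s => 0 + RtoC s * z)%C).
    by move=> t; rewrite Cplus_0_l.
  exact: RderivE_line.
have := @isCInt_FTC (fun s => prim0 G (s * z)%C) (fun s => z * G (s * z)%C)%C 0 1 ltac:(lra).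
rewrite Cmult_0_l Cmult_1_l prim0_0 Csub0r; apply=> s Hs.
  apply: RderivE_comp; first exact: L.
  by apply: prim0_deriv => //; exact: D0_star.
have [l Hl] := HG _ (D0_star Hz Hs).
exact: RderivE_ccont (RderivE_comp (L s) (CderivE_scal z Hl)).
Qed.

Lemma CderivE_local (f g : C -> C) (D : C -> Prop) (z l : C) :
  (forall z, D z -> exists del, 0 < del /\ forall w, Cmod (w - z)%C < del -> D w) ->
  D z -> (forall t, D t -> f t = g t) -> CderivE f z l -> CderivE g z l.
Proof.
move=> Op Hz E /is_deriveC_eps H; apply/is_deriveC_eps => eps e0.
have [d [d0 Hd]] := H eps e0; have [d2 [d20 H2]] := Op _ Hz.
exists (Rmin d d2); split; first exact: Rmin_pos.
move=> w Hw; rewrite -(E z Hz) -E.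
  exact: Hd (Rlt_le_trans _ _ _ Hw (Rmin_l _ _)).
exact: H2 (Rlt_le_trans _ _ _ Hw (Rmin_r _ _)).
Qed.

(** Convention for words as sequences: [last false w] holds when [w] ends in xi1, and [last true w]
    also when it is empty. A nonempty [w] contributes a factor [t], which cancels the pole of xi0;
    an empty [w] forces the letter xi1, which is regular at 0. *)
Lemma iter_int_step i w : last false (i :: w) ->
  (last false w -> exists v, holoD0 v /\ forall z, D0 z -> iter_int w z = (z * v z)%C) ->
  exists G, [/\ holoD0 G,
    forall t, D0 t -> t <> 0%C -> (form i t * iter_int w t)%C = G t &
    forall z, D0 z -> CderivE (iter_int (i :: w)) z (G z)].
Proof.
move=> Li IH.
suff [G [HG E]] : exists G, holoD0 G /\
    forall t, D0 t -> t <> 0%C -> (form i t * iter_int w t)%C = G t.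
  exists G; split=> // z Hz.
  apply: (CderivE_local D0_open Hz _ (prim0_deriv HG Hz)) => t Ht.
  by rewrite (iter_int_prim HG E).
case: w Li IH => [|j w] Li IH.
  rewrite /= in Li; rewrite Li; exists (form true); split; last by move=> t _ _; rewrite Cmult_1_r.
  by move=> z Hz; eexists; exact: form1_deriv.
have [v [Hv E]] := IH Li; clear IH.
case: i Li => Li; last first.
  exists v; split=> // t Ht t0; rewrite E //; rewrite /form; field; exact: t0.
exists (fun t => form true t * (t * v t))%C; split; last first.
  by move=> t Ht t0; rewrite E.
move=> z Hz; have [l Hl] := Hv z Hz; eexists.
exact: CderivE_mult (form1_deriv Hz) (CderivE_mult (CderivE_id z) Hl).
Qed.

(** Holomorphy alone would not carry the induction: the zero at 0 must be divided out before the
    next xi0. *)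
Lemma iter_int_zfactor w : last false w ->
  exists v, holoD0 v /\ forall z, D0 z -> iter_int w z = (z * v z)%C.
Proof.
elim: w => [//|i w IH] Li; have [G [HG E Hd]] := iter_int_step Li IH.
apply: (div_by_z HG Hd).
by rewrite (iter_int_prim HG E D0_0) prim0_0.
Qed.

Lemma iter_int_deriv i w z : last false (i :: w) -> D0 z -> z <> 0%C ->
  CderivE (iter_int (i :: w)) z (form i z * iter_int w z)%C.
Proof.
move=> Li Hz z0; have [G [HG E Hd]] := iter_int_step Li (@iter_int_zfactor w).
by rewrite E //; exact: Hd.
Qed.

Lemma iter_int_holo w : last true w -> holoD0 (iter_int w).
Proof.
case: w => [|i w] Li z Hz; first by exists (RtoC 0); exact: CderivE_const.
by have [G [_ _ Hd]] := iter_int_step Li (@iter_int_zfactor w); exists (G z); exact: Hd.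
Qed.

Lemma iter_int_0 w : last false w -> iter_int w 0 = 0%C.
Proof. by move/iter_int_zfactor => [v [_ ->]]; [rewrite Cmult_0_l|exact: D0_0]. Qed.

(** * Growth of iterated integrals at infinity *)

Lemma D0_neg_cexp (s : C) : Rabs s.2 < PI -> D0 (- cexp s)%C.
Proof.
move=> H; rewrite /D0 /Im /Re /= => [[H1 H2]].
have e0 := exp_pos s.1.
have S : sin s.2 = 0.
  have : exp s.1 * sin s.2 = 0 by lra.
  by move/Rmult_integral => []; lra.
have [P1 P2] := Rabs_def2 _ _ H.
have Z : s.2 = 0.
  case: (Rtotal_order s.2 0) => [K|[//|K]].
  - by have := sin_gt_0 (- s.2) ltac:(lra) ltac:(lra); rewrite sin_neg; lra.
  - by have := sin_gt_0 s.2 K P1; lra.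
by rewrite Z cos_0 in H2; lra.
Qed.

(** For [t = - exp s] the product [t * form i t] is the form in the coordinate [s], hence the
    uniform bound. *)
Lemma form_bound_far i t : 2 <= Cmod t -> Cmod (t * form i t)%C <= 2.
Proof.
move=> H; rewrite Cmod_mult.
have t0 : t <> 0%C by apply/Cmod_gt_0; lra.
case: i => /=; last by rewrite Cmod_inv // Rinv_r; lra.
have T : Cmod t - 1 <= Cmod (1 - t)%C.
  have : Cmod t <= Cmod (- (1 - t))%C + Cmod 1.
    by have -> : Cmod t = Cmod (- (1 - t) + 1)%C; [f_equal; ring|exact: Cmod_triangle].
  by rewrite Cmod_opp Cmod_1; lra.
rewrite Cmod_inv; last by apply/Cmod_gt_0; lra.
by apply/Rle_div_l; lra.
Qed.

(* In the coordinate s with z = - exp s the slit plane becomes a strip, where the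
   segment from ln 2 to s has length at most 5 + ln |z|. *)
Lemma iter_int_growth w : last true w -> exists K n, 0 <= K /\
  forall z, D0 z -> 2 <= Cmod z -> Cmod (iter_int w z) <= K * (5 + ln (Cmod z)) ^ n.
Proof.
elim: w => [|i w IH] Li.
  by exists 1, 0%N; split; [lra|move=> z _ _ /=; rewrite Cmod_1; lra].
have {IH}[|K [n [K0 HK]]] := IH; first by case: w Li.
have L2 : 0 < ln 2 by rewrite -ln_1; apply: ln_increasing; lra.
have F2 := Cmod_ge_0 (iter_int (i :: w) (- (2))%C).
set F := iter_int (i :: w) in F2 *.
(* The base point is -2, that is [s = ln 2]. The 4 is the factor 2 of [segment_bound] times the
   bound 2 of [form_bound_far]; each integration costs one more power of the logarithm. *)
exists (Cmod (F (- (2))%C) + 4 * K), n.+1; split; first lra.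
move=> z Hz z2.
have Dz : D1 (- z)%C.
  move=> [H1 H2]; apply: Hz; move: H1 H2; rewrite /Im /Re /= => H1 H2; split; first lra.
  have := Cmod_le_sum z; have -> : z.2 = 0 by lra.
  by rewrite Rabs_R0 Rabs_pos_eq; lra.
have [B _] := Clog_principal Dz.
set s := Clog (- z)%C in B *; rewrite /Im in B.
have s1 : s.1 = ln (Cmod z) by rewrite /s /= Cmod_opp.
have Ez : (z = - cexp s)%C by rewrite cexp_Clog //; ring.
have E2 : (- (2) = - cexp (ln 2, 0))%C.
  by rewrite /cexp /= exp_ln ?cos_0 ?sin_0; [apply: injective_projections => /=; ring|lra].
have lz : ln 2 <= ln (Cmod z) by apply: ln_le; lra.
set l := ln (Cmod z) in s1 lz *.
have l5 : 0 < 5 + l by lra.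
have P4 := PI_4.
have := @segment_bound (fun s => F (- cexp s)%C)
  (fun s => (- cexp s) * (form i (- cexp s) * iter_int w (- cexp s)))%C (ln 2, 0) s (2 * (K * (5 + l) ^ n)).
rewrite -Ez -E2 => H.
have {}H : Cmod (F z - F (- (2))%C)%C <= 2 * (2 * (K * (5 + l) ^ n)) * Cmod (s - (ln 2, 0%coqR))%C.
  apply: H => t Ht; set u := (_ + _)%C.
  have u1 : u.1 = ln 2 + t * (l - ln 2) by rewrite -s1 /u /=; ring.
  have u2 : u.2 = t * s.2 by rewrite /u /=; ring.
  have ua : ln 2 <= u.1 <= l by rewrite u1; nra.
  have Du : D0 (- cexp u)%C by apply: D0_neg_cexp; apply: Rabs_def1; rewrite u2; nra.
  have um : 2 <= Cmod (- cexp u)%C.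
    by rewrite Cmod_opp Cmod_cexp -{1}(exp_ln 2); [apply: exp_le_mono|]; lra.
  split.
    apply: (@CderivE_comp F (fun s => - cexp s)%C); last exact: (is_derive_opp (V:=C_NormedModule)) (cexp_deriv u).
    by apply: iter_int_deriv => //; apply/Cmod_gt_0; lra.
  rewrite Cmult_assoc Cmod_mult; apply: Rmult_le_compat; try exact: Cmod_ge_0.
    exact: form_bound_far.
  apply: Rle_trans (HK _ Du um) _; apply: Rmult_le_compat_l => //.
  by rewrite Cmod_opp Cmod_cexp ln_exp; apply: pow_incr; lra.
have sl : Cmod (s - (ln 2, 0%coqR))%C <= 5 + l.
  apply: Rle_trans (Cmod_le_sum _) _; rewrite Csub_fst Csub_snd [(ln 2, _).1]/= [(ln 2, _).2]/= Rminus_0_r.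
  have s2 : Rabs s.2 <= PI by apply: Rabs_le; lra.
  by rewrite s1 (Rabs_pos_eq (l - ln 2)); lra.
have p0 : 0 <= (5 + l) ^ n by apply: pow_le; lra.
have p1 : 1 <= (5 + l) ^ n by apply: pow_R1_Rle; lra.
have T : Cmod (F z) <= Cmod (F (- (2))%C) + Cmod (F z - F (- (2))%C)%C.
  have {1}-> : (F z = F (- (2)) + (F z - F (- (2))))%C by ring.
  exact: Cmod_triangle.
apply: Rle_trans T _; rewrite Rmult_plus_distr_r; apply: Rplus_le_compat.
  have : 1 <= (5 + l) ^ n.+1 by apply: pow_R1_Rle; lra.
  nra.
apply: Rle_trans H _; rewrite -tech_pow_Rmult.
have KP : 0 <= K * (5 + l) ^ n by exact: Rmult_le_pos.
have := Rmult_le_compat_l _ _ _ KP sl; lra.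
Qed.

(** With [x] the absolute value of [ln (Cmod z)], powers of the logarithm are dominated by a square
    root of [Cmod z] or of its inverse. The scaling by [2 * k] makes the n-th power of
    [exp (x / (2 * k))] equal to [exp (x / 2)]. *)
Lemma pow_le_exp n : exists K, 0 < K /\ forall x, 0 <= x -> (1 + x) ^ n <= K * exp (x / 2).
Proof.
case: n => [|n].
  exists 1; split; first lra; move=> x x0 /=.
  by have := exp_ineq1_le (x / 2); lra.
set k := INR n.+1; have k1 : 1 <= k by rewrite /k S_INR; have := pos_INR n; lra.
exists ((2 * k) ^ n.+1); split; first by apply: pow_lt; lra.
move=> x x0.
have H : 1 + x <= 2 * k * exp (x / (2 * k)).
  have := exp_ineq1_le (x / (2 * k)) => H.
  apply: Rle_trans (Rmult_le_compat_l (2 * k) _ _ ltac:(lra) H).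
  rewrite (_ : 2 * k * (1 + x / (2 * k)) = 2 * k + x); last by field; lra.
  lra.
apply: Rle_trans (pow_incr _ _ n.+1 (conj _ H)) _; first lra.
rewrite Rpow_mult_distr; apply: Rmult_le_compat_l; first by apply: pow_le; lra.
by rewrite exp_powE -/k; apply: Req_le; f_equal; field; lra.
Qed.
End ComplexAnalysis.

Import GRing.Theory.
Local Open Scope ring_scope.

(** * Shuffle algebra *)

Section ShuffleAlgebra.
Variables (K : fieldType) (S : lalgType K).
Variables (W : seq bool -> S) (sh : S -> S -> S).
Definition letter_of (i : bool) : S := W [:: i].
Hypothesis char0 : forall n, n.+1%:R != 0 :> K.
Hypothesis mulZr : forall (c : K) (x y : S), x * (c *: y) = c *: (x * y).
Hypothesis W_nil : W [::] = 1.
Hypothesis W_cat : forall u v, W (u ++ v) = W u * W v.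
Hypothesis W_ind : forall P : S -> Prop, P 0 ->
  (forall c a b, P a -> P b -> P (c *: a + b)) -> (forall u, P (W u)) -> forall a, P a.
Hypothesis shL : forall c a a' b, sh (c *: a + a') b = c *: sh a b + sh a' b.
Hypothesis shR : forall c a b b', sh a (c *: b + b') = c *: sh a b + sh a b'.
Hypothesis sh1l : forall a, sh 1 a = a.
Hypothesis sh1r : forall a, sh a 1 = a.
Hypothesis sh_cons : forall i u j v, sh (W (i :: u)) (W (j :: v)) =
  letter_of i * sh (W u) (W (j :: v)) + letter_of j * sh (W (i :: u)) (W v).

Lemma W_cons i u : W (i :: u) = letter_of i * W u.
Proof. by rewrite /letter_of -W_cat. Qed.
Lemma W_rcons i u : W (rcons u i) = W u * letter_of i.
Proof. by rewrite /letter_of -W_cat cats1. Qed.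
Lemma shW0l a : sh (W [::]) a = a.
Proof. by rewrite W_nil sh1l. Qed.
Lemma shW0r a : sh a (W [::]) = a.
Proof. by rewrite W_nil sh1r. Qed.
Lemma shDl a b c : sh (a + b) c = sh a c + sh b c.
Proof. by have := shL 1 a b c; rewrite !scale1r. Qed.
Lemma shDr a b c : sh a (b + c) = sh a b + sh a c.
Proof. by have := shR 1 a b c; rewrite !scale1r. Qed.
Lemma mulL c (x a b : S) : x * (c *: a + b) = c *: (x * a) + x * b.
Proof. by rewrite mulrDr mulZr. Qed.

Lemma lin_eq (f g : S -> S) :
  (forall c a b, f (c *: a + b) = c *: f a + f b) ->
  (forall c a b, g (c *: a + b) = c *: g a + g b) ->
  (forall u, f (W u) = g (W u)) -> forall a, f a = g a.
Proof.
move=> fL gL E; apply: W_ind => //; last by move=> c a b Ea Eb; rewrite fL gL Ea Eb.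
by have := fL (-1) 0 0; have := gL (-1) 0 0; rewrite !scaleN1r oppr0 addr0 !addNr => -> ->.
Qed.

Notation "a '\ls' b" := (sh a b) (at level 40, left associativity).

Lemma sh_letter i j (a b : S) : (letter_of i * a) \ls (letter_of j * b) =
  letter_of i * (a \ls (letter_of j * b)) + letter_of j * ((letter_of i * a) \ls b).
Proof.
have mL := mulL.
move: a; apply: lin_eq => [c a a'|c a a'|u].
- by rewrite mL shL.
- rewrite mL (shL c a a' (letter_of j * b)) (shL c _ _ b) !mL.
  by rewrite scalerDr -!addrA; congr (_ + _); rewrite addrCA.
- move: b; apply: lin_eq => [c b b'|c b b'|v].
  + by rewrite mL shR.
  + rewrite mL (shR c _ (letter_of j * b) (letter_of j * b')) (shR c _ b b') !mL.
    by rewrite scalerDr -!addrA; congr (_ + _); rewrite addrCA.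
  + by rewrite -!W_cons sh_cons.
Qed.

(** Both sides split according to which of the three words supplies the first letter; the three
    remainders agree by induction on the total length. *)
Lemma shA_words n u v t : (size u + size v + size t < n)%N ->
  (W u \ls W v) \ls W t = W u \ls (W v \ls W t).
Proof.
elim: n u v t => [|n IH] u v t H; first by case: (notF H).
case: u H => [|i u] H; first by rewrite !shW0l.
case: v H => [|j v] H; first by rewrite shW0l shW0r.
case: t H => [|k t] H; first by rewrite !shW0r.
have E1 := IH u (j :: v) (k :: t); have E2 := IH (i :: u) v (k :: t).
have E3 := IH (i :: u) (j :: v) t; move: E1 E2 E3; rewrite !W_cons => E1 E2 E3.
have {}E1 := E1 ltac:(rewrite /= in H *; lia); have {}E2 := E2 ltac:(rewrite /= in H *; lia).
have {}E3 := E3 ltac:(rewrite /= in H *; lia).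
rewrite (sh_letter i j (W u) (W v)) shDl.
rewrite (sh_letter i k (W u \ls (letter_of j * W v)) (W t)).
rewrite (sh_letter j k ((letter_of i * W u) \ls W v) (W t)) E1 E2.
rewrite (sh_letter j k (W v) (W t)) !shDr.
rewrite (sh_letter i j (W u) (W v \ls (letter_of k * W t))).
rewrite (sh_letter i k (W u) ((letter_of j * W v) \ls W t)).
rewrite -E3 (sh_letter i j (W u) (W v)) shDl !mulrDr.
by rewrite -!addrA; congr (_ + _); rewrite [RHS]addrCA; congr (_ + _); rewrite addrCA.
Qed.

Lemma shA (a b c : S) : (a \ls b) \ls c = a \ls (b \ls c).
Proof.
move: a; apply: lin_eq => [d a a'|d a a'|u].
- by rewrite (shL d a a' b) shL.
- by rewrite shL.
move: b; apply: lin_eq => [d b b'|d b b'|v].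
- by rewrite (shR d _ b b') shL.
- by rewrite (shL d b b' c) shR.
move: c; apply: lin_eq => [d c c'|d c c'|t].
- by rewrite shR.
- by rewrite (shR d _ c c') shR.
exact: (shA_words (ltnSn _)).
Qed.

(** The words of a shuffle product, listed with multiplicity, so that properties of single words in
    the product can be stated. *)
Fixpoint shuf (u : seq bool) : seq bool -> seq (seq bool) :=
  match u with
  | [::] => fun v => [:: v]
  | i :: u' =>
      fix shufu (v : seq bool) :=
        match v with
        | [::] => [:: u]
        | j :: v' => map (cons i) (shuf u' v) ++ map (cons j) (shufu v')
        end
  end.

Definition sumW (l : seq (seq bool)) : S := \sum_(x <- l) W x.

Lemma sumW_cat l l' : sumW (l ++ l') = sumW l + sumW l'.
Proof. exact: big_cat. Qed.
Lemma sumW_cons l i : sumW (map (cons i) l) = letter_of i * sumW l.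
Proof. by rewrite /sumW big_map mulr_sumr; apply: eq_bigr => x _; rewrite W_cons. Qed.
Lemma sumW_hd x l : sumW (x :: l) = W x + sumW l.
Proof. exact: big_cons. Qed.
Lemma sumW1 x : sumW [:: x] = W x.
Proof. exact: big_seq1. Qed.

Lemma sw_shuf u v : W u \ls W v = sumW (shuf u v).
Proof.
elim: u v => [|i u IHu] v; first by rewrite ?shW0l ?shW0r /= sumW1.
elim: v => [|j v IHv]; first by rewrite ?shW0l ?shW0r /= sumW1.
by rewrite sh_cons IHu IHv [shuf _ _]/= sumW_cat !sumW_cons.
Qed.

Lemma shuf_perm u v : {in shuf u v, forall x, perm_eq x (u ++ v)}.
Proof.
elim: u v => [|i u IHu] v x; first by rewrite inE => /eqP ->.
elim: v x => [|j v IHv] x; first by rewrite inE cats0 => /eqP ->.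
rewrite /= mem_cat => /orP [] /mapP [y Hy ->].
  by rewrite perm_cons; exact: IHu.
apply: (@perm_trans _ (j :: (i :: u) ++ v)); first by rewrite perm_cons; exact: IHv.
by rewrite perm_sym; apply/permPl/(perm_catCA (i :: u) [:: j] v).
Qed.

Lemma shuf_one_last v : last true v -> {in shuf [:: true] v, forall x, last false x}.
Proof.
elim: v => [|j v IH] Hl x; first by rewrite inE => /eqP ->.
rewrite [shuf _ _]/= inE => /orP [/eqP -> //|/mapP [y Hy ->]].
have lv : last true v by case: v Hl {IH Hy}.
by have := IH lv y Hy; case: y {Hy}.
Qed.

Lemma sw_zeros n m : W (nseq n false) \ls W (nseq m false) =
  ('C(n + m, n)%:R : K) *: W (nseq (n + m) false).
Proof.
elim: n m => [|n IHn] m; first by rewrite bin0 scale1r shW0l.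
elim: m => [|m IHm]; first by rewrite addn0 binn scale1r shW0r.
rewrite [nseq n.+1 _]/= [nseq m.+1 _]/= sh_cons.
rewrite -[false :: nseq m false]/(nseq m.+1 false) -[false :: nseq n false]/(nseq n.+1 false) IHn IHm.
have E : (n.+1 + m = n + m.+1)%N by rewrite addSnnS.
by rewrite E !mulZr -!W_cons -scalerDl -natrD addSn binS addnC.
Qed.

Lemma scale_succ (n : nat) (x : S) : x + (n%:R : K) *: x = (n.+1%:R : K) *: x.
Proof. by rewrite -{1}[x]scale1r -scalerDl -mulrS. Qed.

Lemma sw_ones n : W [:: true] \ls W (nseq n true) = (n.+1%:R : K) *: W (nseq n.+1 true).
Proof.
elim: n => [|n IHn]; first by rewrite scale1r shW0r.
rewrite [nseq n.+1 _ in LHS]/= sh_cons shW0l IHn mulZr -!W_cons.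
exact: scale_succ.
Qed.

(** Insert xi0 into [v xi1 xi0^j]: the [j + 1] places after the last xi1 all give the word with one
    more trailing xi0, the other places lengthen [v] and leave [j] trailing xi0. This can be solved
    for the word with [j + 1] of them. *)
Lemma sw_trailing v j : exists l, (forall x, x \in l -> size x = (size v).+1) /\
  W (v ++ true :: nseq j false) \ls W [:: false] =
  (j.+1%:R : K) *: W (v ++ true :: nseq j.+1 false) +
  sumW [seq x ++ true :: nseq j false | x <- l].
Proof.
elim: v => [|i v [l [Hl IH]]].
  exists [:: [:: false]]; split; first by move=> x; rewrite inE => /eqP ->.
  rewrite sh_cons shW0r (sw_zeros j 1) addn1 binSn mulZr.
  by rewrite !cat0s [map _ _]/= sumW1 -!W_cons.
exists ([:: false, i & v] :: map (cons i) l); split.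
  move=> x; rewrite inE => /orP [/eqP -> //|/mapP [y /Hl Hy ->]].
  by rewrite /= Hy.
rewrite [(i :: v) ++ _]/= sh_cons shW0r IH mulrDr mulZr -W_cons -addrA; congr (_ + _).
rewrite map_cons sumW_hd addrC [in RHS]cat_cons; congr (_ + _).
  by rewrite !W_cons.
by rewrite -sumW_cons -!map_comp.
Qed.

(** The mirror image of [sw_trailing]: inserting xi1 before the first xi0 gives one word [j + 1]
    times, inserting it later leaves [j] leading xi1. *)
Lemma sw_leading v j :
  W [:: true] \ls W (nseq j true ++ false :: v) =
  (j.+1%:R : K) *: W (nseq j.+1 true ++ false :: v) +
  sumW [seq nseq j true ++ false :: x | x <- shuf [:: true] v].
Proof.
elim: j => [|j IH].
  rewrite [nseq 0 _ ++ _]/= sh_cons shW0l -W_cons scale1r; congr (_ + _).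
  by rewrite sw_shuf -sumW_cons.
rewrite [nseq j.+1 _ ++ _ in LHS]/= sh_cons shW0l IH mulrDr mulZr -!W_cons addrA; congr (_ + _).
  exact: scale_succ.
by rewrite -sumW_cons -!map_comp.
Qed.

(** * Generation of words by shuffling with single letters *)

Definition subspace (A : S -> Prop) :=
  A 0 /\ forall (c : K) (a b : S), A a -> A b -> A (c *: a + b).

Lemma subspace_sumW A l : subspace A -> (forall x, x \in l -> A (W x)) -> A (sumW l).
Proof.
move=> [A0 AL]; rewrite /sumW; elim: l => [|x l IH] H; first by rewrite big_nil.
rewrite big_cons -[W x]scale1r; apply: AL; first by apply: H; rewrite inE eqxx.
by apply: IH => y Hy; apply: H; rewrite inE Hy orbT.
Qed.

Lemma subspace_solve A (k : K) a b c : subspace A -> k != 0 -> A a -> A c ->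
  a = k *: b + c -> A b.
Proof.
move=> [A0 AL] k0 Ha Hc E.
have -> : b = k^-1 *: a + ((- k^-1) *: c + 0).
  by rewrite addr0 E scalerDr scalerA mulVf // scale1r scaleNr addrK.
by apply: (AL) => //; exact: AL.
Qed.

Lemma word_trailing w : (exists n, w = nseq n false) \/
  exists v j, w = v ++ true :: nseq j false.
Proof.
elim: w => [|i w [[n ->]|[v [j ->]]]]; first by left; exists 0%N.
- by case: i; [right; exists [::], n|left; exists n.+1].
- by right; exists (i :: v), j.
Qed.

Lemma word_leading w : (exists n, w = nseq n true) \/
  exists j v, w = nseq j true ++ false :: v.
Proof.
elim: w => [|[] w [[n ->]|[j [v ->]]]]; first by left; exists 0%N.
- by left; exists n.+1.
- by right; exists j.+1, v.
- by right; exists 0%N, (nseq n true).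
- by right; exists 0%N, (nseq j true ++ false :: v).
Qed.

(** Induction on the number of trailing xi0: [sw_trailing] expresses the word through a product with
    xi0 and words with fewer trailing xi0, after division by [j + 1] in characteristic 0. *)
Lemma gen_trailing A n : subspace A ->
  (forall v, size v = n -> A (W v \ls W [:: false])) ->
  (forall t, size t = n.+1 -> last false t -> A (W t)) ->
  forall t, size t = n.+1 -> A (W t).
Proof.
move=> HA Hs Hb t; case: (word_trailing t) => [[m ->]|[v [j ->]]].
  rewrite size_nseq => ->.
  apply: (subspace_solve HA (char0 n) (Hs (nseq n false) (size_nseq _ _)) HA.1).
  by rewrite addr0 (sw_zeros n 1) addn1 binSn.
elim: j v => [|j IH] v Hv.
  by apply: Hb => //; rewrite last_cat.
have sz : size (v ++ true :: nseq j false) = n.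
  by move: Hv; rewrite !size_cat /= !size_nseq !addnS => [[]].
have [l [Hl E]] := sw_trailing v j.
have HE : W (v ++ true :: nseq j false) \ls W [:: false] = (j.+1%:R : K) *: W (v ++ true :: nseq j.+1 false) +
  sumW [seq x ++ true :: nseq j false | x <- l] by [].
apply: (subspace_solve HA (char0 j) (Hs _ sz) _ HE).
apply: subspace_sumW => // x /mapP [y /Hl Hy ->]; apply: IH.
by move: sz; rewrite !size_cat Hy => <-; rewrite addSn.
Qed.

(** Removes leading xi1 in the same way. Every word met on the way still ends in xi1
    ([shuf_one_last]), so the base case consists of words of S10. *)
Lemma gen_leading A n : subspace A ->
  (forall v, size v = n -> last true v -> A (W [:: true] \ls W v)) ->
  (forall v, size v = n -> last false v -> A (W (false :: v))) ->
  forall t, size t = n.+1 -> last false t -> A (W t).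
Proof.
move=> HA Hs Hb t; case: (word_leading t) => [[m ->]|[j [v ->]]].
  rewrite size_nseq => -> _.
  apply: (subspace_solve HA (char0 n) (Hs (nseq n true) (size_nseq _ _) _) HA.1).
    by elim: (n).
  by rewrite addr0 sw_ones.
elim: j v => [|j IH] v Hv.
  by rewrite /= => Hl; apply: Hb; [case: Hv|case: v Hl {Hv}].
have sz : size (nseq j true ++ false :: v) = n.
  by move: Hv; rewrite !size_cat /= !size_nseq => [[]].
rewrite last_cat [last _ _]/= => Hl.
have HE : W [:: true] \ls W (nseq j true ++ false :: v) = (j.+1%:R : K) *: W (nseq j.+1 true ++ false :: v) +
  sumW [seq nseq j true ++ false :: x | x <- shuf [:: true] v] by rewrite sw_leading.
apply: (subspace_solve HA (char0 j) (Hs _ sz _) _ HE); first by rewrite last_cat.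
apply: subspace_sumW => // x /mapP [y Hy ->]; apply: IH.
  have Ey : size y = (size v).+1 by exact: perm_size (shuf_perm Hy).
  by move: sz; rewrite !size_cat /= Ey => <-; rewrite addnS.
rewrite last_cat [last _ _]/=; apply: (shuf_one_last _ Hy).
by case: v Hl {Hy Hv sz HE}.
Qed.

(** * The recursion on last letters and the reversal [tau] *)

Lemma add4_perm (V : zmodType) (a b c d : V) : a + b + (c + d) = a + c + (b + d).
Proof. by rewrite -!addrA; congr (_ + _); rewrite addrCA. Qed.

(** [tau] turns first letters into last ones, so its compatibility with the shuffle product needs
    the recursion from the other end. *)
Lemma sh_rcons u i v j : W (rcons u i) \ls W (rcons v j) =
  (W u \ls W (rcons v j)) * letter_of i + (W (rcons u i) \ls W v) * letter_of j.
Proof.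
elim: u v => [|h u IHu] v.
  elim: v => [|k v IHv]; first by rewrite sh_cons !shW0l !shW0r addrC.
  rewrite [rcons [::] i]/= [rcons (k :: v) j]/= sh_cons [in LHS]IHv sh_cons !shW0l.
  rewrite !mulrDr !mulrDl !mulrA addrA -(W_cons k (rcons v j)) -[_ * W (k :: v) * letter_of j]mulrA.
  by rewrite -(W_rcons j (k :: v)) addrA [X in X + _]addrC -addrA.
elim: v => [|k v IHv].
  have := IHu [::]; rewrite [rcons [::] j]/= [rcons (h :: u) i]/= => IH.
  rewrite sh_cons IH sh_cons !shW0r !mulrDr !mulrDl !mulrA -(W_cons h (rcons u i)).
  by rewrite addrAC [letter_of j * W (h :: rcons u i)](_ : _ = letter_of j * W (h :: u) * letter_of i) // -mulrA -W_rcons.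
have := IHu (k :: v); rewrite [rcons (h :: u) i]/= [rcons (k :: v) j]/= => IH.
rewrite [rcons (h :: u) i]/= in IHv.
rewrite sh_cons IH IHv (sh_cons h u k (rcons v j)) (sh_cons h (rcons u i) k v).
by rewrite !mulrDr !mulrDl !mulrA add4_perm.
Qed.

Section Tau.
Variable tau : S -> S.
Hypothesis tauL : forall c a b, tau (c *: a + b) = c *: tau a + tau b.
Hypothesis tauW : forall u, tau (W u) = W (rev (map negb u)).

Lemma tau_letter i a : tau (letter_of i * a) = tau a * letter_of (~~ i).
Proof.
move: a; apply: lin_eq => [c a b|c a b|u]; first by rewrite mulL tauL.
  by rewrite tauL mulrDl scalerAl.
by rewrite -W_cons !tauW /= rev_cons W_rcons.
Qed.

Lemma tau_sh_word n u v : (size u + size v < n)%N ->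
  tau (W u \ls W v) = tau (W u) \ls tau (W v).
Proof.
elim: n u v => [|n IH] u v H; first by case: (notF H).
case: u H => [|i u] H; first by rewrite (tauW [::]) !shW0l.
case: v H => [|j v] H; first by rewrite (tauW [::]) !shW0r.
have tauD a b : tau (a + b) = tau a + tau b.
  by have := tauL 1 a b; rewrite !scale1r.
rewrite sh_cons tauD !tau_letter IH ?IH; try by rewrite /= in H *; lia.
by rewrite !tauW /= !rev_cons sh_rcons addrC.
Qed.

Lemma tau_sh a b : tau (a \ls b) = tau a \ls tau b.
Proof.
move: a; apply: lin_eq => [c a a'|c a a'|u]; first by rewrite shL tauL.
  by rewrite tauL shL.
move: b; apply: lin_eq => [c b b'|c b b'|v]; first by rewrite shR tauL.
  by rewrite tauL shR.
exact: tau_sh_word (ltnSn _).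
Qed.
End Tau.

(** * Deconcatenation and convolution of characters *)

Definition scalar_lin (f : S -> K) := forall c a b, f (c *: a + b) = c * f a + f b.

Lemma scalar_lin0 f : scalar_lin f -> f 0 = 0.
Proof. by move=> fL; have := fL (-1) 0 0; rewrite scaleN1r oppr0 addr0 mulN1r addNr. Qed.
Lemma scalar_linD f a b : scalar_lin f -> f (a + b) = f a + f b.
Proof. by move=> fL; have := fL 1 a b; rewrite scale1r mul1r. Qed.

Lemma scalar_eq f g : scalar_lin f -> scalar_lin g -> (forall u, f (W u) = g (W u)) ->
  forall a, f a = g a.
Proof.
move=> fL gL E; apply: W_ind => //; first by rewrite !scalar_lin0.
by move=> c a b Ea Eb; rewrite fL gL Ea Eb.
Qed.

Lemma mult_hom f : scalar_lin f -> (forall u v, f (W u \ls W v) = f (W u) * f (W v)) ->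
  forall a b, f (a \ls b) = f a * f b.
Proof.
move=> fL H a b; move: a; apply: scalar_eq => [c a a'|c a a'|u].
- by rewrite shL fL.
- by rewrite fL mulrDl mulrA.
move: b; apply: scalar_eq => [c b b'|c b b'|v].
- by rewrite shR fL.
- by rewrite fL mulrDr mulrCA.
exact: H.
Qed.

Variable ext : (seq bool -> K) -> S -> K.
Hypothesis extL : forall h, scalar_lin (ext h).
Hypothesis extW : forall h u, ext h (W u) = h u.

(** The deconcatenation coproduct of [u] paired with [B]; bilinear forms stand for functionals on
    the tensor square. *)
Definition deconc (B : S -> S -> K) (u : seq bool) : K :=
  \sum_(k < (size u).+1) B (W (take k u)) (W (drop k u)).

Lemma deconc_nil B : deconc B [::] = B (W [::]) (W [::]).
Proof. by rewrite /deconc big_ord1. Qed.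
Lemma deconc_cons B i u : deconc B (i :: u) =
  B (W [::]) (W (i :: u)) + deconc (fun a b => B (letter_of i * a) b) u.
Proof.
by rewrite /deconc big_ord_recl; congr (_ + _); apply: eq_bigr => k _; rewrite /= W_cons.
Qed.
Lemma eq_deconc B B' u : (forall a b, B a b = B' a b) -> deconc B u = deconc B' u.
Proof. by move=> E; apply: eq_bigr => k _. Qed.
Lemma deconcD B B' u : deconc (fun a b => B a b + B' a b) u = deconc B u + deconc B' u.
Proof. exact: big_split. Qed.

Definition bilin (B : S -> S -> K) :=
  (forall b, scalar_lin (fun a => B a b)) /\ (forall a, scalar_lin (B a)).

Lemma bilin_shift B i : bilin B -> bilin (fun a b => B (letter_of i * a) b).
Proof. by move=> [B1 B2]; split=> [b c a a'|a]; [rewrite mulL B1|exact: B2]. Qed.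

(** The cocycle rule: the coproduct of [xi_i x] is the sum of [1 (x) xi_i x] and the coproduct of
    [x] with [xi_i] put before its left factor. *)
Lemma ext_deconc_letter B i x : bilin B ->
  ext (deconc B) (letter_of i * x) = B (W [::]) (letter_of i * x) + ext (deconc (fun a b => B (letter_of i * a) b)) x.
Proof.
move=> [B1 B2]; move: x; apply: scalar_eq => [c a b|c a b|u].
- by rewrite mulL extL.
- by rewrite mulL B2 extL add4_perm -mulrDr.
- by rewrite -W_cons !extW deconc_cons.
Qed.

(* Deconcatenation is a homomorphism for the shuffle product, tested against
   an arbitrary bilinear form. *)
Lemma deconc_sh B u v : bilin B ->
  ext (deconc B) (W u \ls W v) =
  deconc (fun a1 b1 => deconc (fun a2 b2 => B (a1 \ls a2) (b1 \ls b2)) v) u.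
Proof.
elim: u v B => [|i u IHu] v B BL.
  by rewrite shW0l extW deconc_nil; apply: eq_deconc => a b; rewrite !shW0l.
elim: v B BL => [|j v IHv] B BL.
  by rewrite shW0r extW; apply: eq_deconc => a b; rewrite deconc_nil !shW0r.
rewrite sh_cons (scalar_linD _ _ (extL _)) !ext_deconc_letter //.
rewrite (IHu (j :: v) _ (bilin_shift i BL)) (IHv _ (bilin_shift j BL)).
rewrite add4_perm -(scalar_linD _ _ (BL.2 _)) -sh_cons.
rewrite [in RHS]deconc_cons [in RHS]deconc_cons shW0l -addrA; congr (_ + _).
rewrite [X in _ + X]deconc_cons addrCA; congr (_ + _).
  by apply: eq_deconc => a b; rewrite !shW0l.
rewrite -deconcD; apply: eq_deconc => a b.
rewrite [in LHS]deconc_cons [in RHS]deconc_cons !shW0r -addrA; congr (_ + _).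
rewrite -deconcD; apply: eq_deconc => a2 b2.
by rewrite sh_letter (scalar_linD _ _ (BL.1 _)).
Qed.

(** For [B a b = f a * g b], the double sum of [deconc_sh] factors, since [f] and [g] are
    multiplicative. *)
Lemma conv_hom f g : scalar_lin f -> scalar_lin g ->
  (forall a b, f (a \ls b) = f a * f b) -> (forall a b, g (a \ls b) = g a * g b) ->
  forall a b, ext (deconc (fun a b => f a * g b)) (a \ls b) =
    ext (deconc (fun a b => f a * g b)) a * ext (deconc (fun a b => f a * g b)) b.
Proof.
move=> fL gL fM gM; apply: mult_hom => [|u v]; first exact: extL.
rewrite deconc_sh; last first.
  split=> [b c a a'|a c b b']; first by rewrite fL mulrDl mulrA.
  by rewrite gL mulrDr mulrCA.
rewrite !extW /deconc big_distrl /=; apply: eq_bigr => k _.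
rewrite big_distrr /=; apply: eq_bigr => l _.
by rewrite fM gM mulrACA.
Qed.

Lemma hom_zeros f n : scalar_lin f -> (forall a b, f (a \ls b) = f a * f b) -> f 1 = 1 ->
  f (W (nseq n false)) = f (W [:: false]) ^+ n / n`!%:R.
Proof.
move=> fL fM f1; elim: n => [|n IH]; first by rewrite W_nil f1 expr0 divr1.
have fZ c a : f (c *: a) = c * f a.
  by have := fL c a 0; rewrite addr0 scalar_lin0 // addr0.
have := congr1 f (sw_zeros n 1); rewrite fM fZ addn1 binSn IH => E.
apply: (mulfI (char0 n)); rewrite -E exprSr factS natrM invfM.
by rewrite mulrCA [n.+1%:R * _]mulrA mulfV // mul1r mulrAC.
Qed.

Lemma hom_ones0 f n : scalar_lin f -> (forall a b, f (a \ls b) = f a * f b) ->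
  f (W [:: true]) = 0 -> f (W (nseq n.+1 true)) = 0.
Proof.
move=> fL fM f0; have fZ c a : f (c *: a) = c * f a.
  by have := fL c a 0; rewrite addr0 scalar_lin0 // addr0.
have := congr1 f (sw_ones n); rewrite fM fZ f0 mul0r => /esym/eqP.
by rewrite mulf_eq0 (negPf (char0 n)) => /eqP.
Qed.

End ShuffleAlgebra.

(** * The monoid algebra as a shuffle algebra *)

Fact W_key : unit. Proof. exact: tt. Qed.
(* Locked, as unification is prone to unfold monoid algebra elements. *)
Definition W : seq bool -> Sxi := locked_with W_key (fun u => << FMonom u >>).

Lemma WE u : W u = << FMonom u >>.
Proof. by rewrite /W unlock. Qed.

Lemma W_nil : W [::] = 1.
Proof. by rewrite WE -fmoneE. Qed.

Lemma W_cat u v : W (u ++ v) = W u * W v.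
Proof. by rewrite !WE [RHS]fgmulUU mulr1 -(fmmulE (FMonom u) (FMonom v)). Qed.

Lemma W_letter i : W [:: i] = letter i.
Proof. exact: WE. Qed.

Lemma WS_cons i u : W (i :: u) = letter i * W u.
Proof. by rewrite -W_letter -W_cat. Qed.

Lemma word_W (w : word) : << w >> = W w :> Sxi.
Proof. by rewrite WE; case: w. Qed.

Lemma malg_single (c : C) (u : word) : << c *g u >> = c *: W u :> Sxi.
Proof. by apply/malgP => k; rewrite mcoeffZ -word_W !mcoeffU mulrnAr mulr1. Qed.

Lemma Sxi_ind (P : Sxi -> Prop) : P 0 -> (forall c a b, P a -> P b -> P (c *: a + b)) ->
  (forall u, P (W u)) -> forall a, P a.
Proof.
move=> P0 PD PW a; rewrite (monalgE a); elim: (X in \sum_(k <- X) _) => [|u s IH].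
  by rewrite big_nil.
by rewrite big_cons malg_single; exact: PD.
Qed.

Section LinExt.
Variables (V : lmodType C) (h : word -> V).

Lemma lin_extEw (d : {fset word}) (a : Sxi) : (msupp a `<=` d)%fset ->
  lin_ext h a = \sum_(u <- d) a@_u *: h u.
Proof.
by move=> le; rewrite [LHS](big_fset_incl _ le) => //= x xd /mcoeff_outdom ->; rewrite scale0r.
Qed.

Lemma lin_ext_linear c a b : lin_ext h (c *: a + b) = c *: lin_ext h a + lin_ext h b.
Proof.
set d := (msupp a `|` msupp b)%fset.
have ha : (msupp a `<=` d)%fset by apply: fsubsetUl.
have hb : (msupp b `<=` d)%fset by apply: fsubsetUr.
have hab : (msupp (c *: a + b) `<=` d)%fset.
  apply: fsubset_trans (msuppD_le _ _) _; apply: fsetSU; exact: msuppZ_le.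
rewrite (lin_extEw ha) (lin_extEw hb) (lin_extEw hab) scaler_sumr -big_split /=.
by apply: eq_bigr => u _; rewrite mcoeffD mcoeffZ scalerDl scalerA.
Qed.

Lemma lin_extW u : lin_ext h (W u) = h (FMonom u).
Proof. by rewrite WE /lin_ext msuppU1 big_seq_fset1 mcoeffUU scale1r. Qed.

End LinExt.

Section Lin.
Variables (V : lmodType C) (f : Sxi -> V).
Hypothesis fL : forall c a b, f (c *: a + b) = c *: f a + f b.

Lemma lin_0 : f 0 = 0.
Proof.
have := fL (-1) 0 0; rewrite scaleN1r oppr0 addr0 scaleN1r addNr; exact.
Qed.
Lemma lin_add a b : f (a + b) = f a + f b.
Proof. by rewrite -{1}[a]scale1r fL scale1r. Qed.
Lemma lin_scale c a : f (c *: a) = c *: f a.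
Proof. by rewrite -[c *: a]addr0 fL lin_0 addr0. Qed.
Lemma lin_bigsum (I : Type) (r : seq I) (P : pred I) (F : I -> Sxi) :
  f (\sum_(i <- r | P i) F i) = \sum_(i <- r | P i) f (F i).
Proof. by apply: (big_morph f lin_add lin_0). Qed.
End Lin.

Lemma Sxi_lin_eq (V : lmodType C) (f g : Sxi -> V) :
  (forall c a b, f (c *: a + b) = c *: f a + f b) ->
  (forall c a b, g (c *: a + b) = c *: g a + g b) ->
  (forall u, f (W u) = g (W u)) -> forall a, f a = g a.
Proof.
move=> fL gL E; apply: Sxi_ind => //; first by rewrite !lin_0.
by move=> c a b Ea Eb; rewrite fL gL Ea Eb.
Qed.

Lemma shL (c : C) (a a' b : Sxi) : (c *: a + a') \sh b = c *: (a \sh b) + a' \sh b.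
Proof. by exact: lin_ext_linear. Qed.

Lemma shW u v : W u \sh W v = shuffle_word u v.
Proof. by rewrite /shuffle !lin_extW. Qed.

Lemma scale_swap (V : lmodType C) (c d : C) (x y z t : V) :
  c *: (d *: x + y) + (d *: z + t) = d *: (c *: x + z) + (c *: y + t).
Proof. by rewrite !scalerDr !scalerA [c * d]mulrC -!addrA; congr (_ + _); rewrite addrCA. Qed.

Lemma shR (c : C) (a b b' : Sxi) : a \sh (c *: b + b') = c *: (a \sh b) + a \sh b'.
Proof.
move: a; apply: (Sxi_lin_eq (V := Sxi)) => [c' a a'|c' a a'|u].
- exact: shL.
- rewrite (shL c' a a' b) (shL c' a a' b'); exact: (scale_swap (V := Sxi)).
- by rewrite /shuffle !lin_extW lin_ext_linear.
Qed.

Lemma sw_nil v : shuffle_word [::] v = W v. Proof. by rewrite WE. Qed.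
Lemma sw_nilr u : shuffle_word u [::] = W u. Proof. by rewrite WE; case: u. Qed.
Lemma sw_cons i u j v : shuffle_word (i :: u) (j :: v) =
  letter i * shuffle_word u (j :: v) + letter j * shuffle_word (i :: u) v.
Proof. by []. Qed.

Lemma sh1l (a : Sxi) : 1 \sh a = a.
Proof.
move: a; apply: (Sxi_lin_eq (V := Sxi)) => // [c a b|u]; first exact: shR.
by rewrite -W_nil shW sw_nil.
Qed.
Lemma sh1r (a : Sxi) : a \sh 1 = a.
Proof.
move: a; apply: (Sxi_lin_eq (V := Sxi)) => // [c a b|u]; first exact: shL.
by rewrite -W_nil shW sw_nilr.
Qed.

Lemma mulZr (c : C) (x b : Sxi) : x * (c *: b) = c *: (x * b).
Proof.
have E : x * c%:MP = c%:MP * x.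
  rewrite [LHS]fgmulgU [RHS]fgmulUg; apply: eq_bigr => k _.
  by rewrite mulrC mulm1 mul1m.
by rewrite -!mul_malgC !mulrA E.
Qed.

Lemma natCE n : (n%:R : C) = RtoC (INR n).
Proof.
elim: n => [//|n IH]; rewrite S_INR RtoC_plus mulrS IH; exact: Cplus_comm.
Qed.

Lemma natC_neq0 n : (n.+1%:R : C) != 0.
Proof. rewrite natCE; apply/eqP => /RtoC_inj; exact: (not_0_INR n.+1). Qed.

Lemma shuffle_cons i u j v : W (i :: u) \sh W (j :: v) =
  letter_of W i * (W u \sh W (j :: v)) + letter_of W j * (W (i :: u) \sh W v).
Proof. by rewrite !shW sw_cons /letter_of !W_letter. Qed.

Lemma shuffleA (a b c : Sxi) : (a \sh b) \sh c = a \sh (b \sh c).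
Proof. exact: (shA mulZr W_nil W_cat Sxi_ind shL shR sh1l sh1r shuffle_cons). Qed.

Lemma tau_linear (c : C) (a b : Sxi) : tau (c *: a + b) = c *: tau a + tau b.
Proof. exact: lin_ext_linear. Qed.
Lemma tauW u : tau (W u) = W (rev (map negb u)).
Proof. by rewrite /tau lin_extW /tau_word -WE. Qed.

Lemma tau_shuffle (a b : Sxi) : tau (a \sh b) = tau a \sh tau b.
Proof.
exact: (tau_sh mulZr W_nil W_cat Sxi_ind shL shR sh1l sh1r shuffle_cons tau_linear tauW).
Qed.

Definition cext (h : seq bool -> C) (a : Sxi) : C := lin_ext (V := C^o) h a.

Lemma cextL h : scalar_lin (K := C) (cext h).
Proof. move=> c a b; exact: (lin_ext_linear (V := C^o)). Qed.
Lemma cextW h u : cext h (W u) = h u.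
Proof. exact: (lin_extW (V := C^o)). Qed.

Lemma shuffle_mult_hom (f : Sxi -> C) : scalar_lin f ->
  (forall u v, f (W u \sh W v) = f (W u) * f (W v)) -> forall a b, f (a \sh b) = f a * f b.
Proof. exact: (mult_hom Sxi_ind shL shR). Qed.

Lemma shuffle_conv_hom (f g : Sxi -> C) : scalar_lin f -> scalar_lin g ->
  (forall a b, f (a \sh b) = f a * f b) -> (forall a b, g (a \sh b) = g a * g b) ->
  forall a b, cext (deconc W (fun a b => f a * g b)) (a \sh b) =
    cext (deconc W (fun a b => f a * g b)) a * cext (deconc W (fun a b => f a * g b)) b.
Proof.
exact: (conv_hom mulZr W_nil W_cat Sxi_ind shL shR sh1l sh1r shuffle_cons cextL cextW).
Qed.

Lemma shuffle_hom_zeros (f : Sxi -> C) n : scalar_lin f ->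
  (forall a b, f (a \sh b) = f a * f b) -> f 1 = 1 ->
  f (W (nseq n false)) = f xi0 ^+ n / n`!%:R.
Proof.
move=> fL fM f1; rewrite -W_letter.
exact: (hom_zeros natC_neq0 mulZr W_nil W_cat sh1l sh1r shuffle_cons).
Qed.
Lemma shuffle_hom_ones0 (f : Sxi -> C) n : scalar_lin f ->
  (forall a b, f (a \sh b) = f a * f b) -> f xi1 = 0 -> f (W (nseq n.+1 true)) = 0.
Proof.
move=> fL fM f1; rewrite -W_letter in f1.
exact: (hom_ones0 natC_neq0 mulZr W_nil W_cat sh1l sh1r shuffle_cons).
Qed.

(** Reduces a linear condition to products with one letter and to words of S10; it serves both to
    compare two solutions and to build the expansions defining [reg10]. *)
Lemma shuffle_gen (A : Sxi -> Prop) n : subspace (K := C) A ->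
  (forall v, size v = n -> A (W v \sh xi0)) ->
  (forall v, size v = n -> last true v -> A (xi1 \sh W v)) ->
  (forall v, size v = n -> last false v -> A (W (false :: v))) ->
  forall t, size t = n.+1 -> A (W t).
Proof.
move=> HA H0 H1 Hb; rewrite -W_letter in H0; rewrite -W_letter in H1.
apply: (gen_trailing natC_neq0 mulZr W_nil W_cat sh1l sh1r shuffle_cons HA H0).
exact: (gen_leading natC_neq0 mulZr W_nil W_cat sh1l sh1r shuffle_cons HA H1 Hb).
Qed.

Lemma shuffle_gen_trailing (A : Sxi -> Prop) n : subspace (K := C) A ->
  (forall v, size v = n -> A (W v \sh xi0)) ->
  (forall t, size t = n.+1 -> last false t -> A (W t)) ->
  forall t, size t = n.+1 -> A (W t).
Proof.
move=> HA H0 Hb; rewrite -W_letter in H0.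
exact: (gen_trailing natC_neq0 mulZr W_nil W_cat sh1l sh1r shuffle_cons HA H0 Hb).
Qed.

Lemma shuffle_zeros n m : W (nseq n false) \sh W (nseq m false) =
  ('C(n + m, n)%:R : C) *: W (nseq (n + m) false).
Proof. exact: (sw_zeros mulZr W_nil W_cat sh1l sh1r shuffle_cons). Qed.
Lemma shuffle_ones n : W [:: true] \sh W (nseq n true) = (n.+1%:R : C) *: W (nseq n.+1 true).
Proof. exact: (sw_ones mulZr W_nil W_cat sh1l sh1r shuffle_cons). Qed.
Lemma shuffle_shuf u v : W u \sh W v = sumW W (shuf u v).
Proof. exact: (sw_shuf W_nil W_cat sh1l sh1r shuffle_cons). Qed.

Lemma xi_pow i n : letter i ^+ n = W (nseq n i).
Proof.
by elim: n => [|n IH]; [rewrite W_nil expr0|rewrite exprS IH -WS_cons].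
Qed.

(** * Extended polylogarithms *)

Lemma deriv_add (f g : C -> C) (z k l : C) : CderivE f z k -> CderivE g z l ->
  CderivE (fun t => f t + g t) z (k + l).
Proof. exact: CderivE_plus. Qed.
Lemma deriv_mul (f g : C -> C) (z k l : C) : CderivE f z k -> CderivE g z l ->
  CderivE (fun t => f t * g t) z (k * g z + f z * l).
Proof. exact: CderivE_mult. Qed.
Lemma deriv_scale (c : C) (f : C -> C) (z k : C) : CderivE f z k ->
  CderivE (fun t => c * f t) z (c * k).
Proof. exact: CderivE_scal. Qed.
Lemma deriv_sum (I : Type) (r : seq I) (f : I -> C -> C) (df : I -> C) (z : C) :
  (forall i, CderivE (f i) z (df i)) ->
  CderivE (fun t => \sum_(i <- r) f i t) z (\sum_(i <- r) df i).
Proof.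
move=> H; elim: r => [|i r IH].
  rewrite big_nil; apply: (@CderivE_ext (fun _ => 0)) => [t|]; first by rewrite big_nil.
  exact: CderivE_const.
rewrite big_cons; apply: (@CderivE_ext (fun t => f i t + \sum_(i <- r) f i t)).
  by move=> t; rewrite big_cons.
exact: deriv_add.
Qed.

Lemma deriv_cext (h : seq bool -> C -> C) (dh : seq bool -> C) (a : Sxi) (z : C) :
  (forall u, CderivE (h u) z (dh u)) ->
  CderivE (fun t => cext (fun u => h u t) a) z (cext dh a).
Proof.
move=> H; rewrite /cext /lin_ext.
exact: (@deriv_sum _ (finmap.enum_fset (msupp a)) (fun u t => a@_u * h u t) (fun u => a@_u * dh u) z
  (fun u => @deriv_scale (a@_u) (h u) z (dh u) (H u))).
Qed.

Lemma pow_step (K : comNzRingType) (a x : K) m :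
  a * x ^+ m.+1 + x * (m.+1%:R * x ^+ m * a) = m.+2%:R * x ^+ m.+1 * a.
Proof.
rewrite -[in RHS]add1n natrD 2!mulrDl mul1r [a * _]mulrC; congr (_ + _).
by rewrite [x ^+ m.+1]exprS -!mulrA mulrCA.
Qed.

Lemma div_step (K : fieldType) (a b x z : K) : a != 0 ->
  (a * b)^-1 * (a * x * z) = z * (x / b).
Proof.
move=> a0; rewrite invfM -!mulrA [b^-1 * (a * _)]mulrCA mulKf //.
by rewrite mulrCA [RHS]mulrCA [z * _]mulrC.
Qed.

Lemma deriv_log_pow n z : D1 z ->
  CderivE (fun t => Clog t ^+ n.+1 / n.+1`!%:R) z (form false z * (Clog z ^+ n / n`!%:R)).
Proof.
move=> Hz.
have P m : CderivE (fun t => Clog t ^+ m.+1) z (m.+1%:R * Clog z ^+ m * z^-1).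
  elim: m => [|m IH].
    apply: (CderivE_eq _ (Clog_deriv Hz)).
    by rewrite expr0 !mul1r.
  apply: (CderivE_eq _ (deriv_mul (Clog_deriv Hz) IH)).
  exact: pow_step.
apply: (@CderivE_ext (fun t => (n.+1`!%:R)^-1 * Clog t ^+ n.+1)) => [t|]; first by rewrite mulrC.
apply: (CderivE_eq _ (deriv_scale _ (P n))).
rewrite factS natrM; exact: (div_step _ _ _ (natC_neq0 n)).
Qed.

Definition inD01 (z : C) : Prop := D0 z /\ D1 z.

Lemma cext_letter h i (a : Sxi) : cext h (letter_of W i * a) = cext (fun u => h (i :: u)) a.
Proof.
move: a; apply: (scalar_eq (K := C) (S := Sxi) Sxi_ind) => [c a b|c a b|u].
- rewrite (mulL mulZr) cextL; exact: erefl.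
- exact: cextL.
- by rewrite /letter_of -W_cat !cextW.
Qed.

Lemma eq_cext h h' (a : Sxi) : (forall u, h u = h' u) -> cext h a = cext h' a.
Proof. by move=> E; congr cext; apply: funext. Qed.

(** The final xi1 is left implicit, so that shuffles act only on the letters before it. *)
Definition iter1 (z : C) (u : seq bool) : C := iter_int (rcons u true) z.

Lemma iter1_deriv_nil z : inD01 z -> CderivE (fun t => iter1 t [::]) z (form true z).
Proof.
move=> [H0 /D1_neq0 H1]; apply: (CderivE_eq _ (@iter_int_deriv true [::] z isT H0 H1)).
exact: mulr1.
Qed.
Lemma iter1_deriv i u z : inD01 z ->
  CderivE (fun t => iter1 t (i :: u)) z (form i z * iter1 z u).
Proof.
move=> [H0 /D1_neq0 H1]; apply: (@iter_int_deriv i (rcons u true)) => //.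
by rewrite -rcons_cons last_rcons.
Qed.

Definition iterx (v : seq bool) (m : nat) (z : C) : C :=
  cext (iter1 z) (W v \sh W (nseq m false)).

Definition logp (n : nat) (z : C) : C := (Clog z ^+ n / n`!%:R)%R.

(** The part of the derivative of [iterx v m] in which the leading letter comes from [v]; when
    nothing precedes the implicit xi1, that letter itself. *)
Definition iterx_head (v : seq bool) (m : nat) (z : C) : C :=
  (if v is i :: v' then form i z * iterx v' m z
  else if m is 0%N then form true z else 0)%R.

Lemma cextZr h (c : C) (a : Sxi) : cext (fun u => c * h u) a = c * cext h a.
Proof.
move: a; apply: (scalar_eq (K := C) (S := Sxi) Sxi_ind) => [d a b|d a b|u].
- exact: cextL.
- by rewrite cextL mulrDr mulrCA.
- by rewrite !cextW.
Qed.

Lemma cextDl h (a b : Sxi) : cext h (a + b) = cext h a + cext h b.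
Proof. exact: scalar_linD (cextL h). Qed.

Lemma iterx_deriv v m z : inD01 z -> CderivE (iterx v m) z
  (iterx_head v m z + (if m is m'.+1 then form false z * iterx v m' z else 0)).
Proof.
move=> Hz; rewrite /iterx_head; case: v => [|i v].
  have E k t : iterx [::] k t = iter1 t (nseq k false).
    by rewrite /iterx W_nil sh1l cextW.
  apply: (@CderivE_ext (fun t => iter1 t (nseq m false))) => [t|]; first by rewrite E.
  case: m => [|m]; first by rewrite addr0; exact: iter1_deriv_nil.
  rewrite add0r E; exact: (@iter1_deriv false (nseq m false)).
case: m => [|m].
  have E k t : iterx k 0 t = iter1 t k.
    by rewrite /iterx [nseq 0 _]/= W_nil sh1r cextW.
  apply: (@CderivE_ext (fun t => iter1 t (i :: v))) => [t|]; first by rewrite E.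
  rewrite addr0 E; exact: iter1_deriv.
have E t : iterx (i :: v) m.+1 t =
    cext (fun u => iter1 t (i :: u)) (W v \sh W (nseq m.+1 false)) +
    cext (fun u => iter1 t (false :: u)) (W (i :: v) \sh W (nseq m false)).
  rewrite /iterx (shuffle_cons i v false (nseq m false)) cextDl.
  exact: (f_equal2 +%R (cext_letter (iter1 t) i (W v \sh W (nseq m.+1 false)))
    (cext_letter (iter1 t) false (W (i :: v) \sh W (nseq m false)))).
apply: (@CderivE_ext (fun t => cext (fun u => iter1 t (i :: u)) (W v \sh W (nseq m.+1 false)) +
    cext (fun u => iter1 t (false :: u)) (W (i :: v) \sh W (nseq m false)))) => [t|]; first by rewrite E.
rewrite /iterx -!cextZr; apply: deriv_add.
  exact: (deriv_cext _ (fun u => iter1_deriv i u Hz)).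
exact: (deriv_cext _ (fun u => iter1_deriv false u Hz)).
Qed.

(** Differentiating an alternating sum of products [e m * l (k - m)]: the xi0-derivative of [e m.+1]
    and that of [l (k - m)] give the same product with opposite signs, so only the head terms [g]
    remain. *)
Lemma telescope_conv (K : comNzRingType) (e l g : nat -> K) (f : K) k :
  \sum_(m < k.+1) (-1) ^+ m * ((g m + (if (m : nat) is m'.+1 then f * e m' else 0)) * l (k - m)%N
     + e m * (if (k - m)%N is j.+1 then f * l j else 0)) =
  \sum_(m < k.+1) (-1) ^+ m * (g m * l (k - m)%N).
Proof.
transitivity (\sum_(m < k.+1) (-1) ^+ m * (g m * l (k - m)%N) +
  (\sum_(m < k.+1) (-1) ^+ m * ((if (m : nat) is m'.+1 then f * e m' else 0) * l (k - m)%N) +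
   \sum_(m < k.+1) (-1) ^+ m * (e m * (if (k - m)%N is j.+1 then f * l j else 0)))).
  rewrite -!big_split /=; apply: eq_bigr => m _.
  by rewrite mulrDl !mulrDr addrA.
rewrite -[RHS]addr0; congr (_ + _).
rewrite big_ord_recl [X in _ + X = _]big_ord_recr /= subnn mul0r !mulr0 add0r addr0.
rewrite -big_split /= big1 // => m _.
rewrite /bump /= !add1n add0n exprS mulN1r -(subnSK (ltn_ord m)) mulNr.
by rewrite [e m * _]mulrCA -[f * e m * _]mulrA addNr.
Qed.

Definition logli (v : seq bool) (k : nat) (z : C) : C :=
  (\sum_(m < k.+1) (-1) ^+ m * (iterx v m z * logp (k - m) z))%R.

Lemma logp_deriv n z : D1 z ->
  CderivE (logp n) z (if n is j.+1 then form false z * logp j z else 0).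
Proof.
case: n => [|n] H; last exact: deriv_log_pow.
apply: (@CderivE_ext (fun _ => 1 / 1)) => [t|]; first by rewrite /logp expr0.
exact: CderivE_const.
Qed.

Lemma logli_deriv v k z : inD01 z -> CderivE (logli v k) z
  (\sum_(m < k.+1) (-1) ^+ m * (iterx_head v m z * logp (k - m) z)).
Proof.
move=> Hz; apply: (CderivE_eq (telescope_conv (fun m => iterx v m z) (fun j => logp j z)
   (fun m => iterx_head v m z) (form false z) k)).
apply: deriv_sum => m; apply: deriv_scale.
apply: (CderivE_eq _ (deriv_mul (iterx_deriv v m Hz) (logp_deriv (k - m) Hz.2))); exact: erefl.
Qed.

Definition trailing0 (w : seq bool) : nat := index true (rev w).

(* The extended polylogarithm of a word: [v xi1 xi0^k] is expanded as
   [sum_m (-1)^m ((v sh xi0^m) xi1) sh xi0^(k-m)]. *)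
Definition Lw (w : seq bool) (z : C) : C :=
  if true \in w then logli (take (size w - (trailing0 w).+1) w) (trailing0 w) z
  else logp (size w) z.

Lemma Lw_zeros n z : Lw (nseq n false) z = logp n z.
Proof. by rewrite /Lw mem_nseq andbF size_nseq. Qed.

Lemma Lw_logli v k z : Lw (v ++ true :: nseq k false) z = logli v k z.
Proof.
have E : trailing0 (v ++ true :: nseq k false) = k.
  rewrite /trailing0 rev_cat rev_cons rev_nseq -cats1 -catA index_cat mem_nseq andbF.
  by rewrite size_nseq /= addn0.
rewrite /Lw E mem_cat inE eqxx orbT size_cat /= size_nseq addnK.
by rewrite take_size_cat.
Qed.

Lemma Lw_nil z : Lw [::] z = 1.
Proof. by rewrite (Lw_zeros 0) /logp expr0 divr1. Qed.

Lemma Lw_xi0 z : Lw [:: false] z = Clog z.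
Proof. by rewrite (Lw_zeros 1) /logp expr1 divr1. Qed.

Lemma Lw_deriv i w z : inD01 z -> CderivE (Lw (i :: w)) z (form i z * Lw w z).
Proof.
move=> Hz; case: (word_trailing w) => [[n ->]|[v [k ->]]]; last first.
  rewrite Lw_logli; apply: (@CderivE_ext (logli (i :: v) k)) => [t|].
    by rewrite -(Lw_logli (i :: v)).
  apply: (CderivE_eq _ (logli_deriv (i :: v) k Hz)).
  rewrite /logli mulr_sumr; apply: eq_bigr => m _.
  by rewrite [iterx_head _ _ _]/(form i z * iterx v m z)%R -mulrA mulrCA.
rewrite Lw_zeros; case: i.
  apply: (@CderivE_ext (logli [::] n)) => [t|]; first by rewrite -(Lw_logli [::]).
  apply: (CderivE_eq _ (logli_deriv [::] n Hz)).
  rewrite big_ord_recl big1 => [|m _]; last by rewrite /= mul0r mulr0.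
  by rewrite /= subn0 mul1r addr0.
apply: (@CderivE_ext (logp n.+1)) => [t|]; first by rewrite -(Lw_zeros n.+1).
exact: (logp_deriv n.+1 Hz.2).
Qed.

Lemma Lw_iter w z : last true w -> Lw w z = iter_int w z.
Proof.
case: (word_trailing w) => [[n ->]|[v [[|k] ->]]]; last first.
- by rewrite last_cat /= (_ : last false (nseq k false) = false) //; elim: k.
- rewrite Lw_logli /logli big_ord1 /iterx [nseq 0 _]/= W_nil sh1r cextW => _.
  by rewrite /logp subnn !expr0 mul1r divr1 mulr1 /iter1 cats1.
case: n => [_|n]; first by rewrite Lw_nil.
by rewrite /= (_ : last false (nseq n false) = false) //; elim: n.
Qed.

(** * Logarithmic growth near 0 *)

Section Growth.
Local Open Scope R_scope.

(** The exponent [k] is unspecified, so powers of the logarithm are absorbed, while [p] counts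
    powers of [z]. The summand 1 makes the base at least 1, so that [k] may be raised. *)
Definition logO (p : nat) (F : C -> C) := exists K k del, 0 <= K /\ 0 < del /\
  forall z, inD01 z -> Cmod z < del ->
    Cmod (F z) <= K * Cmod z ^ p * (1 + Cmod (Clog z)) ^ k.

Lemma logO_ext p F F' : (forall z, inD01 z -> F z = F' z) -> logO p F -> logO p F'.
Proof.
move=> E [K [k [d [K0 [d0 H]]]]]; exists K, k, d; split=> //; split=> // z Hz zd.
by rewrite -E //; exact: H.
Qed.

Lemma log1_ge1 z : 1 <= 1 + Cmod (Clog z).
Proof. by have := Cmod_ge_0 (Clog z); lra. Qed.

Lemma logO_plus p F G : logO p F -> logO p G -> logO p (fun z => F z + G z)%C.
Proof.
move=> [K [k [d [K0 [d0 H]]]]] [L [l [e [L0 [e0 I]]]]].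
exists (K + L), (k + l)%coq_nat, (Rmin d e); split; first lra.
split; first exact: Rmin_pos.
move=> z Hz zd; have H1 := H z Hz (Rlt_le_trans _ _ _ zd (Rmin_l _ _)).
have I1 := I z Hz (Rlt_le_trans _ _ _ zd (Rmin_r _ _)).
have x1 := log1_ge1 z; set x := 1 + _ in x1 H1 I1 *.
have P : 0 <= Cmod z ^ p by apply: pow_le; exact: Cmod_ge_0.
have P1 : x ^ k <= x ^ (k + l)%coq_nat by apply: Rle_pow => //; lia.
have P2 : x ^ l <= x ^ (k + l)%coq_nat by apply: Rle_pow => //; lia.
apply: Rle_trans (Cmod_triangle _ _) _.
have := Rmult_le_compat_l (K * Cmod z ^ p) _ _ (Rmult_le_pos _ _ K0 P) P1.
have := Rmult_le_compat_l (L * Cmod z ^ p) _ _ (Rmult_le_pos _ _ L0 P) P2.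
lra.
Qed.

Lemma logO_mult p q F G : logO p F -> logO q G -> logO (p + q) (fun z => F z * G z)%C.
Proof.
move=> [K [k [d [K0 [d0 H]]]]] [L [l [e [L0 [e0 I]]]]].
exists (K * L), (k + l)%coq_nat, (Rmin d e); split; first exact: Rmult_le_pos.
split; first exact: Rmin_pos.
move=> z Hz zd; have H1 := H z Hz (Rlt_le_trans _ _ _ zd (Rmin_l _ _)).
have I1 := I z Hz (Rlt_le_trans _ _ _ zd (Rmin_r _ _)).
rewrite Cmod_mult -plusE !pow_add.
apply: Rle_trans (Rmult_le_compat _ _ _ _ (Cmod_ge_0 _) (Cmod_ge_0 _) H1 I1) _.
by apply: Req_le; ring.
Qed.

Lemma logO_weaken p F : logO p.+1 F -> logO p F.
Proof.
move=> [K [k [d [K0 [d0 H]]]]]; exists K, k, (Rmin d 1); split=> //.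
split; first by apply: Rmin_pos; lra.
move=> z Hz zd; have H1 := H z Hz (Rlt_le_trans _ _ _ zd (Rmin_l _ _)).
have z1 := Rlt_le_trans _ _ _ zd (Rmin_r _ _).
apply: Rle_trans H1 _; have z0 := Cmod_ge_0 z.
apply: Rmult_le_compat_r; first by apply: pow_le; have := log1_ge1 z; lra.
apply: Rmult_le_compat_l => //.
by have := pow_le (Cmod z) p z0; rewrite -tech_pow_Rmult; nra.
Qed.

Lemma logO_const c : logO 0 (fun _ => c).
Proof.
exists (Cmod c), 0%N, 1; split; first exact: Cmod_ge_0.
by split; first lra; move=> z _ _ /=; lra.
Qed.

Lemma logO_zero p : logO p (fun _ => RtoC 0).
Proof.
exists 0, 0%N, 1; split; first lra.
by split; first lra; move=> z _ _; rewrite Cmod_0 !Rmult_0_l; lra.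
Qed.

Lemma logO_log : logO 0 Clog.
Proof.
exists 1, 1%N, 1; split; first lra.
by split; first lra; move=> z _ _ /=; lra.
Qed.

Lemma logO_iter w : last false w -> logO 1 (iter_int w).
Proof.
move=> /iter_int_zfactor [v [Hv E]].
have [l Hl] := Hv 0%C D0_0.
have [d [d0 Hd]] := CderivE_cont_eps Hl Rlt_0_1.
have M0 := Cmod_ge_0 (v 0%C).
exists (Cmod (v 0%C) + 1), 0%N, d; split; first lra.
split=> // z [Hz _] zd; rewrite E // Cmod_mult /= !Rmult_1_r Rmult_comm.
apply: Rmult_le_compat_r; first exact: Cmod_ge_0.
have := Hd z; rewrite Csub0r => /(_ zd) K.
have -> : v z = (v 0%C + (v z - v 0%C))%C by ring.
by apply: Rle_trans (Cmod_triangle _ _) _; lra.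
Qed.

Lemma Clog_bound z : D1 z -> Cmod (Clog z) <= Rabs (ln (Cmod z)) + 4.
Proof.
move=> /Clog_principal [B _]; rewrite /Im in B; apply: Rle_trans (Cmod_le_sum _) _.
have P4 := PI_4; have L4 : Rabs (Clog z).2 <= 4 by apply: Rabs_le; lra.
exact: Rplus_le_compat_l L4.
Qed.

(** The power of the logarithm is at most a constant times the inverse square root of [Cmod z],
    which leaves a square root of [Cmod z]. *)
Lemma logO_lim F : logO 1 F -> forall eps, 0 < eps -> exists del, 0 < del /\
  forall z, inD01 z -> Cmod z < del -> Cmod (F z) < eps.
Proof.
move=> [K [k [d [K0 [d0 H]]]]] eps e0.
have [M [M0 HM]] := pow_le_exp k.
set N := K * 5 ^ k * M + 1.
have p5 : 0 < 5 ^ k by apply: pow_lt; lra.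
have A0 : 0 <= K * 5 ^ k * M by apply: Rmult_le_pos; [apply: Rmult_le_pos|]; lra.
have N0 : 0 < N by rewrite /N; lra.
set eta := eps / N; have et0 : 0 < eta by apply: Rdiv_lt_0_compat.
exists (Rmin d (Rmin 1 (eta * eta))); split.
  by do 2 apply: Rmin_pos => //; nra.
move=> z Hz zd.
have z1 := Rlt_le_trans _ _ _ zd (Rmin_l _ _).
have z2 := Rlt_le_trans _ _ _ (Rlt_le_trans _ _ _ zd (Rmin_r _ _)) (Rmin_l _ _).
have z3 := Rlt_le_trans _ _ _ (Rlt_le_trans _ _ _ zd (Rmin_r _ _)) (Rmin_r _ _).
have z0 : 0 < Cmod z by apply/Cmod_gt_0/D1_neq0; case: Hz.
set x := - ln (Cmod z).
have x0 : 0 <= x.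
  by have : ln (Cmod z) < 0 by [rewrite -ln_1; apply: ln_increasing]; rewrite /x; lra.
have L : 1 + Cmod (Clog z) <= 5 * (1 + x).
  have := Clog_bound Hz.2; rewrite Rabs_left1 -/x; last by rewrite /x in x0; lra.
  lra.
have {}H := H z Hz z1; rewrite pow_1 in H.
have L2 : (1 + Cmod (Clog z)) ^ k <= 5 ^ k * (M * exp (x / 2)).
  apply: (Rle_trans _ ((5 * (1 + x)) ^ k)).
    by apply: pow_incr; have := log1_ge1 z; lra.
  rewrite Rpow_mult_distr; apply: Rmult_le_compat_l; first lra.
  exact: HM.
(* [y] is the square root of [Cmod z]; one of its two factors cancels [exp (x / 2)]. *)
set y := exp (- (x / 2)).
have y0 : 0 < y by exact: exp_pos.
have yy : y * y = Cmod z.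
  by rewrite /y -exp_plus (_ : _ + _ = ln (Cmod z)) ?exp_ln // /x; lra.
have ye : y * exp (x / 2) = 1.
  by rewrite /y -exp_plus Rplus_opp_l exp_0.
have B : Cmod (F z) <= K * 5 ^ k * M * y.
  apply: Rle_trans H _.
  apply: Rle_trans (Rmult_le_compat_l _ _ _ _ L2) _; first by apply: Rmult_le_pos; lra.
  apply: Req_le; rewrite -yy.
  transitivity (K * 5 ^ k * M * y * (y * exp (x / 2))); first by ring.
  by rewrite ye; ring.
have ylt : y < eta.
  by apply: Rnot_le_lt => C; nra.
apply: Rle_lt_trans B _.
have E : eps = N * eta by rewrite /eta; field; lra.
rewrite E /N.
have := Rmult_le_compat_l _ _ _ A0 (Rlt_le _ _ ylt); lra.
Qed.

(** The doubly slit plane is star-shaped about 1/2, a point between the two slits. *)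
Lemma D01_segment z t : inD01 z -> 0 <= t <= 1 -> inD01 (RtoC (/2) + RtoC t * (z - RtoC (/2)))%C.
Proof.
case: z => x y [H0 H1] Ht; move: H0 H1; rewrite /inD01 /D0 /D1 /Re /Im /= => H0 H1.
have Ey : 0 + (t * (y + - 0) + 0 * (x + - / 2)) = t * y by ring.
have Ex : / 2 + (t * (x + - / 2) - 0 * (y + - 0)) = / 2 + t * (x - / 2) by ring.
rewrite Ey Ex; split; move=> [Y X]; case: (Rmult_integral _ _ Y) => E.
- by rewrite E in X; lra.
- by apply: H0; split=> //; nra.
- by rewrite E in X; lra.
- by apply: H1; split=> //; nra.
Qed.

Lemma half_D01 : inD01 (RtoC (/2)).
Proof. by split; rewrite /D0 /D1 /Re /Im /=; lra. Qed.

Lemma D01_const F : (forall z, inD01 z -> CderivE F z (RtoC 0)) ->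
  forall z, inD01 z -> F z = F (RtoC (/2)).
Proof.
move=> H z Hz; apply: Csub_eq0; apply: Cmod_eq_0.
apply: Rle_antisym; last exact: Cmod_ge_0.
have := @segment_bound F (fun _ => RtoC 0) (RtoC (/2)) z 0; rewrite Rmult_0_r Rmult_0_l; apply.
move=> t Ht; rewrite Cmod_0; split; last lra.
by apply: H; exact: D01_segment.
Qed.

Lemma small_real_D01 del : 0 < del -> exists z, inD01 z /\ Cmod z < del.
Proof.
move=> d0; set x := Rmin (/2) (del / 2).
have x0 : 0 < x by apply: Rmin_pos; lra.
have x1 : x <= /2 := Rmin_l _ _. have x2 : x <= del / 2 := Rmin_r _ _.
exists (RtoC x); split; first by split; rewrite /D0 /D1 /Re /Im /=; lra.
by rewrite Cmod_R Rabs_pos_eq; lra.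
Qed.

(** A primitive on [D01] is determined by its limit at 0, although 0 is a boundary point. *)
Lemma D01_const_logO F c : (forall z, inD01 z -> CderivE F z (RtoC 0)) ->
  logO 1 (fun z => F z - c)%C -> forall z, inD01 z -> F z = c.
Proof.
move=> H G z Hz; apply: Csub_eq0; apply: Cmod_eps_eq0 => eps e0.
have [d [d0 Hd]] := logO_lim G e0; have [w [Hw wd]] := small_real_D01 d0.
rewrite (D01_const H Hz) -(D01_const H Hw).
by apply: Rlt_le; exact: Hd.
Qed.
End Growth.

Lemma logO_sum (I : Type) (r : seq I) p (f : I -> C -> C) :
  (forall i, logO p (f i)) -> logO p (fun z => \sum_(i <- r) f i z).
Proof.
move=> H; elim: r => [|i r IH].
  by apply: (@logO_ext _ (fun _ => RtoC 0)) (logO_zero p) => z _; rewrite big_nil.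
apply: (@logO_ext p (fun z => f i z + \sum_(i <- r) f i z)); first by move=> z _; rewrite big_cons.
exact: logO_plus.
Qed.

Lemma logO_cext p (h : seq bool -> C -> C) (a : Sxi) :
  (forall u, logO p (h u)) -> logO p (fun z => cext (fun u => h u z) a).
Proof.
move=> H; rewrite /cext /lin_ext.
apply: (@logO_sum _ (finmap.enum_fset (msupp a)) p (fun u t => a@_u * h u t)) => u.
exact: (logO_mult (logO_const _) (H u)).
Qed.

Lemma logO_pow F n : logO 0 F -> logO 0 (fun z => F z ^+ n).
Proof.
move=> H; elim: n => [|n IH]; first exact: logO_const.
apply: (@logO_ext _ (fun z => F z * F z ^+ n)); first by move=> z _; rewrite exprS.
exact: (logO_mult H IH).
Qed.

Lemma logO_logp n : logO 0 (logp n).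
Proof. exact: (logO_mult (logO_pow n logO_log) (logO_const _)). Qed.

Lemma logO_logli v k : logO 1 (logli v k).
Proof.
apply: logO_sum => m; apply: (logO_mult (logO_const _)).
rewrite -[X in logO X]addn0; apply: logO_mult (logO_logp _).
by apply: logO_cext => u; apply: logO_iter; rewrite last_rcons.
Qed.

(** The exponent is a boolean read as 0 or 1: a word containing xi1 vanishes at 0 up to logarithms,
    a power of xi0 need not. *)
Lemma logO_Lw w : logO (true \in w) (Lw w).
Proof.
case: (word_trailing w) => [[n ->]|[v [k ->]]].
  rewrite mem_nseq andbF.
  by apply: (@logO_ext _ (logp n)) (logO_logp n) => z _; rewrite Lw_zeros.
rewrite mem_cat inE eqxx orbT.
by apply: (@logO_ext _ (logli v k)) (logO_logli v k) => z _; rewrite Lw_logli.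
Qed.

Lemma logO_Lw0 w : logO 0 (Lw w).
Proof. by have := logO_Lw w; case: (true \in w) => //; exact: logO_weaken. Qed.

(** * Multiplicativity of the polylogarithms *)

Definition Lx (a : Sxi) (z : C) : C := cext (fun u => Lw u z) a.

Lemma LxW u z : Lx (W u) z = Lw u z.
Proof. exact: cextW. Qed.
Lemma LxL z : scalar_lin (K := C) (fun a => Lx a z).
Proof. exact: cextL. Qed.

Lemma Lx_deriv_letter i a z : inD01 z ->
  CderivE (Lx (letter_of W i * a)) z (form i z * Lx a z).
Proof.
move=> Hz; rewrite /Lx -cextZr.
apply: (@CderivE_ext (fun t => cext (fun u => Lw (i :: u) t) a)).
  by move=> t; exact: (esym (cext_letter (fun u => Lw u t) i a)).
exact: (deriv_cext _ (fun u => Lw_deriv i u Hz)).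
Qed.

Lemma logO_sumW (l : seq (seq bool)) : (forall x, x \in l -> true \in x) -> logO 1 (Lx (sumW W l)).
Proof.
move=> H.
have E z : Lx (sumW W l) z = \sum_(x <- l) Lw x z.
  elim: l {H} => [|x l IH]; first by rewrite /sumW !big_nil; exact: (scalar_lin0 (LxL z)).
  rewrite sumW_hd big_cons -IH -LxW; exact: (scalar_linD _ _ (LxL z)).
apply: (@logO_ext _ (fun z => \sum_(x <- l) Lw x z)) => [z _|]; first by rewrite E.
elim: l H {E} => [|x l IH] H.
  by apply: (@logO_ext _ (fun _ => RtoC 0)) (logO_zero 1) => z _; rewrite big_nil.
apply: (@logO_ext _ (fun z => Lw x z + \sum_(x <- l) Lw x z)); first by move=> z _; rewrite big_cons.
apply: logO_plus; last by apply: IH => y Hy; apply: H; rewrite inE Hy orbT.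
by have := logO_Lw x; rewrite H // inE eqxx.
Qed.

(** By induction on the total length, the shuffle recursion and the Leibniz rule give both sides the
    same derivative. If xi1 occurs, both sides are [logO 1], so the constant difference is 0. *)
Lemma Lx_hom_word n u v z : (size u + size v < n)%N -> inD01 z ->
  Lx (W u \sh W v) z = Lw u z * Lw v z.
Proof.
elim: n u v z => [|n IH] u v z Hn Hz; first by case: (notF Hn).
case: u Hn => [|i u] Hn; first by rewrite W_nil sh1l Lw_nil mul1r LxW.
case: v Hn => [|j v] Hn; first by rewrite W_nil sh1r Lw_nil mulr1 LxW.
(* Powers of xi0 do not tend to 0 at 0; for them the identity is computed from divided powers of the
   logarithm and binomial coefficients. *)
case Ht: (true \in (i :: u) ++ (j :: v)); last first.
  have Z w : (true \in w) = false -> w = nseq (size w) false.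
    elim: w => [//|[] w IHw]; first by rewrite inE eqxx.
    by rewrite inE => /IHw E; congr cons; exact: E.
  move: Ht; rewrite mem_cat => /norP [/negbTE /Z -> /negbTE /Z ->].
  rewrite shuffle_zeros !Lw_zeros.
  have -> : forall c b, Lx (c *: b) z = c * Lx b z.
    by move=> c b; have := LxL z c b 0; rewrite (scalar_lin0 (LxL z)) !addr0.
  rewrite LxW Lw_zeros /logp; set p := (size _ + size _)%N; set q := size (i :: u).
  set r := size (j :: v).
  rewrite [RHS]mulrACA -exprD [LHS]mulrCA; congr (_ * _).
  have F : ('C(p, q)%:R * (q`!%:R * r`!%:R))%R = p`!%:R :> C.
    by rewrite -!natrM -(bin_fact (leq_addr r q)) /p addKn.
  have nz k : (k`!%:R : C) != 0 by rewrite -(prednK (fact_gt0 k)); exact: natC_neq0.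
  rewrite -F -invfM [X in _ * X = _]invfM mulrA mulfV ?mul1r //.
  by apply/negP => /eqP C0; move: F; rewrite C0 mul0r => /esym/eqP; apply/negP/nz.
apply: Csub_eq0.
apply: (@D01_const_logO (fun z => Lx (W (i :: u) \sh W (j :: v)) z - Lw (i :: u) z * Lw (j :: v) z)%C) => // [t Ht1|].
  have S1 : (size u + size (j :: v) < n)%N by rewrite /= in Hn *; lia.
  have S2 : (size (i :: u) + size v < n)%N by rewrite /= in Hn *; lia.
  have dX := CderivE_eq (f_equal (fun x => form i t * x) (IH u (j :: v) t S1 Ht1))
    (Lx_deriv_letter i (W u \sh W (j :: v)) Ht1).
  have dY := CderivE_eq (f_equal (fun x => form j t * x) (IH (i :: u) v t S2 Ht1))
    (Lx_deriv_letter j (W (i :: u) \sh W v) Ht1).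
  apply: (CderivE_eq _ (CderivE_minus (@CderivE_ext _ (Lx (W (i :: u) \sh W (j :: v))) _ _ _ (deriv_add dX dY))
    (deriv_mul (Lw_deriv i u Ht1) (Lw_deriv j v Ht1)))).
    by rewrite -!mulrA [Lw (i :: u) t * (_ * _)]mulrCA; exact: Cplus_opp_r.
  move=> s; rewrite (shuffle_cons i u j v); exact: (esym (scalar_linD _ _ (LxL s))).
apply: (@logO_ext _ (fun t => Lx (W (i :: u) \sh W (j :: v)) t + (-1) * (Lw (i :: u) t * Lw (j :: v) t))).
  by move=> t _; rewrite mulN1r; exact: (esym (Csub0r _)).
apply: logO_plus.
  rewrite shuffle_shuf; apply: logO_sumW => x Hx.
  by rewrite (perm_mem (shuf_perm Hx)).
apply: (logO_mult (logO_const _)).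
move: Ht; rewrite mem_cat => /orP [] H; have := logO_Lw (i :: u); have := logO_Lw (j :: v); rewrite H.
- by move=> _ Hi; exact: (logO_mult Hi (logO_Lw0 (j :: v))).
- by move=> Hj _; exact: (logO_mult (logO_Lw0 (i :: u)) Hj).
Qed.

Lemma Lx_hom z : inD01 z -> forall a b, Lx (a \sh b) z = Lx a z * Lx b z.
Proof.
move=> Hz; apply: (shuffle_mult_hom (LxL z)) => u v.
by rewrite !LxW; exact: (Lx_hom_word (ltnSn _) Hz).
Qed.

Definition dual_word (u : seq bool) : seq bool := rev (map negb u).

(** The left-hand side of condition (i) with a prefix [u] already moved into the first factor: the
    sum over [w = ab] of the values of [tau (u a)] at [1 - z] times those of [b] at [z]. *)
Fixpoint connection (u w : seq bool) (z : C) : C :=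
  match w with
  | [::] => Lw (dual_word u) (1 - z)%C
  | i :: w' => (Lw (dual_word u) (1 - z)%C * Lw w z + connection (rcons u i) w' z)%R
  end.

Lemma D01_sym z : inD01 z -> inD01 (1 - z)%C.
Proof. by move=> [/D0_D1 H0 /D1_D0 H1]. Qed.

(** * The connection formula and zeta values *)

Lemma CminusE (x y : C) : Cminus x y = (x - y)%R.
Proof. by []. Qed.

Lemma CsubK1 (z : C) : (1 - (1 - z) = z)%C.
Proof. by rewrite !CminusE opprB addrCA subrr addr0. Qed.

Lemma deriv_reflect F z k : CderivE F (1 - z)%C k -> CderivE (fun t => F (1 - t)%C) z (- k)%R.
Proof.
move=> H; apply: (CderivE_eq (k := (- (1) * k)%C)); first exact: mulN1r.
apply: (@CderivE_comp F (fun t => 1 - t)%C) => //.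
apply: (@CderivE_ext (fun t => 1 + - (1) * t)%C).
  by move=> t; rewrite -[(_ + _)%C]/(1 + - 1 * t)%R mulN1r.
exact: CderivE_affine.
Qed.

Lemma dual_word_rcons u i : dual_word (rcons u i) = ~~ i :: dual_word u.
Proof. by rewrite /dual_word map_rcons rev_rcons. Qed.

Lemma form_reflect i (z : C) : form (~~ i) (1 - z)%C = form i z.
Proof. by case: i; rewrite /form /= ?CsubK1. Qed.

Lemma Lw_dual_word_deriv u i z : inD01 z ->
  CderivE (fun t => Lw (dual_word (rcons u i)) (1 - t)%C) z (- (form i z * Lw (dual_word u) (1 - z)%C)).
Proof.
move=> /D01_sym Hz; rewrite dual_word_rcons; apply: deriv_reflect.
by rewrite -(form_reflect i); exact: Lw_deriv.
Qed.

(** Moving the letter [i] from the right factor to the left one gives derivative terms [form i z] of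
    opposite signs. The sum telescopes, leaving only the derivative [k] of the initial left
    factor. *)
Lemma connection_deriv u w z k : inD01 z -> CderivE (fun t => Lw (dual_word u) (1 - t)%C) z k ->
  CderivE (connection u w) z (k * Lw w z).
Proof.
move=> Hz; elim: w u k => [|i w IH] u k Hk; first by rewrite Lw_nil mulr1.
apply: (CderivE_eq _ (deriv_add (deriv_mul Hk (Lw_deriv i w Hz)) (IH (rcons u i) _ (Lw_dual_word_deriv u i Hz)))).
by rewrite mulNr mulrCA mulrA addrK.
Qed.

Definition phi (w : seq bool) : C := connection [::] w (RtoC (/2)%coqR).

Lemma connection_phi w z : inD01 z -> connection [::] w z = phi w.
Proof.
move=> Hz; apply: (D01_const _ Hz) => t Ht.
apply: (CderivE_eq _ (connection_deriv (k := 0) w Ht _)); first exact: mul0r.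
apply: (@CderivE_ext (fun _ => 1)) => [s|]; first by rewrite /dual_word Lw_nil.
exact: CderivE_const.
Qed.

Lemma connection_deconc u w z : connection u w z =
  deconc W (fun a b => Lx (tau (W u * a)) (1 - z)%C * Lx b z) w.
Proof.
elim: w u => [|i w IH] u.
  by rewrite deconc_nil -W_cat cats0 tauW !LxW Lw_nil mulr1.
have E1 : Lx (tau (W u * W [::])) (1 - z)%C * Lx (W (i :: w)) z =
    Lw (dual_word u) (1 - z)%C * Lw (i :: w) z.
  by rewrite -(W_cat u [::]) cats0 tauW (LxW (rev _)) (LxW (i :: w)).
apply: esym; apply: (etrans (deconc_cons W_cat _ i w)).
apply: (f_equal2 +%R E1); apply: esym; apply: (etrans (IH (rcons u i))).
apply: eq_deconc => a b.
have -> : W (rcons u i) * a = W u * (letter_of W i * a) by rewrite mulrA /letter_of -(W_cat u [:: i]) cats1.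
exact: erefl.
Qed.

Definition phix (a : Sxi) : C := cext phi a.

Lemma phixL : scalar_lin (K := C) phix.
Proof. exact: cextL. Qed.
Lemma phixW u : phix (W u) = phi u.
Proof. exact: cextW. Qed.

Lemma Lx_tau_hom z : inD01 z -> scalar_lin (K := C) (fun a => Lx (tau a) z) /\
  forall a b, Lx (tau (a \sh b)) z = Lx (tau a) z * Lx (tau b) z.
Proof.
move=> Hz; split=> [c a b|a b]; first by rewrite tau_linear LxL.
by rewrite tau_shuffle Lx_hom.
Qed.

Lemma phix_hom (a b : Sxi) : phix (a \sh b) = phix a * phix b.
Proof.
have Hz := half_D01; have [tL tM] := Lx_tau_hom (D01_sym Hz).
have E x : phix x = cext (deconc W (fun a b => Lx (tau a) (1 - RtoC (/2)%coqR)%C * Lx b (RtoC (/2)%coqR))) x.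
  apply: eq_cext => u; rewrite /phi connection_deconc; apply: eq_deconc => c d.
  by rewrite W_nil mul1r.
rewrite !E; exact: (shuffle_conv_hom tL (LxL _) tM (Lx_hom Hz)).
Qed.

(** At [1 - t] the left factors are polylogarithms near 0 and supply the power [p]; the right ones,
    near 1, contribute at most logarithms. *)
Lemma logO_connection p u w :
  (forall s, logO p (Lw (dual_word (u ++ s)))) ->
  (forall v, (size v <= size w)%N -> logO 0 (fun t => Lw v (1 - t)%C)) ->
  logO p (fun t => connection u w (1 - t)%C).
Proof.
elim: w u => [|i w IH] u Hu Hv.
  apply: (@logO_ext _ (Lw (dual_word (u ++ [::])))) (Hu [::]) => z _.
  by rewrite cats0 /= CsubK1.
apply: (@logO_ext _ (fun t => Lw (dual_word u) t * Lw (i :: w) (1 - t)%C + connection (rcons u i) w (1 - t)%C)).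
  by move=> z _; rewrite /= CsubK1.
apply: logO_plus.
  rewrite -[X in logO X]addn0; apply: logO_mult; last exact: Hv.
  by have := Hu [::]; rewrite cats0.
apply: IH => [s|v Hs]; first by rewrite cat_rcons; exact: Hu.
by apply: Hv; exact: leqW.
Qed.

Lemma Lw_connection i w z : inD01 z -> Lw (i :: w) z = phi (i :: w) - connection [:: i] w z.
Proof.
move=> Hz; rewrite -(connection_phi (i :: w) Hz) [connection [::] _ z]/=.
by rewrite /dual_word [rev _]/= Lw_nil mul1r addrK.
Qed.

(* Solving the connection formula for its first term bounds [Lw w] near 1 by the
   functions [Lw] near 0 and by shorter words. *)
Lemma logO_near1 w : logO 0 (fun t => Lw w (1 - t)%C).
Proof.
have [n] := ubnP (size w); elim: n w => // n IH [|i w] Hw.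
  by apply: (@logO_ext _ (fun _ => RtoC 1)) (logO_const _) => z _; rewrite Lw_nil.
apply: (@logO_ext _ (fun t => phi (i :: w) + (-1) * connection [:: i] w (1 - t)%C)).
  by move=> z /D01_sym Hz; rewrite Lw_connection // mulN1r.
apply: logO_plus (logO_const _) _; apply: (logO_mult (logO_const _)).
apply: logO_connection => [s|v Hv]; first exact: logO_Lw0.
by apply: IH; exact: leq_ltn_trans Hv Hw.
Qed.

(** In every other term of the connection sum the left word is the dual of a word starting with xi0.
    It contains xi1, so the term vanishes at [t = 0] up to logarithms. *)
Lemma logO_phi w : logO 1 (fun t => Lw (false :: w) (1 - t) - phi (false :: w))%C.
Proof.
apply: (@logO_ext _ (fun t => (-1) * connection [:: false] w (1 - t)%C)).
  by move=> z /D01_sym Hz; rewrite (Lw_connection false w Hz) mulN1r [RHS]CminusE [RHS]addrC addKr.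
apply: (logO_mult (logO_const _)); apply: logO_connection => [s|v _]; last exact: logO_near1.
by have := logO_Lw (dual_word ([:: false] ++ s)); rewrite /dual_word rev_cons mem_rcons inE eqxx.
Qed.

Lemma D01_lim_eq0 (c : C) F : logO 1 (fun t => F t - c)%C ->
  (forall eps, (0 < eps)%coqR -> exists del, (0 < del)%coqR /\
    forall t, (Cmod t < del)%coqR -> (Cmod (F t) < eps)%coqR) -> c = RtoC 0.
Proof.
move=> G H; apply: Cmod_eps_eq0 => eps e0.
have e2 : (0 < eps / 2)%coqR by lra.
have [d1 [d10 H1]] := logO_lim G e2; have [d2 [d20 H2]] := H _ e2.
have [z [Hz zd]] := small_real_D01 (Rmin_pos _ _ d10 d20).
have {}H1 := H1 z Hz (Rlt_le_trans _ _ _ zd (Rmin_l _ _)).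
have {}H2 := H2 z (Rlt_le_trans _ _ _ zd (Rmin_r _ _)).
have -> : c = (F z + - (F z - c))%C by rewrite -[RHS]/(F z - (F z - c))%R opprB addrC subrK.
have := Cmod_triangle (F z) (- (F z - c))%C; rewrite Cmod_opp; lra.
Qed.

Lemma D1_1 : D1 (RtoC 1).
Proof. by rewrite /D1 /Re /=; lra. Qed.

Lemma Clog_1 : Clog (RtoC 1) = RtoC 0.
Proof.
rewrite /Clog Cmod_1 ln_1 /Im /Re /=.
by have -> : (0 / (1 + 1) = 0)%coqR; [field|rewrite atan_0 Rmult_0_r].
Qed.

Lemma phi_xi0 : phi [:: false] = RtoC 0.
Proof.
apply: (D01_lim_eq0 (logO_phi [::])) => eps e0.
have [d [d0 Hd]] := Clog_continuous D1_1 e0.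
exists d; split=> // t Ht; rewrite Lw_xi0.
have := Hd (1 - t)%C; rewrite Clog_1 Csub0r; apply.
rewrite (_ : (1 - t - 1 = - t)%C) ?Cmod_opp //.
by rewrite -[LHS]/(1 - t - 1)%R [LHS]addrC addKr.
Qed.

(** At [z = 1/2] the connection sums of xi0 and xi1 consist of the same two terms. *)
Lemma phi_xi1 : phi [:: true] = RtoC 0.
Proof.
have E : (1 - RtoC (/2)%coqR = RtoC (/2)%coqR)%C.
  by rewrite /Cminus /Cplus /Copp /RtoC /=; apply: injective_projections => /=; lra.
rewrite -phi_xi0 /phi /connection E Lw_nil !mul1r; exact: addrC.
Qed.

Lemma phi_nil : phi [::] = 1.
Proof. by rewrite /phi /= /dual_word Lw_nil. Qed.

(** * Limits at 1 *)

Definition has_lim1 (a : Sxi) := logO 1 (fun t => Lx a (1 - t) - phix a)%C.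

Lemma has_lim1_lin (c : C) (a b : Sxi) : has_lim1 a -> has_lim1 b -> has_lim1 (c *: a + b).
Proof.
move=> Ha Hb; rewrite /has_lim1.
apply: (@logO_ext _ (fun t => c * (Lx a (1 - t)%C - phix a) + (Lx b (1 - t)%C - phix b))).
  move=> z _; rewrite LxL phixL [RHS]CminusE opprD mulrBr -!addrA; congr (_ + _).
  by rewrite addrCA.
exact: logO_plus (logO_mult (logO_const c) Ha) Hb.
Qed.

Lemma has_lim1_xi0 (a : Sxi) : has_lim1 (xi0 * a).
Proof.
rewrite -W_letter; move: a; apply: Sxi_ind => [|c a b Ha Hb|u].
- rewrite mulr0; apply: (@logO_ext _ (fun _ => RtoC 0)) (logO_zero 1) => z _.
  by rewrite (scalar_lin0 (LxL _)) (scalar_lin0 phixL) CminusE subr0.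
- have -> : W [:: false] * (c *: a + b) = c *: (W [:: false] * a) + W [:: false] * b.
    exact: (mulL mulZr).
  exact: has_lim1_lin.
- rewrite -(W_cat [:: false] u); apply: (@logO_ext _ _ _ _ (logO_phi u)) => z _.
  by rewrite LxW phixW.
Qed.

Lemma has_lim1_S10 x : S10 x -> has_lim1 x.
Proof.
move=> [c [b ->]]; rewrite -mulrA; apply: has_lim1_lin; last exact: has_lim1_xi0.
rewrite -W_nil; apply: (@logO_ext _ (fun _ => RtoC 0)) (logO_zero 1) => z _.
by rewrite LxW phixW phi_nil Lw_nil CminusE subrr.
Qed.

(** * Existence of the expansions behind [Li] and [reg10] *)

Lemma S0_iter c z : S0 c -> Lx c z = Li0 c z.
Proof.
move=> [k [b ->]]; rewrite LxL -[Li0 _ _]/(cext (fun u => iter_int u z) (k *: 1 + b * xi1)) cextL.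
apply: (f_equal2 +%R).
  by rewrite -W_nil LxW cextW Lw_nil.
rewrite -W_letter; move: b; apply: (scalar_eq (K := C) Sxi_ind) => [d a b|d a b|u].
- rewrite mulrDl -scalerAl; exact: LxL.
- rewrite mulrDl -scalerAl; exact: cextL.
- by rewrite -(W_cat u) cats1 LxW cextW Lw_iter // last_rcons.
Qed.

Lemma Lx_zeros j z : Lx (xi0 ^+ j) z = Clog z ^+ j / j`!%:R.
Proof. by rewrite xi_pow LxW Lw_zeros. Qed.

Lemma scalar_lin_sum (f : Sxi -> C) (I : Type) (r : seq I) (F : I -> Sxi) : scalar_lin f ->
  f (\sum_(i <- r) F i) = \sum_(i <- r) f (F i).
Proof.
move=> fL; elim: r => [|i r IH]; first by rewrite !big_nil; exact: scalar_lin0.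
by rewrite 2!big_cons -IH; exact: scalar_linD.
Qed.

(** Any expansion of [a] evaluates to [Lx a z], because [Lx] is multiplicative; so the value does
    not depend on which expansion is picked. *)
Lemma is_Li_Lx a z y : inD01 z -> is_Li a z y -> y = Lx a z.
Proof.
move=> Hz [n [c [Hc -> ->]]].
rewrite (scalar_lin_sum _ _ (LxL z)); apply: eq_bigr => j _.
by rewrite Lx_hom // Lx_zeros (S0_iter _ (Hc j)).
Qed.

(** The identity is required for every length from [N] on, so that two expansions can be added at a
    common length. *)
Definition expands0 (a : Sxi) := exists (c : nat -> Sxi) (N : nat), (forall j, S0 (c j)) /\
  forall m, (N <= m)%N -> a = \sum_(j < m.+1) c j \sh xi0 ^+ j.

Definition expands10 (a : Sxi) := exists (c : nat -> nat -> Sxi) (N : nat), (forall i j, S10 (c i j)) /\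
  forall n m, (N <= n)%N -> (N <= m)%N ->
    a = \sum_(i < n.+1) \sum_(j < m.+1) xi1 ^+ i \sh c i j \sh xi0 ^+ j.

Lemma sh0l (a : Sxi) : 0 \sh a = 0.
Proof. exact: (lin_0 (V := Sxi) (f := fun x => x \sh a) (fun c x y => shL c x y a)). Qed.
Lemma sh0r (a : Sxi) : a \sh 0 = 0.
Proof. exact: (lin_0 (V := Sxi) (f := fun x => a \sh x) (fun c x y => shR c a x y)). Qed.
Lemma shZl (c : C) (a b : Sxi) : (c *: a) \sh b = c *: (a \sh b).
Proof. exact: (lin_scale (V := Sxi) (f := fun x => x \sh b) (fun c x y => shL c x y b)). Qed.
Lemma shZr (c : C) (a b : Sxi) : a \sh (c *: b) = c *: (a \sh b).
Proof. exact: (lin_scale (V := Sxi) (f := fun x => a \sh x) (fun c x y => shR c a x y)). Qed.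
Lemma sh_suml (I : Type) (r : seq I) (F : I -> Sxi) (a : Sxi) :
  (\sum_(i <- r) F i) \sh a = \sum_(i <- r) (F i \sh a).
Proof. exact: (lin_bigsum (V := Sxi) (f := fun x => x \sh a) (fun c x y => shL c x y a)). Qed.
Lemma sh_sumr (I : Type) (r : seq I) (F : I -> Sxi) (a : Sxi) :
  a \sh (\sum_(i <- r) F i) = \sum_(i <- r) (a \sh F i).
Proof. exact: (lin_bigsum (V := Sxi) (f := fun x => a \sh x) (fun c x y => shR c a x y)). Qed.

Lemma S0_subspace : subspace (K := C) S0.
Proof.
split; first by exists 0, 0; rewrite scale0r mul0r addr0.
move=> c _ _ [k [b ->]] [k' [b' ->]]; exists (c * k + k'), (c *: b + b').
by rewrite scalerDr scalerA scalerDl mulrDl scalerAl; exact: add4_perm.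
Qed.

Lemma S10_subspace : subspace (K := C) S10.
Proof.
split; first by exists 0, 0; rewrite scale0r mulr0 mul0r addr0.
move=> c _ _ [k [b ->]] [k' [b' ->]]; exists (c * k + k'), (c *: b + b').
have -> : xi0 * (c *: b + b') = c *: (xi0 * b) + xi0 * b' by exact: (mulL mulZr).
by rewrite scalerDr scalerA scalerDl mulrDl scalerAl; exact: add4_perm.
Qed.

Lemma S0_W w : last true w -> S0 (W w).
Proof.
case/lastP: w => [_|w i]; first by exists 1, 0; rewrite mul0r addr0 scale1r W_nil.
rewrite last_rcons => ->; exists 0, (W w); rewrite scale0r add0r -W_letter.
by rewrite -(W_cat w) cats1.
Qed.

Lemma S10_W w : last false w -> S10 (W (false :: w)).
Proof.
case/lastP: w => [//|w i]; rewrite last_rcons => ->.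
exists 0, (W w); rewrite scale0r add0r -!W_letter.
by rewrite -(W_cat [:: false] w) -(W_cat (_ ++ w)) -cats1.
Qed.

Lemma S10_1 : S10 1.
Proof. by exists 1, 0; rewrite mulr0 mul0r addr0 scale1r. Qed.

Lemma xi0_step j : xi0 ^+ j \sh xi0 = (j.+1%:R : C) *: xi0 ^+ j.+1.
Proof. by rewrite !xi_pow -W_letter (shuffle_zeros j 1) addn1 binSn. Qed.

Lemma xi1_step j : xi1 \sh xi1 ^+ j = (j.+1%:R : C) *: xi1 ^+ j.+1.
Proof. by rewrite !xi_pow -W_letter shuffle_ones. Qed.

Lemma mul_xi0_step (x : Sxi) j :
  (x \sh xi0 ^+ j) \sh xi0 = ((j.+1%:R : C) *: x) \sh xi0 ^+ j.+1.
Proof. by rewrite (shuffleA x (xi0 ^+ j) xi0) xi0_step shZr shZl. Qed.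

Lemma mul_xi1_step (x y : Sxi) i :
  xi1 \sh ((xi1 ^+ i \sh x) \sh y) = (xi1 ^+ i.+1 \sh ((i.+1%:R : C) *: x)) \sh y.
Proof.
rewrite -(shuffleA xi1 (xi1 ^+ i \sh x) y) -(shuffleA xi1 (xi1 ^+ i) x) xi1_step.
by rewrite (shZl _ (xi1 ^+ i.+1) x) (shZr _ (xi1 ^+ i.+1) x).
Qed.

Lemma lin_sum (V : lmodType C) (k : C) n (f g : 'I_n -> V) :
  k *: (\sum_(j < n) f j) + \sum_(j < n) g j = \sum_(j < n) (k *: f j + g j).
Proof. by rewrite scaler_sumr big_split. Qed.

Lemma expands0_subspace : subspace (K := C) expands0.
Proof.
split.
  exists (fun _ => 0), 0%N; split; first by move=> _; exact: S0_subspace.1.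
  by move=> m _; rewrite big1 // => j _; rewrite sh0l.
move=> k a b [c [N [Hc Ha]]] [d [M [Hd Hb]]].
exists (fun j => k *: c j + d j), (maxn N M); split; first by move=> j; exact: S0_subspace.2.
move=> m; rewrite geq_max => /andP [/Ha {1}-> /Hb {1}->].
by rewrite lin_sum; apply: eq_bigr => j _; rewrite shL.
Qed.

Lemma expands0_xi0 a : expands0 a -> expands0 (a \sh xi0).
Proof.
move=> [c [N [Hc Ha]]].
exists (fun j => if j is j'.+1 then (j'.+1%:R : C) *: c j' else 0), N.+1; split.
  case=> [|j]; first exact: S0_subspace.1.
  by rewrite -[_ *: _]addr0; apply: S0_subspace.2 => //; exact: S0_subspace.1.
case=> [//|m] Hm; rewrite {1}(Ha m Hm) sh_suml [RHS]big_ord_recl [X in _ = X + _]sh0l add0r.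
apply: eq_bigr => j _.
exact: mul_xi0_step.
Qed.

Lemma expands0_S0 a : S0 a -> expands0 a.
Proof.
move=> Ha; exists (fun j => if j is 0%N then a else 0), 0%N; split.
  by case=> [//|j]; exact: S0_subspace.1.
move=> m _; rewrite big_ord_recl expr0 sh1r big1 ?addr0 // => j _; exact: sh0l.
Qed.

Lemma expands0_all a : expands0 a.
Proof.
move: a; apply: Sxi_ind; [exact: expands0_subspace.1|exact: expands0_subspace.2|move=> u].
have [n] := ubnP (size u); elim: n u => // n IH u Hu.
case: u Hu => [|i u] Hu; first by apply/expands0_S0/S0_W.
apply: (shuffle_gen_trailing (n := size u) expands0_subspace) => // [v Hv|t Ht Hl].
  by apply/expands0_xi0/IH; rewrite Hv.
by apply/expands0_S0/S0_W; case: t Ht Hl.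
Qed.

Lemma expands10_subspace : subspace (K := C) expands10.
Proof.
split.
  exists (fun _ _ => 0), 0%N; split; first by move=> _ _; exact: S10_subspace.1.
  by move=> n m _ _; rewrite big1 // => i _; rewrite big1 // => j _; rewrite sh0r sh0l.
move=> k a b [c [N [Hc Ha]]] [d [M [Hd Hb]]].
exists (fun i j => k *: c i j + d i j), (maxn N M); split; first by move=> i j; exact: S10_subspace.2.
move=> n m; rewrite !geq_max => /andP [N1 M1] /andP [N2 M2].
rewrite {1}(Ha n m N1 N2) {1}(Hb n m M1 M2).
rewrite lin_sum; apply: eq_bigr => i _; rewrite lin_sum; apply: eq_bigr => j _.
by rewrite (shR k _ (c i j) (d i j)) shL.
Qed.

Lemma expands10_xi0 a : expands10 a -> expands10 (a \sh xi0).
Proof.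
move=> [c [N [Hc Ha]]].
exists (fun i j => if j is j'.+1 then (j'.+1%:R : C) *: c i j' else 0), N.+1; split.
  move=> i [|j]; first exact: S10_subspace.1.
  by rewrite -[_ *: _]addr0; apply: S10_subspace.2 => //; exact: S10_subspace.1.
move=> n [//|m] Hn Hm; rewrite {1}(Ha n m (ltnW Hn) Hm) sh_suml; apply: eq_bigr => i _.
rewrite sh_suml [RHS]big_ord_recl [X in _ = X \sh _ + _]sh0r [X in _ = X + _]sh0l add0r; apply: eq_bigr => j _.
apply: (etrans (mul_xi0_step _ j)).
exact: (f_equal (fun x => x \sh xi0 ^+ j.+1) (esym (shZr _ (xi1 ^+ i) (c i j)))).
Qed.

Lemma expands10_xi1 a : expands10 a -> expands10 (xi1 \sh a).
Proof.
move=> [c [N [Hc Ha]]].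
exists (fun i j => if i is i'.+1 then (i'.+1%:R : C) *: c i' j else 0), N.+1; split.
  move=> [|i] j; first exact: S10_subspace.1.
  by rewrite -[_ *: _]addr0; apply: S10_subspace.2 => //; exact: S10_subspace.1.
move=> [//|n] m Hn Hm; rewrite {1}(Ha n m Hn (ltnW Hm)) sh_sumr [RHS]big_ord_recl.
rewrite [X in _ = X + _]big1 ?add0r => [|j _]; last by rewrite sh0r sh0l.
apply: eq_bigr => i _; rewrite sh_sumr; apply: eq_bigr => j _.
exact: mul_xi1_step.
Qed.

Lemma sh0_mid i j : xi1 ^+ i \sh 0 \sh xi0 ^+ j = 0.
Proof. by rewrite sh0r sh0l. Qed.
Lemma sh1_mid (a : Sxi) : xi1 ^+ 0 \sh a \sh xi0 ^+ 0 = a.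
Proof. by rewrite !expr0 (sh1l a) sh1r. Qed.

Lemma sum_first (V : zmodType) n (F : nat -> V) :
  (forall i, F i.+1 = 0) -> \sum_(i < n.+1) F i = F 0%N.
Proof. by move=> H; rewrite big_ord_recl big1 ?addr0 // => i _; exact: H. Qed.

Lemma expands10_S10 a : S10 a -> expands10 a.
Proof.
move=> Ha; pose c (i j : nat) : Sxi := if (i + j)%N is 0%N then a else 0.
exists c, 0%N; split.
  by rewrite /c => i j; case: (i + j)%N => [//|k]; exact: S10_subspace.1.
move=> n m _ _.
have Z i j : (i + j != 0)%N -> xi1 ^+ i \sh c i j \sh xi0 ^+ j = 0.
  by rewrite /c; case: (i + j)%N => [/notF//|k _]; exact: sh0_mid.
have H0 := @sum_first Sxi m (fun j => xi1 ^+ 0 \sh c 0%N j \sh xi0 ^+ j) (fun j => Z 0%N j.+1 isT).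
have H1 := @sum_first Sxi n (fun i => \sum_(j < m.+1) xi1 ^+ i \sh c i j \sh xi0 ^+ j).
apply: esym; apply: (etrans (H1 _)) => [i|]; first by apply: big1 => j _; exact: (Z i.+1 j isT).
exact: (etrans H0 (sh1_mid a)).
Qed.

Lemma expands10_all a : expands10 a.
Proof.
move: a; apply: Sxi_ind; [exact: expands10_subspace.1|exact: expands10_subspace.2|move=> u].
have [n] := ubnP (size u); elim: n u => // n IH u Hu.
case: u Hu => [|i u] Hu; first by apply: expands10_S10; rewrite W_nil; exact: S10_1.
apply: (shuffle_gen (n := size u) expands10_subspace) => // [v Hv|v Hv _|v _ Hl].
- by apply/expands10_xi0/IH; rewrite Hv.
- by apply/expands10_xi1/IH; rewrite Hv.
- by apply/expands10_S10/S10_W.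
Qed.

Lemma Li_Lx a z : inD01 z -> Li a z = Lx a z.
Proof.
move=> Hz; apply: (is_Li_Lx Hz); rewrite /Li; apply: epsilon_spec.
have [c [N [Hc Ha]]] := expands0_all a.
by eexists; exists N, c; split=> //; exact: Ha.
Qed.

Lemma reg10P a : is_reg10 a (reg10 a).
Proof.
rewrite /reg10; apply: epsilon_spec; have [c [N [Hc Ha]]] := expands10_all a.
by exists (c 0%N 0%N), N, c; split=> //; exact: Ha.
Qed.

Lemma phix_pow i n : phix (letter i ^+ n.+1) = 0.
Proof.
rewrite xi_pow; case: i.
  apply: (shuffle_hom_ones0 n phixL phix_hom).
  by rewrite -W_letter phixW phi_xi1.
rewrite (shuffle_hom_zeros _ phixL phix_hom); last by rewrite -W_nil phixW phi_nil.
by rewrite -W_letter phixW phi_xi0 exprS mul0r mul0r.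
Qed.

(** [phix] is multiplicative and kills all positive powers of xi0 and xi1, so of any expansion only
    the term [c 0 0] survives. *)
Lemma reg10_phix a : S10 (reg10 a) /\ phix a = phix (reg10 a).
Proof.
have [n [c [Hc Ea ->]]] := reg10P a; split; first exact: Hc.
rewrite {1}Ea (scalar_lin_sum _ _ phixL) big_ord_recl [X in _ + X]big1 ?addr0 => [|i _]; last first.
  rewrite (scalar_lin_sum _ _ phixL) big1 // => j _.
  by rewrite !phix_hom phix_pow !mul0r.
rewrite (scalar_lin_sum _ _ phixL) big_ord_recl [X in _ + X]big1 ?addr0 => [|j _]; last first.
  by rewrite !phix_hom phix_pow mulr0.
by rewrite !expr0 sh1l sh1r.
Qed.

(** * Zeta values as connection constants *)

Section Zeta.
Local Open Scope R_scope.

Lemma Cmod_dist_lt (x y z : C) e e' : Cmod (x - y)%C < e -> Cmod (x - z)%C < e' ->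
  Cmod (y - z)%C < e + e'.
Proof.
move=> H1 H2; have -> : (y - z = - (x - y) + (x - z))%C.
  by rewrite -[RHS]/(- (x - y) + (x - z))%R opprB addrA subrK.
by have := Cmod_triangle (- (x - y))%C (x - z)%C; rewrite Cmod_opp; lra.
Qed.

Lemma zeta_phix a : S10 a -> zeta a = phix a.
Proof.
move=> /has_lim1_S10 G.
have L eps : 0 < eps -> exists del, 0 < del /\ forall z, inD01 z -> Cmod (z - 1)%C < del ->
    Cmod (Li a z - phix a)%C < eps.
  move=> e0; have [d [d0 Hd]] := logO_lim G e0; exists d; split=> // z Hz zd.
  rewrite Li_Lx //; have := Hd _ (D01_sym Hz); rewrite CsubK1; apply.
  by rewrite -Cmod_opp (_ : (- (1 - z) = z - 1)%C) //; exact: opprB.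
apply: iota_unique => [y Hy|].
  (* Uniqueness of the limit, required by [iota]: points [1 - t] with small real [t > 0] lie in the
     domain and near 1. *)
  apply: Csub_eq0; apply: Cmod_eps_eq0 => eps e0.
  have s2 : 0 < sqrt 2 by apply: sqrt_lt_R0; lra.
  have e1 : 0 < eps / 2 / sqrt 2 by do 2 apply: Rdiv_lt_0_compat => //; lra.
  have [d1 Hd1] := Hy _ (locally_ball (T := C_UniformSpace) y (mkposreal _ e1)).
  have [d2 [d20 Hd2]] := L (eps / 2) ltac:(lra).
  have [t [Ht td]] := small_real_D01 (Rmin_pos _ _ (cond_pos d1) d20).
  have E : (1 - t - 1 = - t)%C by rewrite -[LHS]/(1 - t - 1)%R [LHS]addrC addKr.
  have K1 : Cmod (Li a (1 - t) - y)%C < eps / 2.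
    have := Hd1 (1 - t)%C _ (D01_sym Ht).
    have Hb : ball (RtoC 1 : C_UniformSpace) d1 (1 - t)%C.
      apply: C_NormedModule_mixin_compat1; rewrite -[minus _ _]/(1 - t - 1)%C E Cmod_opp.
      exact: Rlt_le_trans td (Rmin_l _ _).
    move=> /(_ Hb) /C_NormedModule_mixin_compat2 /=.
    by rewrite (_ : sqrt 2 * (eps / 2 / sqrt 2) = eps / 2); last by field; lra.
  have K2 := Hd2 _ (D01_sym Ht); rewrite E Cmod_opp in K2.
  have {}K2 := K2 (Rlt_le_trans _ _ _ td (Rmin_r _ _)).
  apply: Rle_trans (Rlt_le _ _ (Cmod_dist_lt K1 K2)) _; apply: Req_le; field.
move=> P [e He]; have [d [d0 Hd]] := L e (cond_pos e).
(* Half the radius, since a box of radius [d / 2] lies in the disc of radius [d]. *)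
have d2 : 0 < d / 2 by lra.
exists (mkposreal _ d2) => z Hz Dz; apply: He; apply: C_NormedModule_mixin_compat1.
apply: Hd => //; apply: Rlt_le_trans (C_NormedModule_mixin_compat2 _ _ _ Hz) _ => /=.
have : sqrt 2 <= 2.
  by rewrite -{2}(sqrt_square 2); [apply: sqrt_le_1_alt|]; lra.
nra.
Qed.
End Zeta.

Lemma zeta_reg10 (w : word) : zeta (reg10 << w >>) = phi w.
Proof. by rewrite word_W; have [H1 H2] := reg10_phix (W w); rewrite zeta_phix // -H2 phixW. Qed.

(** * Existence and uniqueness *)

Section Infinity.
Local Open Scope R_scope.

Lemma deriv_vanishes_eps D F : (forall eps, 0 < eps -> exists M, forall z, D z -> M < Cmod z ->
    Cmod (C_derive F z) < eps) -> deriv_vanishes D F.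
Proof.
move=> H P [e He]; have [M HM] := H e (cond_pos e).
exists M => z zM Dz; apply: He; apply: C_NormedModule_mixin_compat1.
by rewrite -[minus _ _]/(C_derive F z - 0)%C Csub0r; exact: HM.
Qed.

Lemma deriv_vanishes_bound D F : deriv_vanishes D F -> forall eps, 0 < eps ->
  exists M, forall z, D z -> M < Cmod z -> Cmod (C_derive F z) <= eps.
Proof.
move=> H eps e0; have e1 : 0 < eps / sqrt 2.
  by apply: Rdiv_lt_0_compat => //; apply: sqrt_lt_R0; lra.
have [M HM] := H _ (locally_ball (T := C_UniformSpace) (RtoC 0) (mkposreal _ e1)).
exists M => z Dz zM; have := HM z zM Dz => /C_NormedModule_mixin_compat2 /=.
rewrite -[minus _ _]/(C_derive F z - 0)%C Csub0r.
rewrite (_ : sqrt 2 * (eps / sqrt 2) = eps); first exact: Rlt_le.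
by field; have := sqrt_lt_R0 2; lra.
Qed.

(** This is the derivative of the integral of [xi0 v]: powers of the logarithm grow more slowly than
    the square root of [Cmod z], so dividing by [z] wins. *)
Lemma iter_int_decay v : last true v -> forall eps, 0 < eps -> exists M, forall z, D0 z ->
  M < Cmod z -> Cmod (form false z * iter_int v z)%C < eps.
Proof.
move=> Lv eps e0; have [K [n [K0 HK]]] := iter_int_growth Lv.
have [M [M0 HM]] := pow_le_exp n.
have p5 : 0 < 5 ^ n by apply: pow_lt; lra.
set N := K * (5 ^ n * M) + 1.
have A0 : 0 <= K * (5 ^ n * M) by apply: Rmult_le_pos => //; apply: Rmult_le_pos; lra.
have N0 : 0 < N by rewrite /N; lra.
(* 2 is the threshold of the growth bound; the other term makes the square root of [Cmod z] exceed
   [N / eps]. *)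
exists (Rmax 2 ((N / eps) * (N / eps))) => z Hz zM.
have z2 := Rle_lt_trans _ _ _ (Rmax_l _ _) zM.
have zN := Rle_lt_trans _ _ _ (Rmax_r _ _) zM.
set x := ln (Cmod z).
have x0 : 0 <= x by rewrite /x -ln_1; apply: ln_le; lra.
have H1 := HK z Hz (Rlt_le _ _ z2); rewrite -/x in H1.
have L : (5 + x) ^ n <= 5 ^ n * (M * exp (x / 2)).
  apply: (Rle_trans _ ((5 * (1 + x)) ^ n)); first by apply: pow_incr; lra.
  by rewrite Rpow_mult_distr; apply: Rmult_le_compat_l; [lra|exact: HM].
set y := exp (x / 2) in L.
have y0 : 0 < y := exp_pos _.
have yy : y * y = Cmod z by rewrite /y -exp_plus (_ : _ + _ = x) /x ?exp_ln; lra.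
have zn0 : z <> 0%C by apply/Cmod_gt_0; lra.
rewrite Cmod_mult [form false z]/(/ z)%C Cmod_inv // -yy.
have B : Cmod (iter_int v z) <= K * (5 ^ n * M) * y.
  by apply: Rle_trans H1 _; have := Rmult_le_compat_l _ _ _ K0 L; lra.
have yN : N / eps < y.
  have Ne : 0 < N / eps by apply: Rdiv_lt_0_compat.
  by rewrite -yy in zN; apply: Rnot_le_lt => C; nra.
have Ny : N < eps * y.
  by move/Rlt_div_l: yN => /(_ e0); lra.
apply: (Rle_lt_trans _ (/ (y * y) * (K * (5 ^ n * M) * y))).
  by apply: Rmult_le_compat_l => //; apply/Rlt_le/Rinv_0_lt_compat; nra.
have -> : / (y * y) * (K * (5 ^ n * M) * y) = K * (5 ^ n * M) / y by field; lra.
by apply/Rlt_div_l => //; rewrite /N in Ny; lra.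
Qed.
End Infinity.

Lemma S10_word w : S10 (W w) -> w = [::] \/ exists v, w = false :: v /\ last false v.
Proof.
move=> [c [b E]]; apply: NNPP => N.
(* A functional vanishing on all words of S10, hence on S10, and equal to 1 on [w] if [w] is not of
   the claimed shape. *)
pose g := cext (fun u => if (u == [::]) || (if u is false :: v then last false v else false)
  then 0 else (u == w)%:R).
have g1 : g 1 = 0 by rewrite -W_nil /g cextW eqxx.
have gb : g (xi0 * b * xi1) = 0.
  rewrite -!W_letter; move: b {E}; apply: (scalar_eq (K := C) (g := fun _ => 0) Sxi_ind) => [d a b|d a b|u].
  - have -> : W [:: false] * (d *: a + b) = d *: (W [:: false] * a) + W [:: false] * b.
      exact: (mulL mulZr).
    by rewrite mulrDl -scalerAl; exact: cextL.
  - by rewrite mulr0 addr0.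
  - rewrite -(W_cat [:: false] u) -(W_cat (_ ++ u)) /g cextW cats1 /=.
    by rewrite last_rcons.
have gw : g (W w) = 1.
  rewrite /g cextW eqxx; case: ifP => // H; case: N.
  move: H; case: (w) => [|[] v] //=; first by left.
  by move=> Hv; right; exists v.
have := congr1 g E; rewrite gw; have -> : g (c *: 1 + xi0 * b * xi1) = c * g 1 + g (xi0 * b * xi1).
  exact: cextL.
by rewrite g1 gb mulr0 addr0 => /eqP; rewrite oner_eq0.
Qed.

Lemma form_sub (u : seq bool) : << FMonom u >> = W u :> Sxi.
Proof. by rewrite WE. Qed.

Definition sol0 (z : D01) (a : Sxi) : C := Lx a z.
Definition sol1 (z : D01) (a : Sxi) : C := Lx a (1 - z)%C.

Lemma D01P (z : D01) : inD01 z.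
Proof. exact: (proj2_sig z). Qed.

Lemma Lx_shuffle_hom z : inD01 z -> shuffle_hom (fun a => Lx a z).
Proof.
move=> Hz; split; [exact: LxL| |exact: Lx_hom].
by rewrite -W_nil LxW Lw_nil.
Qed.

Lemma Lx_S10 w z : last true w -> Lx (W w) z = iter_int w z.
Proof. by move=> H; rewrite LxW Lw_iter. Qed.

Lemma last_true_false v : last false v -> last true v.
Proof. by case: v. Qed.

Lemma C_derive_const (c z : C) : C_derive (fun _ => c) z = 0.
Proof. apply: is_C_derive_unique; exact: CderivE_const. Qed.

Lemma S10_holo0 w : S10 (W w) -> deriv_vanishes D0 (iter_int w) /\ holoD0 (iter_int w).
Proof.
move=> /S10_word [->|[v [-> Hv]]].
  split; last by move=> z _; exists 0; exact: CderivE_const.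
  apply: deriv_vanishes_eps => eps e0; exists 0%coqR => z _ _.
  by rewrite (C_derive_const 1 z) Cmod_0.
split; last by apply: iter_int_holo; exact: Hv.
apply: deriv_vanishes_eps => eps e0.
have [M HM] := iter_int_decay (last_true_false Hv) e0.
exists (Rmax M 0) => z Hz zM.
have z0 : z <> 0%C by apply/Cmod_gt_0; exact: Rle_lt_trans (Rmax_r _ _) zM.
rewrite (is_C_derive_unique _ _ _ (@iter_int_deriv false v z Hv Hz z0)).
apply: HM => //; exact: Rle_lt_trans (Rmax_l _ _) zM.
Qed.

Lemma Cmod_reflect_gt M (z : C) : (M + 1 < Cmod z)%coqR -> (M < Cmod (1 - z)%C)%coqR.
Proof.
move=> H; have T : (Cmod z <= Cmod (- (1 - z))%C + Cmod 1)%coqR.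
  have E : z = (- (1 - z) + 1)%C by rewrite -[RHS]/(- (1 - z) + 1)%R opprB subrK.
  by rewrite {1}E; exact: Cmod_triangle.
by rewrite Cmod_opp Cmod_1 in T; lra.
Qed.

Lemma S10_holo1 w : S10 (W w) -> deriv_vanishes D1 (fun z => iter_int w (1 - z)%C) /\
  holomorphic D1 (fun z => iter_int w (1 - z)%C).
Proof.
move=> /S10_holo0 [V H]; split; last first.
  by move=> z /D1_D0 /H [l Hl]; exists (- l)%R; exact: deriv_reflect.
apply: deriv_vanishes_eps => eps e0.
have e2 : (0 < eps / 2)%coqR by lra.
have [M HM] := deriv_vanishes_bound V e2.
exists (M + 1)%coqR => z /D1_D0 Hz zM.
have [l Hl] := H _ Hz; rewrite (is_C_derive_unique _ _ _ (deriv_reflect Hl)).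
have {}HM := HM _ Hz; rewrite (is_C_derive_unique _ _ _ Hl) in HM.
rewrite -[(- l)%R]/(- l)%C Cmod_opp; apply: (Rle_lt_trans _ (eps / 2)%coqR); last lra.
apply: HM; exact: Cmod_reflect_gt.
Qed.

Lemma S10_last w : S10 (W w) -> last true w.
Proof. by move=> /S10_word [->|[v [-> Hv]]]. Qed.

Lemma solution_polylog : solution sol0 sol1.
Proof.
split.
- by move=> z; exact: Lx_shuffle_hom (D01P z).
- by move=> z; exact: Lx_shuffle_hom (D01_sym (D01P z)).
- by move=> z; rewrite /sol0 -W_letter LxW Lw_xi0.
- by move=> z; rewrite /sol1 -W_letter LxW Lw_xi0.
- move=> w z; rewrite zeta_reg10 -(connection_phi w (D01P z)) connection_deconc; apply: eq_bigr => k _.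
  by rewrite !form_sub W_nil mul1r.
- move=> w; rewrite word_W => H; have [V D] := S10_holo0 H.
  exists (iter_int w); split=> //; split=> // z.
  by rewrite /sol0 Lx_S10 // S10_last.
- move=> w; rewrite word_W => H; have [V D] := S10_holo1 H.
  exists (fun z => iter_int w (1 - z)%C); split=> //; split=> // z.
  by rewrite /sol1 Lx_S10 // S10_last.
- move=> w; rewrite word_W => H w0; have [V D] := S10_holo0 H.
  exists (iter_int w); split; first split=> // z.
    by rewrite /sol0 Lx_S10 // S10_last.
  have [E|[v [E Hv]]] := S10_word H; first by rewrite E in w0.
  by rewrite E; apply: iter_int_0.
Qed.

(** * Gluing across the two slits *)

Lemma D0_or_D1 z : D0 z \/ D1 z.
Proof.
case: (excluded_middle_informative (D0 z)) => [|H]; [by left|right=> [[_ H2]]; apply: H => [[_ H1]]; lra].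
Qed.

(* Conditions (ii) and (iii) may be witnessed by different extensions to D0. *)
Lemma cont_eq_at0 F G : holoD0 F -> holoD0 G -> (forall z, inD01 z -> F z = G z) ->
  F (RtoC 0) = G (RtoC 0).
Proof.
move=> HF HG E; apply: Csub_eq0; apply: Cmod_eps_eq0 => eps e0.
have [k Hk] := HF _ D0_0; have [l Hl] := HG _ D0_0.
have e2 : (0 < eps / 2)%coqR by lra.
have [d1 [d10 H1]] := CderivE_cont_eps Hk e2; have [d2 [d20 H2]] := CderivE_cont_eps Hl e2.
have [z [Hz zd]] := small_real_D01 (Rmin_pos _ _ d10 d20).
have K1 := H1 z; rewrite Csub0r in K1.
have K2 := H2 z; rewrite Csub0r -(E z Hz) in K2.
have {}K1 := K1 (Rlt_le_trans _ _ _ zd (Rmin_l _ _)).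
have {}K2 := K2 (Rlt_le_trans _ _ _ zd (Rmin_r _ _)).
apply: Rle_trans (Rlt_le _ _ (Cmod_dist_lt K1 K2)) _; lra.
Qed.

(* [F0 - G0] and [G1 - F1] glue to an entire function. *)
Lemma glued_liouville F0 G0 F1 G1 : holoD0 F0 -> holoD0 G0 -> holomorphic D1 F1 -> holomorphic D1 G1 ->
  deriv_vanishes D0 F0 -> deriv_vanishes D0 G0 -> deriv_vanishes D1 F1 -> deriv_vanishes D1 G1 ->
  (forall z, inD01 z -> F0 z - G0 z = - (F1 z - G1 z))%C ->
  F0 (RtoC 0) = RtoC 0 -> G0 (RtoC 0) = RtoC 0 -> forall z, inD01 z -> F0 z = G0 z.
Proof.
move=> hF0 hG0 hF1 hG1 vF0 vG0 vF1 vG1 E F00 G00 z Hz.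
have d0 t : D0 t -> CderivE (fun s => F0 s - G0 s)%C t (C_derive F0 t - C_derive G0 t)%C.
  by move=> Ht; apply: CderivE_minus; apply: C_derive_correct => //; [exact: hF0|exact: hG0].
have d1 t : D1 t -> CderivE (fun s => - (F1 s - G1 s))%C t (- (C_derive F1 t - C_derive G1 t))%C.
  move=> Ht; apply: (is_derive_opp (V := C_NormedModule)).
  by apply: CderivE_minus; apply: C_derive_correct => //; [exact: hF1|exact: hG1].
pose P s := if excluded_middle_informative (D0 s) then (F0 s - G0 s)%C else (- (F1 s - G1 s))%C.
pose dP s := if excluded_middle_informative (D0 s) then (C_derive F0 s - C_derive G0 s)%C
  else (- (C_derive F1 s - C_derive G1 s))%C.
have P0 s : D0 s -> (F0 s - G0 s)%C = P s by rewrite /P; case: excluded_middle_informative.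
have P1 s : D1 s -> (- (F1 s - G1 s))%C = P s.
  by rewrite /P; case: excluded_middle_informative => // H0 H1; rewrite E.
have PH s : CderivE P s (dP s).
  rewrite /dP; case: excluded_middle_informative => [H|H].
    exact: (CderivE_local D0_open H P0 (d0 s H)).
  have H1 : D1 s by case: (D0_or_D1 s).
  exact: (CderivE_local D1_open H1 P1 (d1 s H1)).
have PV eps : (0 < eps)%coqR -> exists M, forall s, (M < Cmod s)%coqR -> (Cmod (dP s) <= eps)%coqR.
  move=> e0; have e2 : (0 < eps / 2)%coqR by lra.
  have [M1 H1] := deriv_vanishes_bound vF0 e2; have [M2 H2] := deriv_vanishes_bound vG0 e2.
  have [M3 H3] := deriv_vanishes_bound vF1 e2; have [M4 H4] := deriv_vanishes_bound vG1 e2.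
  exists (Rmax (Rmax M1 M2) (Rmax M3 M4)) => s Hs.
  have S1 := Rle_lt_trans _ _ _ (Rle_trans _ _ _ (Rmax_l M1 M2) (Rmax_l _ _)) Hs.
  have S2 := Rle_lt_trans _ _ _ (Rle_trans _ _ _ (Rmax_r M1 M2) (Rmax_l _ _)) Hs.
  have S3 := Rle_lt_trans _ _ _ (Rle_trans _ _ _ (Rmax_l M3 M4) (Rmax_r _ _)) Hs.
  have S4 := Rle_lt_trans _ _ _ (Rle_trans _ _ _ (Rmax_r M3 M4) (Rmax_r _ _)) Hs.
  have T (x y : C) : (Cmod x <= eps / 2 -> Cmod y <= eps / 2 -> Cmod (x - y)%C <= eps)%coqR.
    by move=> Hx Hy; have := Cmod_triangle x (- y)%C; rewrite Cmod_opp /Cminus; lra.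
  rewrite /dP; case: excluded_middle_informative => [H|H].
    by apply: T; [exact: H1|exact: H2].
  have H1' : D1 s by case: (D0_or_D1 s).
  by rewrite Cmod_opp; apply: T; [exact: H3|exact: H4].
apply: Csub_eq0; rewrite (P0 z Hz.1) (liouville_deriv PH PV z (RtoC 0)) -(P0 _ D0_0) F00 G00.
exact: Csub0r.
Qed.

Lemma sub_from_sum (a b c d : C) : a + b = c + d -> (a - c = - (b - d))%C.
Proof.
move=> E; rewrite !CminusE -[RHS]/(- (b - d))%R opprB.
by apply/eqP; rewrite subr_eq addrAC -subr_eq opprK E addrC.
Qed.

Definition mkD01 z (H : inD01 z) : D01 := exist _ z H.

Lemma dual_word_dual_word u : dual_word (dual_word u) = u.
Proof.
by rewrite /dual_word map_rev revK -map_comp -[RHS]map_id; apply: eq_map => b /=; rewrite negbK.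
Qed.

Lemma size_dual_word u : size (dual_word u) = size u.
Proof. by rewrite size_rev size_map. Qed.

(** Duality preserves S10, so condition (ii) applies to [f0] on a word and to [f1] on its dual at
    the same time. *)
Lemma dual_word_S10 v : last false v -> exists v', dual_word (false :: v) = false :: v' /\ last false v' /\ size v' = size v.
Proof.
case/lastP: v => [//|v i]; rewrite last_rcons => ->.
exists (dual_word (false :: v)); split; first by rewrite -rcons_cons dual_word_rcons.
by rewrite size_dual_word size_rcons {1}/dual_word rev_cons last_rcons.
Qed.

Lemma sum_ends (V : zmodType) n (F : nat -> V) :
  \sum_(k < n.+2) F k = F 0%N + (\sum_(k < n) F k.+1 + F n.+1).
Proof. by rewrite big_ord_recl big_ord_recr. Qed.

(** * Uniqueness by induction on the length *)

Section Uniqueness.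
Variables f0 f1 g0 g1 : D01 -> Sxi -> C.
Hypotheses (Hf : solution f0 f1) (Hg : solution g0 g1).

Lemma sol_conn h0 h1 (H : solution h0 h1) w z :
  \sum_(k < (size w).+1) h1 z (W (dual_word (take k w))) * h0 z (W (drop k w)) = zeta (reg10 (W w)).
Proof.
rewrite -(word_W (FMonom w)) -(sol_connection H (FMonom w) z); apply: eq_bigr => k _.
by rewrite !form_sub tauW.
Qed.

Lemma sol_one0 h0 h1 (H : solution h0 h1) z : h0 z (W [::]) = 1.
Proof. by rewrite W_nil; case: (sol_hom0 H z). Qed.
Lemma sol_one1 h0 h1 (H : solution h0 h1) z : h1 z (W [::]) = 1.
Proof. by rewrite W_nil; case: (sol_hom1 H z). Qed.

(** The two extreme factorizations carry the full word; all others involve only shorter words and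
    cancel between two solutions that agree on those. *)
Lemma sol_conn_ends h0 h1 (H : solution h0 h1) i w z :
  h0 z (W (i :: w)) + h1 z (W (dual_word (i :: w))) = zeta (reg10 (W (i :: w))) -
    \sum_(k < size w) h1 z (W (dual_word (take k.+1 (i :: w)))) * h0 z (W (drop k.+1 (i :: w))).
Proof.
pose F k := h1 z (W (dual_word (take k (i :: w)))) * h0 z (W (drop k (i :: w))).
have E := sum_ends (size w) F; rewrite -(sol_conn H (i :: w) z).
apply: (etrans _ (f_equal (fun x => x - \sum_(k < size w) F k.+1) (esym E))).
rewrite {1 3}/F take0 drop0 (take_size (i :: w)) (drop_size (i :: w)).
by rewrite (sol_one1 H) (sol_one0 H) mul1r mulr1 addrA addrAC addrK.
Qed.

Definition agree (n : nat) := forall v, (size v <= n)%N -> forall z,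
  f0 z (W v) = g0 z (W v) /\ f1 z (W v) = g1 z (W v).

Lemma agree_ends n i w z : agree n -> (size w <= n)%N ->
  f0 z (W (i :: w)) + f1 z (W (dual_word (i :: w))) = g0 z (W (i :: w)) + g1 z (W (dual_word (i :: w))).
Proof.
move=> A Hw; rewrite (sol_conn_ends Hf) (sol_conn_ends Hg); congr (_ - _).
apply: eq_bigr => k _; have kw := ltn_ord k.
have [_ ->] := A (dual_word (take k.+1 (i :: w))) ltac:(rewrite size_dual_word size_takel /=; lia) z.
by have [-> _] := A (drop k.+1 (i :: w)) ltac:(rewrite size_drop /=; lia) z.
Qed.

(** The values on xi0 are prescribed; as [tau] exchanges the letters, condition (i) for one-letter
    words transfers agreement to xi1. *)
Lemma agree_letters z : (f0 z xi0 = g0 z xi0 /\ f0 z xi1 = g0 z xi1) /\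
  (f1 z xi0 = g1 z xi0 /\ f1 z xi1 = g1 z xi1).
Proof.
have E00 : f0 z xi0 = g0 z xi0 by rewrite (sol_log0 Hf) (sol_log0 Hg).
have E10 : f1 z xi0 = g1 z xi0 by rewrite (sol_log1 Hf) (sol_log1 Hg).
have A0 : agree 0.
  by case=> // _ t; rewrite (sol_one0 Hf) (sol_one0 Hg) (sol_one1 Hf) (sol_one1 Hg).
have C0 := @agree_ends 0 false [::] z A0 isT; have C1 := @agree_ends 0 true [::] z A0 isT.
have T0 : dual_word [:: false] = [:: true] by [].
have T1 : dual_word [:: true] = [:: false] by [].
move: C0 C1; rewrite T0 T1 !W_letter E00 E10.
by move=> /addrI -> /addIr ->.
Qed.

Lemma agree_S10 n v : agree n -> size v = n -> last false v -> forall z,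
  f0 z (W (false :: v)) = g0 z (W (false :: v)) /\
  f1 z (W (dual_word (false :: v))) = g1 z (W (dual_word (false :: v))).
Proof.
move=> A Hv Lv z; have [v' [E' [Lv' _]]] := dual_word_S10 Lv.
have S := S10_W Lv; have S' := S10_W Lv'; rewrite -E' in S'.
set w := false :: v in S S' E' *; set w' := dual_word w in S' *.
have W0 u : S10 (W u) -> S10 << FMonom u >> by rewrite form_sub.
have [F0 [[hF0 eF0] vF0]] := sol_holo0 Hf (W0 _ S).
have [G0 [[hG0 eG0] vG0]] := sol_holo0 Hg (W0 _ S).
have [F1 [[hF1 eF1] vF1]] := sol_holo1 Hf (W0 _ S').
have [G1 [[hG1 eG1] vG1]] := sol_holo1 Hg (W0 _ S').
have [F [[hF eF] zF]] := sol_init Hf (W0 _ S) isT.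
have [G [[hG eG] zG]] := sol_init Hg (W0 _ S) isT.
have sz : (size v <= n)%N by rewrite Hv.
have EE t : f0 t (W w) + f1 t (W w') = g0 t (W w) + g1 t (W w') := agree_ends false t A sz.
have E0 t : inD01 t -> F0 t = G0 t.
  apply: (glued_liouville hF0 hG0 hF1 hG1 vF0 vG0 vF1 vG1).
  - move=> s Hs; have := EE (mkD01 Hs); rewrite -!form_sub.
    rewrite -(eF0 (mkD01 Hs)) -(eG0 (mkD01 Hs)) -(eF1 (mkD01 Hs)) -(eG1 (mkD01 Hs)) /=.
    exact: sub_from_sum.
  - apply: etrans zF; apply: (cont_eq_at0 hF0 hF) => s Hs.
    by rewrite (eF0 (mkD01 Hs)) -(eF (mkD01 Hs)).
  - apply: etrans zG; apply: (cont_eq_at0 hG0 hG) => s Hs.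
    by rewrite (eG0 (mkD01 Hs)) -(eG (mkD01 Hs)).
have Ef : f0 z (W w) = g0 z (W w).
  by rewrite -!form_sub -(eF0 z) -(eG0 z); apply: E0; exact: D01P.
by split=> //; have := EE z; rewrite Ef => /addrI.
Qed.

Lemma agree_all n : agree n.
Proof.
elim: n => [|n A].
  by case=> // _ t; rewrite (sol_one0 Hf) (sol_one0 Hg) (sol_one1 Hf) (sol_one1 Hg).
move=> u; rewrite leq_eqVlt => /orP [/eqP Hu z|Hu]; last exact: A.
have [[a00 a01] [a10 a11]] := agree_letters z.
have [f0L _ f0M] := sol_hom0 Hf z; have [g0L _ g0M] := sol_hom0 Hg z.
have [f1L _ f1M] := sol_hom1 Hf z; have [g1L _ g1M] := sol_hom1 Hg z.
split.
- apply: (shuffle_gen (A := fun a => f0 z a = g0 z a) _ _ _ _ Hu).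
  + split; first by rewrite (scalar_lin0 f0L) (scalar_lin0 g0L).
    by move=> c a b Ha Hb; rewrite (f0L c a b) (g0L c a b) Ha Hb.
  + by move=> v Hv; rewrite f0M g0M a00 (A v _ z).1 // Hv.
  + by move=> v Hv _; rewrite f0M g0M a01 (A v _ z).1 // Hv.
  + by move=> v Hv Lv; exact: (agree_S10 A Hv Lv z).1.
- apply: (shuffle_gen (A := fun a => f1 z a = g1 z a) _ _ _ _ Hu).
  + split; first by rewrite (scalar_lin0 f1L) (scalar_lin0 g1L).
    by move=> c a b Ha Hb; rewrite (f1L c a b) (g1L c a b) Ha Hb.
  + by move=> v Hv; rewrite f1M g1M a10 (A v _ z).2 // Hv.
  + by move=> v Hv _; rewrite f1M g1M a11 (A v _ z).2 // Hv.
  (* [agree_S10] treats [f1] on duals only; each word of S10 is the dual of its own dual. *)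
  + move=> v Hv Lv; have [v' [E' [Lv' Sv']]] := dual_word_S10 Lv.
    have := (agree_S10 A (etrans Sv' Hv) Lv' z).2.
    by rewrite -E' dual_word_dual_word.
Qed.

Lemma solution_unique : f0 = g0 /\ f1 = g1.
Proof.
split; apply: funext => z; apply: funext => a; move: a; apply: (scalar_eq (K := C) Sxi_ind).
- by case: (sol_hom0 Hf z).
- by case: (sol_hom0 Hg z).
- by move=> u; exact: (agree_all (leqnn (size u)) z).1.
- by case: (sol_hom1 Hf z).
- by case: (sol_hom1 Hg z).
- by move=> u; exact: (agree_all (leqnn (size u)) z).2.
Qed.
End Uniqueness.

Theorem theorem10 :
  (exists! f : (D01 -> Sxi -> C) * (D01 -> Sxi -> C), solution f.1 f.2) /\
  (forall f0 f1 : D01 -> Sxi -> C, solution f0 f1 ->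
     forall (w : word) (z : D01),
       f0 z << w >> = Li << w >> z /\
       f1 z << w >> = Li << w >> (Cminus (RtoC 1) z)).
Proof.
split.
  exists (sol0, sol1); split=> [|[f0 f1] /= Hf]; first exact: solution_polylog.
  by have [-> ->] := solution_unique solution_polylog Hf.
move=> f0 f1 Hf w z; have [-> ->] := solution_unique Hf solution_polylog.
have Hz := D01P z.
by rewrite (Li_Lx _ Hz) (Li_Lx _ (D01_sym Hz)).
Qed.
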